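(* Let $(\kappa,\lambda)$ be an exponent pair, and let $c$ be a fixed real number with $$1<c<1+\frac{1-\lambda}{2\kappa-\lambda+3}.$$ Then, for every $\varepsilon>0$, the bound $$N_c(p)\le p^{1/(4(2-c)\sqrt{e})+\varepsilon}$$ holds for all sufficiently large primes $p$.
   Context: For a real number $c>1$ that is not an integer and a prime $p$, $N_c(p)$ denotes the least positive integer $n$ such that $\lfloor n^c\rfloor$ is a quadratic non-residue modulo $p$ (i.e. its Legendre symbol modulo $p$ equals $-1$). Here $\lfloor\cdot\rfloor$ is the floor function and $e$ is the base of the natural logarithm. ''For all sufficiently large primes $p$'' means for all primes $p\ge p_0$, where $p_0$ may depend on $\kappa,\lambda,c,\varepsilon$. Exponent pairs are understood in the standard sense (Graham and Kolesnik, ''Van der Corput's Method of Exponential Sums''). For positive reals $N,y,s$, a nonnegative integer $P$ and a positive real $\epsilon<1/2$, let $\mathbf{F}(N,P,s,y,\epsilon)$ be the set of real functions $f$ that are defined and have $P$ continuous derivatives on some interval $[a,b]\subseteq[N,2N]$ and satisfy, for all integers $0\le j\le P-1$ and all $a\le x\le b$, $$\left|f^{(j+1)}(x)-(-1)^j (s)_j\, y\, x^{-s-j}\right|<\epsilon\,(s)_j\, y\, x^{-s-j},$$ where $(s)_0=1$ and $(s)_j=s(s+1)\cdots(s+j-1)$ for $j\ge1$. A pair $(\kappa,\lambda)$ of real numbers with $0\le\kappa\le 1/2\le\lambda\le 1$ is an exponent pair if for each $s>0$ there exist a nonnegative integer $P=P(\kappa,\lambda,s)$ and a positive real $\epsilon=\epsilon(\kappa,\lambda,s)<1/2$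 such that for every $N>0$, every $y>0$ and every $f\in\mathbf{F}(N,P,s,y,\epsilon)$ (with associated interval $[a,b]$), $$\left|\sum_{a<n\le b}\exp(2\pi i f(n))\right|\le C\left((yN^{-s})^{\kappa}N^{\lambda}+y^{-1}N^{s}\right),$$ where $C>0$ depends only on $\kappa,\lambda,s$. *)

(* Defs.v *)
From mathcomp Require Import all_boot all_order all_algebra.
From mathcomp Require Import all_classical all_reals all_analysis.
From mathcomp Require Export complex.

Set Implicit Arguments.
Unset Strict Implicit.
Unset Printing Implicit Defensive.

Import Order.TTheory GRing.Theory Num.Theory numFieldNormedType.Exports.

Local Open Scope classical_set_scope.
Local Open Scope ring_scope.

Definition legendre (a : int) (p : nat) : int :=
  if (p %| a)%Z then 0
  else if [exists x : 'I_p, (x%:Z ^+ 2 == a %[mod p])%Z] then 1 else -1.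

(* [is_Nc c p n] means "N_c(p) exists and equals n". *)
Definition is_Nc (R : realType) (c : R) (p n : nat) : Prop :=
  let nonresidue k := legendre (Num.floor (k%:R `^ c)) p = -1 in
  [/\ (0 < n)%N, nonresidue n &
      forall m : nat, (0 < m)%N -> nonresidue m -> (n <= m)%N].

(* Derivatives relative to a set A: the difference quotient is taken along
   points of A only, hence one-sidedly at the endpoints when A = [a, b]. *)
Definition diff_quot (R : realType) (f : R -> R) (x y : R) : R :=
  (f y - f x) / (y - x).

Definition derivable_on (R : realType) (A : set R) (f : R -> R) : Prop :=
  forall x, A x -> cvg (diff_quot f x y @[y --> within A x^']).

Definition derive_on (R : realType) (A : set R) (f : R -> R) : R -> R :=
  fun x => lim (diff_quot f x y @[y --> within A x^']).

Definition derive_n_on (R : realType) (A : set R) (j : nat) (f : R -> R) :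
  R -> R := iter j (derive_on A) f.

Definition has_n_cont_derivatives (R : realType) (A : set R) (P : nat)
    (f : R -> R) : Prop :=
  forall j : nat, (j < P)%N ->
    derivable_on A (derive_n_on A j f) /\
    {within A, continuous (derive_n_on A j.+1 f)}.

Definition pochhammer (R : realType) (s : R) (j : nat) : R :=
  \prod_(i < j) (s + i%:R).

(* f belongs to F(N, P, s, y, eps) with associated interval [a, b]; only the
   values of f on [a, b] matter.  A degenerate interval a = b would only
   contribute an empty exponential sum. *)
Definition in_F (R : realType) (N : R) (P : nat) (s y eps a b : R)
    (f : R -> R) : Prop :=
  [/\ a < b, `[a, b] `<=` `[N, 2 * N],
      has_n_cont_derivatives `[a, b] P f &
      forall (j : nat) (x : R), (j < P)%N -> a <= x <= b ->
        `| derive_n_on `[a, b] j.+1 f x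
           - (-1) ^+ j * pochhammer s j * y * x `^ (- s - j%:R) |
        < eps * pochhammer s j * y * x `^ (- s - j%:R)].

(* e^(it) *)
Definition expi (R : realType) (t : R) : R[i] := Complex (cos t) (sin t).

(* The range is cut at floor(b) only to make the sum finite; negative n are
   absent because a >= N > 0 in all uses. *)
Definition exp_sum (R : realType) (a b : R) (f : R -> R) : R[i] :=
  \sum_(0 <= n < (Num.truncn b).+1 | a < n%:R <= b) expi (2 * pi * f n%:R).

Definition exponent_pair (R : realType) (kappa lambda : R) : Prop :=
  [/\ 0 <= kappa, kappa <= 1 / 2, 1 / 2 <= lambda, lambda <= 1 &
   forall s : R, 0 < s ->
   exists (P : nat) (eps C : R),
     [/\ 0 < eps, eps < 1 / 2, 0 < C &
      forall (N y a b : R) (f : R -> R), 0 < N -> 0 < y ->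
        in_F N P s y eps a b f ->
        `| exp_sum a b f | <=
          (C * ((y * N `^ (- s)) `^ kappa * N `^ lambda
                + y^-1 * N `^ s))%:C%C]].

(* Main.v *)
(* To make [floor (n ^ c)] a nonresidue it suffices that it equals [q * k ^ 2] with [q] a nonresidue
   and [k] a prime smaller than [p].  This happens as soon as the fractional part of
   [(q * k ^ 2) ^ (1 / c)] lies in a short interval below [1], and for all but [Y ^ (1 - xi)] of the
   integers [q] in [(Y, 2Y]] some prime [k] slightly larger than [Y ^ ((c - 1) / (2 - c))] achieves
   it, with [n] about [Y ^ (1 / (2 - c))].  This is a second moment estimate over [q]: expanding a
   trigonometric minorant of the interval and squaring leads to phases [q ^ (1 / c) * y] with
   [y = h1 * k1 ^ (2 / c) - h2 * k2 ^ (2 / c)], which the exponent pair controls unless [y] is small,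
   and [y] is rarely small because the quotients [k1 / k2] of distinct primes are well spaced.

   It remains to find [Y <= p ^ (1 / (4 sqrt e) + eps)] for which [(Y, 2Y]] contains more than
   [Y ^ (1 - xi)] nonresidues.  By Burgess' estimate about half of the integers up to [p ^ (1/4 + eps)]
   are nonresidues; each has a prime nonresidue factor, so by Mertens' theorem and Vinogradov's trick
   the sum of [1 / q] over the prime nonresidues [q <= p ^ (1 / (4 sqrt e) + eps)] is bounded below,
   and some dyadic block is rich -- unless there is a very small nonresidue [q0], and then
   multiplication by [q0] turns residues into nonresidues.  Burgess' estimate rests on Weil's bound
   for [\sum_u chi (f u)], of which only the upper bound is needed; it is proved by Stepanov's
   method. *)
Require Import Defs.
From mathcomp Require Import all_boot all_order all_algebra.
From mathcomp Require Import all_classical all_reals all_analysis.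
From mathcomp Require Import finfield zify ring lra.
Set Implicit Arguments.
Unset Strict Implicit.
Unset Printing Implicit Defensive.
Import Order.TTheory GRing.Theory Num.Theory numFieldNormedType.Exports.
Local Open Scope ring_scope.

(** * Stepanov's method for quadratic characters *)

(** Put s = 1 - 1/c and tau = (c - 1) / (2 - c), so that s (1 + 2 tau) = tau. For q near Y and k
    near K = Y^tau the interval for the fractional part has length about (Y K^2)^(-s) = Y^(-tau), so
    the minorant has about H = Y^tau harmonics, and tau is the exponent at which there are as many k
    as harmonics. The normalized second moment is H^2 G + Y H / K, where G is the exponent pair
    bound for y up to H K^(2/c). The main part of H^2 G is Y^(2 tau + 2 kappa tau + lambda), and
    asking this exponent to be below 1 is exactly the hypothesis on c. The term Y H / K comes from
    small y and saves a power of Y as soon as K slightly exceeds Y^tau.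

    The saving Y^(-xi) has to pay for about log p dyadic blocks, so the blocks must start at a power
    of p; this is why a very small nonresidue is a separate case. The constant sqrt e appears
    because the primes between p^b and p^a have reciprocal sum close to ln (a / b), and this has to
    stay below 1/2, the density of nonresidues. *)

Lemma derivn_mul_XsubC (F : comNzRingType) (g : {poly F}) (u : F) (M : nat) :
  (derivn M (g * ('X - u%:P) ^+ M)).[u] = g.[u] * M`!%:R.
Proof.
elim: M g => [|M IH] g; first by rewrite expr0 !mulr1 derivn0.
have D : deriv (g * ('X - u%:P) ^+ M.+1)
    = (deriv g * ('X - u%:P) + g *+ M.+1) * ('X - u%:P) ^+ M.
  rewrite derivM deriv_exp derivXsubC mul1r exprS /=.
  by rewrite [RHS]mulrDl -mulrA mulrnAr mulrnAl.
rewrite derivSn D IH hornerD hornerM hornerXsubC subrr mulr0 add0r hornerMn.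
by rewrite factS natrM mulrA [_ * M.+1%:R]mulr_natr.
Qed.

Section Stepanov.
Variables (F : finFieldType) (p : nat).
Hypotheses (Fp : p \in [pchar F]) (cardF : #|F| = p).
Implicit Types (f r s : {poly F}) (u : F).

Let p_pr : prime p. Proof. by case/andP: Fp. Qed.

Lemma natF_neq0 n : (0 < n < p)%N -> n%:R != 0 :> F.
Proof.
move=> /andP[n0 np]; rewrite -(dvdn_pcharf Fp); apply/negP => /dvdn_leq.
by move=> /(_ n0); rewrite leqNgt np.
Qed.

Lemma factF_neq0 M : (M < p)%N -> M`!%:R != 0 :> F.
Proof.
elim: M => [|M IH] Mp; first by rewrite fact0 oner_eq0.
by rewrite factS natrM mulf_neq0 ?IH ?natF_neq0 // ltnW.
Qed.

(** In characteristic [p] derivatives detect multiplicities only up to [p]: the induction cancels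
    [k!] for [k < M]. *)
Lemma dvdp_Xsub_derivn f u M : (M <= p)%N ->
  (forall k, (k < M)%N -> (derivn k f).[u] = 0) -> ('X - u%:P) ^+ M %| f.
Proof.
elim: M f => [|M IH] f leM Hk; first by rewrite expr0 dvd1p.
have /dvdpP[g Dg] : ('X - u%:P) ^+ M %| f.
  by apply: IH => [|k kM]; [exact: ltnW|apply: Hk; exact: ltnW].
have := Hk M (ltnSn M); rewrite {1}Dg derivn_mul_XsubC => /eqP.
rewrite mulf_eq0 (negPf (factF_neq0 leM)) orbF => gu.
by rewrite Dg exprS dvdp_mul // dvdp_XsubCl.
Qed.

Lemma dvdp_prod_XsubX f M (rs : seq F) : uniq rs ->
  (forall u, u \in rs -> ('X - u%:P) ^+ M %| f) ->
  \prod_(u <- rs) ('X - u%:P) ^+ M %| f.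
Proof.
elim: rs => [|u rs IH] /=; first by rewrite big_nil dvd1p.
case/andP => unin urs Hd; rewrite big_cons Gauss_dvdp.
  by rewrite Hd ?mem_head //= IH // => v vrs; apply: Hd; rewrite inE vrs orbT.
apply: coprimep_expl; rewrite coprimep_sym.
elim: rs unin {urs Hd IH} => [|v rs IH]; first by rewrite big_nil coprime1p.
rewrite inE negb_or big_cons coprimepMl => /andP[uv /IH ->]; rewrite andbT.
apply: coprimep_expl; by rewrite coprimep_XsubC root_XsubC.
Qed.

Lemma Frobenius_poly_mod f : exists g, f ^+ p = (f.[0])%:P + g * 'X^p.
Proof.
have pc : p \in [pchar {poly F}].
  rewrite inE; case/andP: Fp => -> /eqP e; by rewrite -polyC_natr e polyC0 eqxx.
have /factor_theorem[h Dh] : root (f - (f.[0])%:P) 0.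
  by rewrite rootE hornerD hornerN hornerC subrr.
rewrite polyC0 subr0 in Dh; exists (h ^+ p).
rewrite -[f in LHS](subrK (f.[0])%:P) Dh addrC.
rewrite -(pFrobenius_autE pc) pFrobenius_autD_comm; last exact: mulrC.
by rewrite !pFrobenius_autE exprMn -polyC_exp -cardF expf_card.
Qed.

Lemma size_sqr_leq r D : (size r <= D)%N -> (size (r ^+ 2) <= D.*2.-1)%N.
Proof.
have [->|r0] := eqVneq r 0; first by rewrite expr0n /= size_poly0.
by move=> rD; rewrite expr2 size_mul // -!subn1 leq_sub2r // -addnn leq_add.
Qed.

Lemma dvdXn_eq0 r : (size r <= p)%N -> 'X^p %| r -> r = 0.
Proof.
move=> rp pr; apply/eqP; apply: contraTT rp => r0.
by rewrite -ltnNge; move: (dvdp_leq r0 pr); rewrite size_polyXn.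
Qed.

Lemma odd_mup_sqr_neq f r s (b a : F) : a != 0 -> f != 0 -> odd (mup b f) ->
  r ^+ 2 * f = a%:P * s ^+ 2 -> r = 0 /\ s = 0.
Proof.
move=> a0 f0 ob E.
have [r0|r0] := eqVneq r 0.
  move: E; rewrite r0 expr0n mul0r => /esym/eqP; rewrite mulf_eq0 polyC_eq0.
  by rewrite (negPf a0) /= sqrf_eq0 => /eqP.
have [s0|s0] := eqVneq s 0.
  move: E; rewrite s0 expr0n mulr0 => /eqP; rewrite mulf_eq0 (negPf f0) orbF.
  by rewrite sqrf_eq0 (negPf r0).
move: (congr1 (fun q => odd (mup b q)) E) => /=.
rewrite !expr2 !mupM ?mulf_neq0 ?polyC_eq0 // !oddD ob.
rewrite [mup b a%:P]mupNroot ?rootC //=.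
by rewrite !addbb.
Qed.

(* Modulo ['X^p] the factor [f ^+ p] is the constant [f.[0]], so [r 0 ^+ 2 * f = f.[0] * s 0 ^+ 2],
   which forces [r 0 = s 0 = 0] by parity of the multiplicity of [b]; then divide by ['X^p]. *)
Lemma stepanov_nonvanish f J D (r s : nat -> {poly F}) (b : F) :
  f.[0] != 0 -> odd (mup b f) -> (D.*2 + size f <= p)%N ->
  (forall j, size (r j) <= D)%N -> (forall j, size (s j) <= D)%N ->
  (\sum_(j < J) r j * 'X^(j * p)) ^+ 2 * f =
    f ^+ p * (\sum_(j < J) s j * 'X^(j * p)) ^+ 2 ->
  forall j, (j < J)%N -> r j = 0 /\ s j = 0.
Proof.
move=> f00 ob Dp; have f0 : f != 0 by apply: contraNneq f00 => ->; rewrite horner0.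
elim: J r s => [|J IH] r s sr ss E j //.
have DS (t : nat -> {poly F}) : \sum_(j < J.+1) t j * 'X^(j * p) =
    t 0%N + (\sum_(j < J) t j.+1 * 'X^(j * p)) * 'X^p.
  rewrite big_ord_recl /= mul0n expr0 mulr1; congr (_ + _); rewrite mulr_suml.
  by apply: eq_bigr => i _; rewrite -mulrA -exprD /bump /= add1n mulSn addnC.
move: E; rewrite !DS; set A := \sum_(j < J) _; set B := \sum_(j < J) _ => E.
have [g Dg] := Frobenius_poly_mod f.
have Z : r 0%N ^+ 2 * f - (f.[0])%:P * s 0%N ^+ 2 = 0.
  have aux x y : (x <= D.*2.-1 -> D.*2 + y <= p -> (x + y).-1 <= p)%N by lia.
  apply: dvdXn_eq0.
    apply: leq_trans (size_polyD _ _) _; rewrite size_polyN geq_max.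
    apply/andP; split.
      apply: leq_trans (size_polyMleq _ _) _.
      apply: (aux _ _ _ Dp); exact: (size_sqr_leq (sr 0%N)).
    rewrite mul_polyC; apply: leq_trans (size_scale_leq _ _) _.
    by apply: leq_trans (size_sqr_leq (ss 0%N)) _; move: (size f) Dp => x; lia.
  (* The quotient results from expanding both squares in [E], writing [f ^+ p] as [f.[0] + g * 'X^p]
     and collecting the multiples of ['X^p]. *)
  apply/dvdpP; exists (f.[0]%:P * (s 0%N * B *+ 2 + B ^+ 2 * 'X^p)
     + g * (s 0%N + B * 'X^p) ^+ 2 - (r 0%N * A *+ 2 + A ^+ 2 * 'X^p) * f).
  apply/eqP; rewrite -subr_eq0.
  have -> : forall x, x = ((r 0%N + A * 'X^p) ^+ 2 * f - f ^+ p * (s 0%N + B * 'X^p) ^+ 2) -> x == 0.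
    by move=> x ->; rewrite E subrr.
  done.
  rewrite Dg; ring.
have [r0 s0] : r 0%N = 0 /\ s 0%N = 0.
  by move/eqP: Z; rewrite subr_eq0 => /eqP; apply: odd_mup_sqr_neq ob.
case: j => [//|j jJ].
apply: (IH (fun j => r j.+1) (fun j => s j.+1)) => // {j jJ}.
rewrite -/A -/B; move: E; rewrite r0 s0 !add0r !exprMn => E.
have X0 : ('X^p ^+ 2 : {poly F}) != 0 by rewrite !expf_neq0 // polyX_eq0.
by apply: (mulIf X0); rewrite mulrAC E mulrA.
Qed.

(* [derivn k (f ^+ a * r) = f ^+ (a - k) * dfactor f a k r]. *)
Fixpoint dfactor f (a k : nat) r : {poly F} :=
  if k is k'.+1 then
    (dfactor f a k' r * deriv f) *+ (a - k') + f * deriv (dfactor f a k' r)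
  else r.

(** The factor [z] behaves as a constant. It will be ['X^(j * p)], so the high powers of ['X] never
    enter [dfactor] and degrees stay low. *)
Lemma dfactorP f a k r z : (k <= a)%N -> deriv z = 0 ->
  derivn k (f ^+ a * r * z) = f ^+ (a - k) * dfactor f a k r * z.
Proof.
move=> ka z0; elim: k ka => [|k IH] ka; first by rewrite derivn0 subn0.
rewrite derivnS IH; last exact: ltnW.
rewrite derivM z0 mulr0 addr0; congr (_ * _); rewrite derivM deriv_exp /=.
have -> : (a - k = (a - k.+1).+1)%N by lia.
rewrite /= exprS.
set t := dfactor _ _ _ _; rewrite [RHS]mulrDr mulrnAr mulrnAl.
set g := f ^+ _; congr (_ *+ _ + _); first by rewrite mulrC [_ * g]mulrC mulrCA.
by rewrite -mulrA mulrCA.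
Qed.

Lemma dfactorD f a k r s : dfactor f a k (r + s) = dfactor f a k r + dfactor f a k s.
Proof.
by elim: k => [//|k /= ->]; rewrite derivD mulrDl mulrnDl mulrDr addrACA.
Qed.

Lemma dfactorN f a k r : dfactor f a k (- r) = - dfactor f a k r.
Proof.
by elim: k => [//|k /= ->]; rewrite derivN mulNr mulNrn mulrN -opprD.
Qed.

Lemma size_dfactor f a k r : (size (dfactor f a k r) <= size r + k * size f)%N.
Proof.
have sd (g : {poly F}) : (size (deriv g) <= size g)%N.
  have [->|g0] := eqVneq g 0; first by rewrite deriv0.
  exact: ltnW (lt_size_deriv g0).
elim: k => [|k IH] /=; first by rewrite mul0n addn0.
apply: leq_trans (size_polyD _ _) _; rewrite geq_max; apply/andP; split.
  rewrite -mulr_natr -polyC_natr mulrC mul_polyC.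
  apply: leq_trans (size_scale_leq _ _) _.
  apply: leq_trans (size_polyMleq _ _) _; apply: leq_trans (leq_pred _) _.
  by rewrite mulSn [(size f + _)%N]addnC addnA leq_add.
apply: leq_trans (size_polyMleq _ _) _; apply: leq_trans (leq_pred _) _.
by rewrite mulSn addnCA leq_add2l; apply: leq_trans (sd _) IH.
Qed.

(** Counting vectors over a finite field replaces a rank argument: two vectors with the same image
    differ by a kernel element. *)
Lemma pigeonhole_kernel (I K : finType) (L : {ffun I -> F} -> {ffun K -> F}) :
  (forall v w, L (v - w) = L v - L w) -> (#|K| < #|I|)%N ->
  exists2 v, v != 0 & L v = 0.
Proof.
move=> LB KI; have /injectivePn[v [w vw E]] : ~~ injectiveb L.
  apply/negP => /injectiveP /leq_card; rewrite !card_ffun leqNgt ltn_exp2l ?KI //.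
  by rewrite cardF prime_gt1.
by exists (v - w); rewrite ?subr_eq0 // LB E subrr.
Qed.

Lemma deriv_Xpj j : deriv ('X^(j * p) : {poly F}) = 0.
Proof.
by rewrite derivXn -mulr_natr natrM -polyC_natr -polyC_natr (pcharf0 Fp) polyC0 !mulr0.
Qed.

(* The polynomial is [f ^+ M * \sum_(j < J) (r_j + s_j * f ^+ e) * 'X^(j * p)].  At a point [u] with
   [f.[u] ^+ e = 1] and [u ^+ p = u] its first [M] derivatives are values of polynomials of low
   degree, so their vanishing is an underdetermined linear system in the coefficients of [r_j] and
   [s_j]. *)
Lemma stepanov_auxiliary f (b : F) J D M e : e.*2.+1 = p ->
  f.[0] != 0 -> odd (mup b f) -> (D.*2 + size f <= p)%N -> (M <= p)%N ->
  (M * (D + M * size f + J) < (J * D).*2)%N ->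
  exists P : {poly F},
    [/\ P != 0, (size P <= (M + e) * size f + D + J * p)%N &
     forall u k, (k < M)%N -> f.[u] ^+ e = 1 -> (derivn k P).[u] = 0].
Proof.
move=> ep f00 ob Dp Mp; case: J => [|J]; first by rewrite mul0n.
case: D Dp => [|D] Dp MJD; first by move: MJD; rewrite muln0.
have f0 : f != 0 by apply: contraNneq f00 => ->; rewrite horner0.
pose co (v : {ffun bool * 'I_J.+1 * 'I_D.+1 -> F}) (c : bool) (j : nat) :=
  \poly_(i < D.+1) v (c, inord j, inord i).
have coB v w c j : co (v - w) c j = co v c j - co w c j.
  apply/polyP => i; rewrite coefB !coef_poly; case: ifP => _; last by rewrite subr0.
  by rewrite !ffunE.
have szco v c j : (size (co v c j) <= D.+1)%N by apply: size_poly.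
(* The [k]-th derivative at an admissible [u], after removal of the common factor [f ^+ (M - k)],
   with [f ^+ e] replaced by 1 and ['X^(j * p)] by ['X^j]. *)
pose W v k : {poly F} := \sum_(j < J.+1)
  (dfactor f M k (co v false j) + dfactor f (M + e) k (co v true j)) * 'X^j.
pose Z := (D.+1 + M * size f + J.+1)%N.
have szW v k : (k < M)%N -> (size (W v k) <= Z)%N.
  move=> kM; apply: leq_trans (size_sum _ _ _) _; apply/bigmax_leqP => j _.
  apply: leq_trans (size_polyMleq _ _) _; rewrite size_polyXn addnS /=.
  have szf a c : (size (dfactor f a k (co v c j)) <= D.+1 + M * size f)%N.
    apply: leq_trans (size_dfactor _ _ _ _) _.
    by rewrite leq_add // leq_mul2r (ltnW kM) orbT.
  rewrite leq_add ?(ltnW (ltn_ord j)) //.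
  by apply: leq_trans (size_polyD _ _) _; rewrite geq_max !szf.
pose L v : {ffun 'I_M * 'I_Z -> F} := [ffun ki : 'I_M * 'I_Z => (W v ki.1)`_ki.2].
have [v v0 Lv] : exists2 v, v != 0 & L v = 0.
  apply: pigeonhole_kernel => [v w|].
    have WB k : W (v - w) k = W v k - W w k.
      rewrite /W -sumrB; apply: eq_bigr => j _.
      by rewrite -mulrBl; congr (_ * _); rewrite !coB !dfactorD !dfactorN opprD addrACA.
    by apply/ffunP => -[k i]; rewrite !ffunE /= WB coefB.
  by rewrite !card_prod !card_ord card_bool -mulnA mul2n.
have W0 k : (k < M)%N -> W v k = 0.
  move=> kM; apply/polyP => i; rewrite coef0.
  have [iZ|Zi] := ltnP i Z; last by rewrite nth_default // (leq_trans (szW v k kM)).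
  by move/ffunP: Lv => /(_ (Ordinal kM, Ordinal iZ)); rewrite !ffunE.
pose h c : {poly F} := \sum_(j < J.+1) co v c j * 'X^(j * p).
exists (f ^+ M * h false + f ^+ (M + e) * h true); split.
- apply: contraNneq v0; rewrite exprD -mulrA -mulrDr => /eqP.
  rewrite mulf_eq0 expf_eq0 (negPf f0) andbF /= addr_eq0 => /eqP E.
  (* A vanishing polynomial would give [h false = - f ^+ e * h true]. Squaring and multiplying by
     [f] produces [f ^+ p], since [e.*2.+1 = p]. *)
  have key : h false ^+ 2 * f = f ^+ p * h true ^+ 2.
    by rewrite E -ep sqrrN exprMn -exprM muln2 [f ^+ _.+1]exprSr mulrAC.
  have := stepanov_nonvanish f00 ob Dp (szco v false) (szco v true) key.
  move=> co0; apply/eqP/ffunP => -[[c j] i]; rewrite ffunE.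
  have : co v c j = 0 by case: (co0 j (ltn_ord j)) => ? ?; case: c.
  move/polyP => /(_ i); rewrite coef_poly coef0 ltn_ord.
  by rewrite !inord_val.
- have szh c : (size (h c) <= D.+1 + J.+1 * p)%N.
    apply: leq_trans (size_sum _ _ _) _; apply/bigmax_leqP => j _.
    apply: leq_trans (size_polyMleq _ _) _; rewrite size_polyXn addnS /=.
    by rewrite leq_add ?szco // leq_mul2r (ltnW (ltn_ord j)) orbT.
  have szt a (c : bool) : (a <= M + e)%N ->
      (size (f ^+ a * h c)%R <= (M + e) * size f + D.+1 + J.+1 * p)%N.
    move=> ale; apply: leq_trans (size_polyMleq _ _) _; rewrite -addnA.
    have sf : (size (f ^+ a)%R <= (M + e) * size f + 1)%N.
      apply: leq_trans (size_poly_exp_leq _ _) _.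
      by rewrite addn1 ltnS mulnC leq_mul // leq_pred.
    move: sf (szh c); move: (size (f ^+ a)%R) (size (h c)) => x y; lia.
  apply: leq_trans (size_polyD _ _) _; rewrite geq_max !szt //; exact: leq_addr.
- move=> u k kM fu.
have up j : u ^+ (j * p) = u ^+ j by rewrite mulnC exprM -cardF expf_card.
have dh c a : (k <= a)%N -> (derivn k (f ^+ a * h c)).[u] =
    f.[u] ^+ (a - k) * (\sum_(j < J.+1) dfactor f a k (co v c j) * 'X^j).[u].
  move=> ka; rewrite mulr_sumr raddf_sum !horner_sum mulr_sumr.
  apply: eq_bigr => j _; rewrite mulrA /= dfactorP ?deriv_Xpj //.
  by rewrite !hornerM horner_exp !hornerXn up mulrA.
rewrite derivnD hornerD !dh ?(ltnW (leq_trans kM (leq_addr _ _))) // ?(ltnW kM) //.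
rewrite addnC -addnBA ?(ltnW kM) // exprD fu mul1r -mulrDr -hornerD.
rewrite -big_split /=; move: (W0 k kM); rewrite /W => W0k.
under eq_bigr do rewrite -mulrDl [(e + M)%N]addnC.
by rewrite W0k horner0 mulr0.
Qed.

(** Every point of [S] is a zero of order at least [M] of the auxiliary polynomial, so [M * #|S|] is
    at most its degree. *)
Lemma stepanov_count f (b : F) J D M e (S : {set F}) : e.*2.+1 = p ->
  f.[0] != 0 -> odd (mup b f) -> (D.*2 + size f <= p)%N -> (M <= p)%N ->
  (M * (D + M * size f + J) < (J * D).*2)%N ->
  (forall u, u \in S -> f.[u] ^+ e = 1) ->
  (M * #|S| < (M + e) * size f + D + J * p)%N.
Proof.
move=> ep f00 ob Dp Mp MJD fS.
have [P [P0 szP dP]] := stepanov_auxiliary ep f00 ob Dp Mp MJD.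
have /(dvdp_leq P0) : \prod_(u <- enum S) ('X - u%:P) ^+ M %| P.
  apply: dvdp_prod_XsubX; first exact: enum_uniq.
  move=> u; rewrite mem_enum => uS; apply: dvdp_Xsub_derivn => // k kM.
  exact: dP kM (fS u uS).
rewrite prodrXl => /leq_trans/(_ szP); set Q := _ ^+ M.
have : (0 < size Q)%N.
  rewrite size_poly_gt0 expf_neq0 // monic_neq0 // monic_prod_XsubC //.
have := size_exp (\prod_(u <- enum S) ('X - u%:P)) M.
rewrite -/Q size_prod_XsubC -cardE /= [(#|S| * M)%N]mulnC => <-.
by case: (size Q).
Qed.

End Stepanov.

(** * The quadratic character, defined by Euler's criterion, and Weil's upper bound *)

Definition qchi (F : finFieldType) (u : F) : int :=
  if u == 0 then 0 else if u ^+ (#|F|.-1./2) == 1 then 1 else -1.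

Section QuadraticCharacter.
Variables (F : finFieldType) (p : nat).
Hypotheses (Fp : p \in [pchar F]) (cardF : #|F| = p) (p_odd : odd p).
Let e := p.-1./2.

Let p_pr : prime p. Proof. by case/andP: Fp. Qed.
Let ep : e.*2.+1 = p. Proof. by rewrite /e; move: p_odd (prime_gt0 p_pr); lia. Qed.

Lemma qchi0 : qchi (0 : F) = 0. Proof. by rewrite /qchi eqxx. Qed.

Lemma qchiE (u : F) : u != 0 -> qchi u = if u ^+ e == 1 then 1 else -1.
Proof. by rewrite /qchi cardF => /negPf ->. Qed.

Lemma half_expf (u : F) : u != 0 -> (u ^+ e == 1) || (u ^+ e == -1).
Proof.
move=> u0; rewrite -sqrf_eq1 -exprM muln2; apply/eqP/(mulfI u0).
by rewrite mulr1 -exprS ep -cardF expf_card.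
Qed.

Lemma oppf1_neq : (-1 : F) == 1 = false.
Proof.
rewrite eq_sym -subr_eq0 opprK -[1 + 1]/(2%:R); apply/negbTE.
apply: (natF_neq0 Fp); rewrite /=; move: p_odd (prime_gt1 p_pr); lia.
Qed.

Lemma qchiM (u v : F) : qchi (u * v) = qchi u * qchi v.
Proof.
have [->|u0] := eqVneq u 0; first by rewrite mul0r qchi0 mul0r.
have [->|v0] := eqVneq v 0; first by rewrite mulr0 qchi0 mulr0.
rewrite !qchiE ?mulf_neq0 // exprMn.
by case/orP: (half_expf u0) => /eqP ->; case/orP: (half_expf v0) => /eqP ->;
  rewrite ?mulrN1 ?mulN1r ?opprK ?mul1r ?eqxx ?oppf1_neq.
Qed.

Lemma qchi_prod (I : Type) (r : seq I) (P : pred I) (g : I -> F) :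
  qchi (\prod_(i <- r | P i) g i) = \prod_(i <- r | P i) qchi (g i).
Proof.
apply: (big_morph _ qchiM); rewrite qchiE ?oner_eq0 // expr1n eqxx //.
Qed.

Lemma qchi_norm (u : F) : `|qchi u| <= 1.
Proof. by rewrite /qchi; case: ifP => // _; case: ifP. Qed.

Lemma qchi_sqr (u : F) : u != 0 -> qchi u * qchi u = 1.
Proof. by move=> u0; rewrite qchiE //; case: ifP. Qed.

(** With [D] near [p / 2] the linear system is underdetermined once [J] exceeds [M / 2] by a
    multiple of [size f]. The main term [J * p / M] of the count is then [p / 2], and the term
    [e * size f / M] as well as the excess of [J] cost about [size f * p / M]; so [M] is taken as
    large as allowed, near the square root of [p]. *)
Lemma stepanov_count_sqrt (f : {poly F}) (b : F) M (S : {set F}) :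
  (M ^ 2 <= p < M.+1 ^ 2)%N -> (size f + 4 <= M)%N -> f.[0] != 0 -> odd (mup b f) ->
  (forall u, u \in S -> f.[u] ^+ e = 1) ->
  (#|S|.*2 <= p + 50 * (size f) * M)%N.
Proof.
move=> Mp fM f00 ob fS; set n := size f.
have n0 : (0 < n)%N.
  by rewrite size_poly_gt0; apply: contraNneq f00 => ->; rewrite horner0.
pose D := (p - n)./2; pose J := (M./2 + 2 * n + 3)%N.
have [pl pu] : (M * M <= p /\ p < M * M + 2 * M + 1)%N.
  by case/andP: Mp; rewrite -!mulnn mulSn mulnS => h1 h2; split=> //; lia.
have M4 : (4 * M <= M * M)%N by rewrite leq_mul2r; apply/orP; right; lia.
have hp : (2 * n + 2 + 2 * M <= p)%N by move: fM; rewrite -/n; lia.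
have C1 : (D.*2 + n <= p)%N by rewrite /D; lia.
have C2 : (M <= p)%N by lia.
have h1 : (p <= D.*2 + n + 1)%N by rewrite /D; lia.
have C3 : (M * (D + M * n + J) < (J * D).*2)%N.
  have [t Dt] : exists t, J.*2 = (M + t)%N by exists (J.*2 - M)%N; rewrite /J; lia.
  have [d Dd] : exists d, D.*2 = (M + d)%N by exists (D.*2 - M)%N; lia.
  have ht : (4 * n + 5 <= t)%N by move: Dt; rewrite /J; lia.
  have hd : (M * M <= 2 * d)%N by lia.
  have d0 : (0 < d)%N by lia.
  rewrite -ltn_double.
  have E1 : ((M * (D + M * n + J)).*2 = M * (M + d) + 2 * (M * M) * n + M * (M + t))%N.
    by rewrite -Dt -Dd; lia.
  have E2 : ((J * D).*2.*2 = (M + t) * (M + d))%N by rewrite -Dt -Dd; lia.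
  rewrite E1 E2.
  have k1 : ((4 * n + 5) * d <= t * d)%N by rewrite leq_mul2r ht orbT.
  have k2 : (M * M * n <= 2 * d * n)%N by rewrite leq_mul2r hd orbT.
  by lia.
have := stepanov_count Fp cardF ep f00 ob C1 C2 C3 fS.
rewrite -/n => H.
have M0 : (0 < M)%N by rewrite (leq_trans _ fM) // addn4.
rewrite -(leq_pmul2l M0).
have J2 : (J.*2 <= M + 4 * n + 6)%N by rewrite /J; lia.
have De : (D.*2 <= p)%N by lia.
have p4 : (p <= 4 * (M * M))%N by lia.
have E3 : (J.*2 * p <= (M + 4 * n + 6) * p)%N by rewrite leq_mul2r J2 orbT.
have E4 : ((5 * n + 7) * p <= (5 * n + 7) * (4 * (M * M)))%N by rewrite leq_mul2l p4 orbT.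
have E5 : (M * M <= n * (M * M))%N by rewrite leq_pmull.
have E6 : (n * M <= n * (M * M))%N by rewrite leq_mul2l leq_pmull ?orbT.
have E7 : (e.*2 * n <= p * n)%N by rewrite leq_mul2r -ep leqnSn orbT.
by lia.
Qed.

(** The character sum equals [2 * #|S| + #|T| - p], where [S] is where the value is 1 and [T] is the
    set of roots. *)
Lemma weil_quadratic_upper (f : {poly F}) (b : F) M :
  (M ^ 2 <= p < M.+1 ^ 2)%N -> (size f + 4 <= M)%N -> f.[0] != 0 -> odd (mup b f) ->
  \sum_(u : F) qchi f.[u] <= (51 * size f * M)%:Z.
Proof.
move=> Mp fM f00 ob.
pose S := [set u | (f.[u] != 0) && (f.[u] ^+ e == 1)].
pose T := [set u | root f u].
have f0 : f != 0 by apply: contraNneq f00 => ->; rewrite horner0.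
have cS : (#|S|.*2 <= p + 50 * (size f) * M)%N.
  by apply: (stepanov_count_sqrt Mp fM f00 ob) => u; rewrite inE => /andP[_ /eqP].
have cT : (#|T| <= size f)%N.
  rewrite cardE ltnW // max_poly_roots ?enum_uniq //.
  by apply/allP => u; rewrite mem_enum inE.
have E u : qchi f.[u] = (u \in S)%:Z * 2 + (u \in T)%:Z - 1.
  rewrite !inE rootE; have [->|fu] := eqVneq f.[u] 0; first by rewrite qchi0.
  by rewrite qchiE //; case: ifP.
rewrite (eq_bigr _ (fun u _ => E u)) sumrB big_split /= -mulr_suml.
have cnt (A : {set F}) : \sum_(i : F) (i \in A)%:Z = #|A|%:Z.
  rewrite -sum1_card (big_morph Posz PoszD (erefl _)) [RHS]big_mkcond /=.
  by apply: eq_bigr => i _; case: (i \in A).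
rewrite !cnt sumr_const cardF.
have n0 : (0 < size f)%N by rewrite size_poly_gt0.
have : (size f <= size f * M)%N by rewrite leq_pmulr //; lia.
move: cS cT; rewrite -!mulnA; set x := (size f * M)%N; lia.
Qed.

End QuadraticCharacter.

(** * Moments of short character sums *)

(* A map all of whose fibres are even has an image of at most half the size of
   its domain, hence factors through ['I_r]. *)
Lemma card_even_fibres (r B : nat) : (0 < B)%N ->
  (#|[set phi : {ffun 'I_r.*2 -> 'I_B} | [forall b, ~~ odd #|[set i | phi i == b]|]]|
   <= r ^ r.*2 * B ^ r)%N.
Proof.
case: B => [//|B] _.
pose comp (q : {ffun 'I_r.*2 -> 'I_r} * {ffun 'I_r -> 'I_B.+1}) :
  {ffun 'I_r.*2 -> 'I_B.+1} := [ffun i => q.2 (q.1 i)].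
apply: (@leq_trans #|[set comp q | q in [set: {ffun 'I_r.*2 -> 'I_r} * {ffun 'I_r -> 'I_B.+1}]]|); last first.
  apply: leq_trans (leq_imset_card _ _) _.
  by rewrite cardsT card_prod !card_ffun !card_ord.
apply/subset_leq_card/fintype.subsetP => phi; rewrite inE => /forallP ev.
pose A := [set phi i | i in [set: 'I_r.*2]].
have cA : (#|A| <= r)%N.
  rewrite -leq_double -[in leqRHS](card_ord r.*2) -cardsT -!sum1_card.
  rewrite [leqRHS](partition_big_imset phi) /= -/A -muln2 big_distrl /=.
  apply: leq_sum => y yA; rewrite sum1dep_card mul1n.
  have -> : #|[set x in [set: 'I_r.*2] | phi x == y]| = #|[set i | phi i == y]|.
    by apply: eq_card => i; rewrite !inE.
  move: (ev y); case/imsetP: yA => i _ ->; case E : #|_| => [|[|//]] // _.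
  by move/eqP: E; rewrite cards_eq0 => /eqP/setP/(_ i); rewrite !inE eqxx.
have Am i : phi i \in A by apply/imsetP; exists i; rewrite ?inE.
have ir i : (index (phi i) (enum A) < r)%N.
  by apply: leq_trans cA; rewrite cardE index_mem mem_enum.
apply/imsetP; exists ([ffun i => Ordinal (ir i)], [ffun j : 'I_r => nth ord0 (enum A) j]).
  by rewrite inE.
by apply/ffunP => i; rewrite !ffunE /= nth_index // mem_enum.
Qed.

Section Moments.
Variables (F : finFieldType) (p : nat).
Hypotheses (Fp : p \in [pchar F]) (cardF : #|F| = p) (p_odd : odd p).

(** The shifts start at 1, so that for [B < p] products of the factors [u + b.+1] do not vanish at
    [u = 0], as Stepanov's argument demands. *)
Definition short_sum (B : nat) (u : F) : int := \sum_(b < B) qchi (u + b.+1%:R).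

Lemma natF_inj m n : (m < p)%N -> (n < p)%N -> m%:R = n%:R :> F -> m = n.
Proof.
wlog mn : m n / (m <= n)%N.
  by move=> H mp np E; case: (leqP m n) => [|/ltnW] h; [|symmetry]; apply: H.
move=> mp np /eqP; rewrite eq_sym -subr_eq0 -natrB // => E.
apply/eqP; rewrite eqn_leq mn /= -subn_eq0; apply: contraTT E => nm.
by apply: (natF_neq0 Fp); rewrite lt0n nm /= (leq_ltn_trans (leq_subr _ _)).
Qed.

(** Expanding the power gives one complete character sum for each tuple of [r.*2] shifts. Tuples in
    which every shift occurs an even number of times are few and estimated trivially; any other
    tuple yields a polynomial with a root of odd multiplicity, to which Weil's bound applies. *)
Lemma short_sum_moment (B r M : nat) : (0 < B < p)%N ->
  (M ^ 2 <= p < M.+1 ^ 2)%N -> (r.*2 + 5 <= M)%N ->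
  \sum_(u : F) short_sum B u ^+ r.*2 <=
    (r ^ r.*2 * B ^ r * p + B ^ r.*2 * (51 * r.*2.+1 * M))%:Z.
Proof.
move=> /andP[B0 Bp] Mp rM.
pose E := [set phi : {ffun 'I_r.*2 -> 'I_B} | [forall b, ~~ odd #|[set i | phi i == b]|]].
have expand u : short_sum B u ^+ r.*2 =
    \sum_(phi : {ffun 'I_r.*2 -> 'I_B}) qchi (\prod_i (u + (phi i).+1%:R)).
  rewrite /short_sum -[X in _ ^+ X](card_ord r.*2) -prodr_const.
  rewrite bigA_distr_bigA; apply: eq_bigr => phi _.
  by rewrite (qchi_prod Fp cardF p_odd).
rewrite (eq_bigr _ (fun u _ => expand u)) exchange_big /=.
rewrite (bigID (mem E)) /= PoszD; apply: lerD.
  apply: (@le_trans _ _ (\sum_(phi in E) p%:Z)).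
    apply: ler_sum => phi _.
    apply: le_trans (_ : \sum_(u : F) 1 <= _).
      by apply: ler_sum => u _; apply: le_trans (ler_norm _) (qchi_norm _).
    by rewrite sumr_const cardF natz.
  rewrite sumr_const -mulr_natr PoszM mulrC -natz ler_wpM2r //.
  by rewrite natz; apply: card_even_fibres.
apply: (@le_trans _ _ (\sum_(phi : {ffun 'I_r.*2 -> 'I_B}) (51 * r.*2.+1 * M)%:Z)); last first.
  by rewrite sumr_const card_ffun !card_ord -mulr_natr PoszM mulrC natz.
rewrite [leRHS](bigID (mem E)) /= -[leLHS]add0r; apply: lerD.
  by apply: sumr_ge0.
apply: ler_sum => phi; rewrite inE negb_forall => /existsP[b]; rewrite negbK => ob.
pose s := [seq - ((phi i).+1%:R : F) | i <- enum 'I_r.*2].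
pose f := \prod_(y <- s) ('X - y%:P).
have fE u : \prod_i (u + (phi i).+1%:R) = f.[u].
  rewrite /f horner_prod big_map big_enum /=; apply: eq_bigr => i _.
  by rewrite hornerXsubC opprK.
rewrite (eq_bigr _ (fun u _ => congr1 (@qchi F) (fE u))).
have sf : size f = r.*2.+1 by rewrite size_prod_XsubC size_map size_enum_ord.
rewrite -sf; apply: (weil_quadratic_upper Fp cardF p_odd Mp (b := - b.+1%:R)).
- by rewrite sf; lia.
- rewrite -fE; apply/prodf_neq0 => i _; rewrite add0r.
  by apply: (natF_neq0 Fp); rewrite /= (leq_ltn_trans (ltn_ord _)).
rewrite mu_prod_XsubC count_map; move: ob; congr (odd _).
rewrite -sum1_card -sum1_count big_enum_cond /=.
apply: eq_bigl => i; rewrite !inE /=; apply/eqP/eqP => [->//|].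
move/oppr_inj/natF_inj => H; apply/val_inj; apply/eqP; rewrite -eqSS; apply/eqP.
by apply: H; apply: leq_ltn_trans (ltn_ord _) _.
Qed.

End Moments.

(** * Amplification *)

Lemma sum_shift_le (g : nat -> int) (x h : nat) : (forall n, `|g n| <= 1) ->
  \sum_(n < x) g n <= \sum_(n < x) g (n + h)%N + (2 * h)%:Z.
Proof.
move=> g1; rewrite -(big_mkord xpredT g) -(big_mkord xpredT (fun n => g (n + h)%N)).
have E : \sum_(0 <= n < x) g n + \sum_(x <= n < x + h) g n =
         \sum_(0 <= n < h) g n + \sum_(0 <= n < x) g (n + h)%N.
  rewrite -big_cat_nat ?leq_addr //= (big_cat_nat (leq0n h) (leq_addl x h)) /=.
  by rewrite -{2}[h]add0n big_addn addnK.
have b1 (m n : nat) : `|\sum_(m <= k < n) g k| <= (n - m)%N%:Z.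
  apply: le_trans (ler_norm_sum _ _ _) _.
  apply: (@le_trans _ _ (\sum_(m <= k < n) 1)); first by apply: ler_sum.
  by rewrite big_const_nat iter_addr_0 natz.
move: (b1 x (x + h)%N) (b1 0%N h) E; rewrite addKn subn0.
rewrite (addrC (\sum_(0 <= n < h) _)).
move: (\sum_(x <= n < _) _) (\sum_(0 <= n < h) _) (\sum_(0 <= n < x) g n)
  (\sum_(0 <= n < x) g (n + h)%N) => s t u v; lia.
Qed.

Lemma sum_sqr_le (T : finType) (U : {set T}) (v : T -> nat) :
  ((\sum_(u in U) v u) ^ 2 <= #|U| * \sum_(u in U) v u ^ 2)%N.
Proof.
rewrite -leq_double -[leqLHS]mul2n -mulnn.
have -> : (2 * ((\sum_(u in U) v u) * (\sum_(u in U) v u)) =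
  \sum_(u in U) \sum_(w in U) 2 * (v u * v w))%N.
  rewrite big_distrl big_distrr /=; apply: eq_bigr => u _.
  by rewrite !big_distrr.
have -> : ((#|U| * \sum_(u in U) v u ^ 2).*2 =
  \sum_(u in U) \sum_(w in U) (v u ^ 2 + v w ^ 2))%N.
  under [RHS]eq_bigr do rewrite big_split /=.
  rewrite big_split /= sum_nat_const -addnn; congr (_ + _)%N.
  by rewrite big_distrr /=; apply: eq_bigr => u _; rewrite sum_nat_const.
by apply: leq_sum => u _; apply: leq_sum => w _; apply: nat_Cauchy.
Qed.

Section Amplification.
Variables (p : nat).
Hypotheses (p_pr : prime p) (p_odd : odd p).
Variables (A m x : nat) (P : {set 'I_m.+1}).
Hypotheses (P_prime : forall a, a \in P -> prime a) (P_gt : forall a, a \in P -> (A < a)%N).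
Hypotheses (A0 : (0 < A)%N) (mx : (m * x < p)%N).

Local Notation F := 'F_p.
Let Fp : p \in [pchar F] := pchar_Fp p_pr.
Let cardF : #|F| = p := card_Fp p_pr.

Let ratio (q : 'I_m.+1 * 'I_x) : F := q.2.+1%:R / q.1%:R.
Let T := [set q : 'I_m.+1 * 'I_x | q.1 \in P].
Let nu (u : F) := #|[set q in T | ratio q == u]|.

Let m_lt_p : (m < p)%N -> forall a, a \in P -> a%:R != 0 :> F.
Proof.
move=> mp a aP; apply: (natF_neq0 Fp); rewrite prime_gt0 ?P_prime //=.
by apply: leq_ltn_trans mp; rewrite -ltnS.
Qed.

(** Since [m * x < p], an equality of fractions [n / a = n' / a'] modulo [p] holds between integers
    after cross-multiplication. If the primes [a] and [a'] differ then [a] divides [n], which leaves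
    at most [x %/ A] values of [n] for each [a]; and [a'] determines [n']. *)
Lemma ratio_energy : (\sum_(u : F) nu u ^ 2 <= #|P| * x + #|P| * (#|P| * (x %/ A)))%N.
Proof.
have [e0|x0] := posnP x.
  rewrite big1 // => u _; rewrite /nu (_ : [set q in T | ratio q == u] = finset.set0) ?cards0 //.
  by apply/setP => -[a [n nx]]; exfalso; move: nx; rewrite e0.
have mp : (m < p)%N by apply: leq_ltn_trans mx; rewrite leq_pmulr.
pose D (q : 'I_m.+1 * 'I_x) := [set q' in T | ratio q' == ratio q].
have E : (\sum_(u : F) nu u ^ 2 = \sum_(q in T) #|D q|)%N.
  rewrite (partition_big ratio xpredT) //=; apply: eq_bigr => u _.
  rewrite -mulnn {1}/nu -sum1_card big_distrl /=.
  rewrite (eq_bigl (fun q => (q \in T) && (ratio q == u))) => [|q]; last by rewrite inE.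
  by apply: eq_bigr => q /andP[_ /eqP <-]; rewrite mul1n.
have cross q q' : q \in T -> q' \in T -> ratio q' == ratio q ->
    (q'.2.+1 * q.1 = q.2.+1 * q'.1)%N.
  rewrite !inE => qT q'T; rewrite /ratio eqr_div ?m_lt_p // -!natrM => /eqP.
  have bd (i : 'I_x) (a : 'I_m.+1) : (i.+1 * a < p)%N.
    by apply: leq_ltn_trans mx; rewrite mulnC leq_mul // -ltnS.
  by apply: (natF_inj Fp); apply: bd.
have Dle q : q \in T -> (#|D q| <= 1 + (q.1 %| q.2.+1) * #|P|)%N.
  move=> qT; have qP : q.1 \in P by rewrite inE in qT.
  have injD : {in D q &, injective (fun q' : 'I_m.+1 * 'I_x => q'.1)}.
    move=> [a1 n1] [a2 n2]; rewrite !inE /= => /andP[aP /eqP e1] /andP[_ /eqP e2] e.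
    subst a2; have : ratio (a1, n1) == ratio (a1, n2) by rewrite e1 e2.
    move/cross; rewrite !inE /= => /(_ aP aP)/eqP; rewrite eqn_pmul2r ?prime_gt0 ?P_prime //.
    by rewrite eqSS => /eqP/val_inj ->.
  rewrite -(card_in_imset injD).
  have sub : [set q'.1 | q' in D q] \subset q.1 |: (if (q.1 %| q.2.+1)%N then P else finset.set0).
    apply/fintype.subsetP => a /imsetP[q' q'D ->]; rewrite !inE.
    have q'T : q' \in T by move: q'D; rewrite inE => /andP[].
    have /(cross _ _ qT q'T) e : ratio q' == ratio q by move: q'D; rewrite inE => /andP[].
    have q'P : q'.1 \in P by move: q'T; rewrite inE.
    have [//|ne /=] := eqVneq q'.1 q.1.
    have -> : (q.1 %| q.2.+1)%N; last exact: q'P.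
    rewrite -(@Gauss_dvdl _ _ q'.1) -?e ?dvdn_mull //.
    rewrite prime_coprime ?P_prime // dvdn_prime2 ?P_prime //.
    by rewrite eq_sym; apply: contra ne => /eqP/val_inj ->.
  apply: leq_trans (subset_leq_card sub) _; apply: leq_trans (leq_card_setU _ _) _.
  by rewrite cards1; case: (_ %| _)%N; rewrite ?cards0 ?mul1n.
rewrite E; apply: leq_trans (_ : \sum_(q in T) (1 + (q.1 %| q.2.+1) * #|P|) <= _)%N.
  by apply: leq_sum => q qT; apply: Dle.
rewrite big_split /= sum1_card; apply: leq_add.
  have -> : T = finset.setX P [set: 'I_x] by apply/setP => q; rewrite !inE andbT.
  by rewrite cardsX cardsT card_ord.
rewrite -big_distrl /= [leqRHS]mulnC leq_mul2r; apply/orP; right.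
rewrite (eq_bigl (fun q => (q.1 \in P) && true)) => [|q]; last by rewrite inE andbT.
rewrite -(pair_big (mem P) xpredT (fun (a : 'I_m.+1) (n : 'I_x) => nat_of_bool (a %| n.+1)%N)) /=.
rewrite -sum_nat_const; apply: leq_sum => a aP.
have -> : (\sum_(n < x) (a %| n.+1) = x %/ a)%N.
  by rewrite divn_count_dvd big_add1 /= big_mkord.
by apply: leq_div2l => //; apply/ltnW/P_gt.
Qed.

Let m_lt : (0 < x)%N -> (m < p)%N.
Proof. by move=> x0; apply: leq_ltn_trans mx; rewrite leq_pmulr. Qed.

(* For [a \in P] one has [qchi (n + a * b) = qchi a * qchi (n / a + b)]. *)
Lemma amplified_sum_le (B : nat) : (0 < x)%N ->
  (#|P| * B)%:Z * \sum_(n < x) qchi (n.+1%:R : F) <=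
  \sum_(q in T) `|short_sum B (ratio q)| + (#|P| * B * (2 * (m * B)))%:Z.
Proof.
move=> x0; have mp := m_lt x0.
have step (a : 'I_m.+1) (b : 'I_B) : a \in P ->
    \sum_(n < x) qchi (n.+1%:R : F) <=
    \sum_(n < x) qchi (a%:R : F) * qchi ((n.+1%:R / a%:R + b.+1%:R) : F)
      + (2 * (m * B))%:Z.
  move=> aP; apply: le_trans (sum_shift_le (g := fun n => qchi (n.+1%:R : F)) x (a * b.+1) _) _.
    by move=> n; apply: qchi_norm.
  apply: lerD; last by rewrite lez_nat leq_mul2l /= leq_mul // -ltnS.
  apply: ler_sum => n _; rewrite -(qchiM Fp cardF p_odd) -addSn natrD natrM.
  by rewrite mulrDr mulrCA mulfV ?mulr1 // m_lt_p.
apply: le_trans (_ : \sum_(a in P) \sum_(b < B)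
   (\sum_(n < x) qchi (a%:R : F) * qchi ((n.+1%:R / a%:R + b.+1%:R) : F)
      + (2 * (m * B))%:Z) <= _).
  rewrite PoszM -mulrA -natz mulr_natl -sumr_const; apply: ler_sum => a aP.
  rewrite -[B in B%:Z]card_ord -natz mulr_natl -sumr_const; apply: ler_sum => b _.
  exact: step.
under eq_bigr do rewrite big_split sumr_const card_ord /=.
rewrite big_split sumr_const /= -mulrnA -natz -mulr_natr mulrC.
apply: lerD; last first.
  by rewrite mulr1 -mulrnA natz lez_nat [leqRHS]mulnC [(B * _)%N]mulnC.
rewrite [leRHS](eq_bigl (fun q => (q.1 \in P) && true)) => [|q]; last by rewrite inE andbT.
rewrite -(pair_big (mem P) xpredT (fun (a : 'I_m.+1) (n : 'I_x) => `|short_sum B (ratio (a, n))|)) /=.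
apply: ler_sum => a aP; rewrite exchange_big; apply: ler_sum => n _ /=.
rewrite -mulr_sumr; apply: le_trans (ler_norm _) _; rewrite normrM.
by rewrite -[leRHS]mul1r ler_wpM2r // qchi_norm.
Qed.

(** This takes the place of Holder's inequality. Off the set [U] the short sums are at most
    [tau * B]; on [U] they are at most [B], and the fractions falling into [U] are few by
    Cauchy-Schwarz and [ratio_energy]. *)
Lemma burgess_inequality (R : realFieldType) (tau : R) (B : nat) :
  (0 < x)%N -> (0 < B)%N -> (0 < #|P|)%N -> 0 < tau ->
  (#|[set u : F | tau * B%:R < `|short_sum B u|%:~R]|
     * (#|P| * x + #|P| * (#|P| * (x %/ A))))%:R <= (tau * (#|P| * x)%:R) ^+ 2 ->
  (\sum_(n < x) qchi (n.+1%:R : F))%:~R <= 2 * tau * x%:R + (2 * (m * B))%:R :> R.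
Proof.
set U := [set u | _] => x0 B0 P0 tau0 HU.
pose V := (\sum_(u in U) nu u)%N.
have V_le : V%:R <= tau * (#|P| * x)%:R.
  rewrite -(@ler_pXn2r _ 2) ?nnegrE ?mulr_ge0 ?(ltW tau0) // -natrX.
  apply: le_trans HU; rewrite ler_nat; apply: leq_trans (sum_sqr_le _ _) _.
  rewrite leq_mul2l; apply/orP; right; apply: leq_trans ratio_energy.
  by rewrite [leqRHS](bigID (mem U)) /= leq_addr.
have cT : #|T| = (#|P| * x)%N.
  have -> : T = finset.setX P [set: 'I_x] by apply/setP => q; rewrite !inE andbT.
  by rewrite cardsX cardsT card_ord.
have W_le u : `|short_sum B u|%:~R <= tau * B%:R + B%:R * (u \in U)%:R :> R.
  have [uU|uU] := boolP (u \in U).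
    rewrite mulr1 -[leLHS]add0r lerD ?mulr_ge0 ?(ltW tau0) // -[B%:R]/(B%:Z%:~R) ler_int.
    apply: le_trans (ler_norm_sum _ _ _) _.
    apply: le_trans (_ : \sum_(b < B) 1 <= _); first by apply: ler_sum => b _; apply: qchi_norm.
    by rewrite sumr_const card_ord natz.
  by rewrite mulr0 addr0 leNgt; move: uU; rewrite inE.
have sumW : (\sum_(q in T) `|short_sum B (ratio q)|)%:~R <=
    2 * tau * (#|P| * B * x)%:R :> R.
  rewrite rmorph_sum /=.
  apply: le_trans (_ : \sum_(q in T) (tau * B%:R + B%:R * (ratio q \in U)%:R) <= _).
    by apply: ler_sum => q _; apply: W_le.
  rewrite big_split sumr_const /= -mulr_sumr cT.
  have -> : \sum_(q in T) (ratio q \in U)%:R = V%:R :> R.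
    rewrite -natr_sum; congr _%:R.
    rewrite -big_mkcondr /= sum1_card /V /nu.
    rewrite -sum1_card (partition_big ratio (mem U)) /= => [|q /andP[]//].
    apply: eq_bigr => u uU; rewrite -sum1_card; apply: eq_bigl => q.
    rewrite [in RHS]inE unfold_in.
    by case: (ratio q =P u) => [->|_]; rewrite ?andbF // uU !andbT.
  rewrite -[_ *+ (#|P| * x)]mulr_natr.
  apply: le_trans (_ : tau * B%:R * (#|P| * x)%:R + B%:R * (tau * (#|P| * x)%:R) <= _).
    by rewrite lerD2l ler_wpM2l.
  rewrite !natrM; lra.
have := amplified_sum_le B x0; rewrite -(ler_int R) intrM intrD => H.
have {}H := le_trans H (lerD sumW (lexx _)).
have PB0 : 0 < (#|P| * B)%:R :> R by rewrite ltr0n muln_gt0 P0.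
rewrite -(ler_pM2l PB0); apply: le_trans H _.
by rewrite -!pmulrn mulrDr !natrM; lra.
Qed.

End Amplification.

(** * Mertens' theorems *)

Section Primes.

Lemma prod_primes_dvd (s : seq nat) N : uniq s -> all prime s ->
  all (fun q => q %| N)%N s -> (\prod_(q <- s) q %| N)%N.
Proof.
elim: s => [|q s IH] /=; first by rewrite big_nil dvd1n.
move=> /andP[qs us] /andP[qp sp] /andP[qN sN]; rewrite big_cons Gauss_dvd.
  by rewrite qN IH.
apply: (@unstable.coprime_prodr _ [::] _ id q); apply/allP => r /mapP[t]; rewrite mem_filter /= => ts ->.
rewrite prime_coprime // dvdn_prime2 //; last exact: (allP sp).
by apply: contraNneq qs => ->.
Qed.

Lemma binS_le_exp4 m : ('C(m.*2.+1, m) <= 4 ^ m)%N.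
Proof.
have : (\sum_(i < m.*2.+2) 'C(m.*2.+1, i) = 2 ^ m.*2.+1)%N.
  rewrite -[2%N]/(1 + 1)%N expnDn; apply: eq_bigr => i _.
  by rewrite !exp1n !muln1.
have m1 : (m < m.*2.+2)%N by lia.
have m2 : (m.+1 < m.*2.+2)%N by lia.
rewrite (bigD1 (Ordinal m1)) //= (bigD1 (Ordinal m2)) /=; last first.
  by rewrite -val_eqE /= -(addn1 m) -{2}(addn0 m) eqn_add2l.
have -> : 'C(m.*2.+1, m.+1) = 'C(m.*2.+1, m).
  by rewrite -bin_sub; [congr binomial; lia|lia].
have -> : (2 ^ m.*2.+1 = 2 * 4 ^ m)%N by rewrite expnS -mul2n expnM.
by move: (\sum_(i < _ | _) _)%N => S E; lia.
Qed.

(** Erdos' argument: for [n = m.*2.+1] the primes in [(m.+1, n]] all divide ['C(n, m)], and even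
    [n > 2] are not prime. *)
Lemma primorial_le n : (\prod_(0 <= q < n.+1 | prime q) q <= 4 ^ n)%N.
Proof.
elim/ltn_ind: n => n IH.
have [n2|n2] := leqP n 2.
  by case: n n2 {IH} => [|[|[|//]]] _; rewrite !big_mkcond /= !big_nat_recr //= big_geq.
have [on|en] := boolP (odd n); last first.
  rewrite big_mkcond big_nat_recr //= -big_mkcond /=.
  have -> : prime n = false.
    by apply/negbTE; apply: contra en => np; case: (even_prime np) n2 => // ->.
  rewrite muln1; case: n n2 IH {en} => // n n2 IH.
  by apply: leq_trans (IH n (ltnSn n)) _; rewrite leq_exp2l.
pose m := n./2; have En : n = m.*2.+1 by rewrite /m; lia.
have m0 : (0 < m)%N by lia.
rewrite En (@big_cat_nat _ _ _ m.+2) //=; last by lia.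
rewrite (_ : (4 ^ m.*2.+1 = 4 ^ m.+1 * 4 ^ m)%N); last by rewrite -expnD; congr expn; lia.
apply: leq_mul; first by apply: IH; lia.
apply: leq_trans (binS_le_exp4 m); apply: dvdn_leq; first by rewrite bin_gt0; lia.
rewrite -big_filter; apply: prod_primes_dvd.
- by rewrite filter_uniq // iota_uniq.
- by apply: filter_all.
apply/allP => q; rewrite mem_filter mem_index_iota => /andP[qp /andP[mq qm]].
have := bin_fact (n := m.*2.+1) (m := m) (leq_trans (leq_addr m m) _).
rewrite addnn => /(_ (leqnSn _)) E.
have : (q %| (m.*2.+1)`!)%N.
  by rewrite dvdn_fact // prime_gt0 //= -ltnS.
rewrite -E !Euclid_dvdM // => /orP[//|].
have nf k : (k < q)%N -> (q %| k`!)%N = false.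
  move=> kq; apply/negbTE; elim: k kq => [|k IHk] kq; first by rewrite fact0 dvdn1; case: (q) qp kq => [|[]].
  by rewrite factS Euclid_dvdM // negb_or IHk ?(ltnW kq) // andbT gtnNdvd.
by rewrite !nf //; lia.
Qed.

Variable R : realType.
Implicit Types n q : nat.

Definition chebyshev_theta n : R := \sum_(0 <= q < n.+1 | prime q) ln q%:R.
Definition mertens_sum n : R := \sum_(0 <= q < n.+1 | prime q) ln q%:R / q%:R.

Lemma ln_prod_nat (r : seq nat) (P : pred nat) (f : nat -> nat) :
  (forall i, P i -> (0 < f i)%N) ->
  ln (\prod_(i <- r | P i) f i)%:R = \sum_(i <- r | P i) ln (f i)%:R :> R.
Proof.
move=> f0; elim: r => [|i r IH]; first by rewrite !big_nil ln1.
rewrite !big_cons; case: ifP => Pi //; rewrite natrM lnM ?IH //.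
  by rewrite posrE ltr0n f0.
by rewrite posrE ltr0n; apply: prodn_cond_gt0.
Qed.

Lemma chebyshev_theta_le n : chebyshev_theta n <= ln 4 * n%:R.
Proof.
rewrite /chebyshev_theta -(ln_prod_nat _ (f := id)) => [|q /prime_gt0 //].
rewrite mulr_natr -lnXn // -natrX ler_ln ?posrE ?ltr0n ?expn_gt0 //.
  by rewrite ler_nat primorial_le.
by apply: prodn_cond_gt0 => q /prime_gt0.
Qed.

Lemma ln_fact_sum n :
  ln n`!%:R = \sum_(0 <= q < n.+1 | prime q) (logn q n`!)%:R * ln q%:R :> R.
Proof.
have fp k : (0 < k <= n)%N ->
    ln k%:R = \sum_(0 <= q < n.+1) (logn q k)%:R * ln q%:R :> R.
  move=> /andP[k0 kn]; rewrite -{1}(partnT k0) (widen_partn _ kn).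
  rewrite ln_prod_nat => [|i _]; last by case: i => [|i]; rewrite expn_gt0 //= lognE.
  apply: eq_bigr => -[|i] _; last by rewrite natrX lnXn // mulr_natl.
  by rewrite (_ : logn 0 k = 0%N) ?expn0 ?ln1 ?mul0r // lognE.
suff H k : (k <= n)%N ->
    ln k`!%:R = \sum_(0 <= q < n.+1) (logn q k`!)%:R * ln q%:R :> R.
  rewrite (H n (leqnn n)) [RHS]big_mkcond; apply: eq_bigr => q _.
  by case: ifP => // qp; rewrite lognE qp mul0r.
elim: k => [|k IH] kn.
  by rewrite fact0 ln1 big1 // => q _; rewrite logn1 mul0r.
rewrite factS natrM lnM ?posrE ?ltr0n ?fact_gt0 // IH ?(ltnW kn) // fp //.
by rewrite -big_split; apply: eq_bigr => q _; rewrite lognM ?fact_gt0 // natrD mulrDl.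
Qed.

Lemma ln_succ_le n : (0 < n)%N -> n%:R * (ln n.+1%:R - ln n%:R) <= 1 :> R.
Proof.
move=> n0; have n0R : 0 < n%:R :> R by rewrite ltr0n.
rewrite -ln_div ?posrE ?ltr0n // -ler_pdivlMl // mulr1.
rewrite -natr1 mulrDl divff ?gt_eqF // mul1r; apply: le_ln1Dx.
by apply: lt_trans (_ : 0 < _); rewrite ?ltrN10 ?invr_gt0.
Qed.

Lemma ln_fact_bounds n : (0 < n)%N ->
  n%:R * ln n%:R - n%:R <= ln n`!%:R :> R /\ ln n`!%:R <= n%:R * ln n%:R :> R.
Proof.
elim: n => [//|[|n] IH] _; first by rewrite ln1 !mulr0; split; rewrite // lerBlDr.
have [] := IH isT; have := @ln_succ_le n.+1 isT.
have : ln n.+1%:R <= ln n.+2%:R :> R by rewrite ler_ln ?posrE // ler_nat.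
rewrite [n.+2`!]factS natrM lnM ?posrE ?ltr0n ?fact_gt0 //.
move: (ln n.+1`!%:R) (ln n.+1%:R) (ln n.+2%:R) => d a b.
rewrite -[n.+2%:R]natr1.
have : 0 <= n.+1%:R :> R by [].
move: (n.+1%:R : R) => m; nra.
Qed.

(** The geometric series over [q ^ k] with [k >= 2] sums to [1 / (q * (q - 1))], so this bounds the
    share of the higher prime powers in [ln n!], divided by [n]. *)
Lemma sum_lnq_tail n :
  \sum_(0 <= q < n.+1 | prime q) ln q%:R / (q%:R * (q%:R - 1)) <= 2 :> R.
Proof.
have pos q : 0 <= ln q%:R / (q%:R * (q%:R - 1)) :> R.
  case: q => [|[|q]]; rewrite ?mul0r ?invr0 ?mulr0 // ?ln1 ?mul0r //.
  have q1 : 1 <= q.+2%:R :> R by rewrite ler1n.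
  by rewrite mulr_ge0 ?ln_ge0 // invr_ge0 mulr_ge0 // subr_ge0.
(* The right-hand side is modelled on the integral of [ln x / x ^ 2]; its increments dominate the
   terms by [ln_succ_le]. *)
suff H m : \sum_(2 <= q < m.+2) ln q%:R / (q%:R * (q%:R - 1))
    <= 2 - (ln m.+1%:R + 2) / m.+1%:R :> R.
  apply: le_trans (_ : \sum_(2 <= q < n.+2) ln q%:R / (q%:R * (q%:R - 1)) <= _).
    rewrite [leRHS]big_mkcond [leLHS]big_mkcond /=.
    rewrite [leRHS](_ : _ = \sum_(0 <= q < n.+2) if (1 < q)%N then ln q%:R / (q%:R * (q%:R - 1)) else 0); last first.
      rewrite [RHS](@big_cat_nat _ _ _ 2) //= [X in X + _]big1_seq ?add0r.
        by apply: eq_big_nat => i /andP[->].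
      by move=> i /andP[_]; rewrite mem_index_iota => /andP[_]; case: i => [|[]].
    rewrite [leRHS]big_nat_recr //= -[leLHS]addr0; apply: lerD; last by case: ifP.
    apply: ler_sum => i _; case: ifP => [/prime_gt1 -> //|_]; by case: ifP.
  apply: le_trans (H n) _; rewrite gerBl divr_ge0 // addr_ge0 // ln_ge0 // ler1n //.
elim: m => [|m IH]; first by rewrite big_geq // ln1 add0r divr1 subrr.
rewrite big_nat_recr //=; apply: le_trans (lerD IH (lexx _)) _.
have := @ln_succ_le m.+1 isT.
have k1 : 1 <= m.+1%:R :> R by rewrite ler1n.
rewrite -[m.+2%:R]natr1 addrK; move: (m.+1%:R) k1 => k k1.
move: (ln k) (ln (k + 1)) => a b H.
have -> : 2 - (a + 2) / k + b / ((k + 1) * k) =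
   (2 * (k + 1) * k - (a + 2) * (k + 1) + b) / ((k + 1) * k) by field; lra.
have -> : 2 - (b + 2) / (k + 1) = (2 * (k + 1) * k - (b + 2) * k) / ((k + 1) * k).
  by field; lra.
rewrite ler_pM2r ?invr_gt0; last by nra.
nra.
Qed.

(** The exponent of [q] in [n!] is at least [n / q - 1]; the total loss is [chebyshev_theta n], at
    most [n * ln 4]. *)
Lemma mertens_upper n : (0 < n)%N -> mertens_sum n <= ln n%:R + ln 4.
Proof.
move=> n0; have n0R : 0 < n%:R :> R by rewrite ltr0n.
rewrite -(ler_pM2l n0R) mulrDr -lerBlDr.
have [_] := ln_fact_bounds n0; apply: le_trans; rewrite lerBlDr.
apply: (@le_trans _ _ (ln n`!%:R + chebyshev_theta n)); last first.
  by rewrite lerD2l mulrC chebyshev_theta_le.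
rewrite ln_fact_sum -big_split mulr_sumr; apply: ler_sum => q qp /=.
have q0 : (0 < q)%N := prime_gt0 qp.
have q0R : 0 < q%:R :> R by rewrite ltr0n.
have lq : 0 <= ln q%:R :> R by rewrite ln_ge0 // ler1n.
rewrite mulrCA mulrC -{3}[ln _]mul1r -mulrDl ler_wpM2r //.
apply: le_trans (_ : (n %/ q)%:R + 1 <= _).
  by rewrite ler_pdivrMr // natr1 -natrM ler_nat ltnW // ltn_ceil.
rewrite lerD2r ler_nat logn_fact // big_ltn // expn1 leq_addr //.
Qed.

Lemma mertens_lower n : (0 < n)%N -> ln n%:R - 3 <= mertens_sum n.
Proof.
move=> n0; have n0R : 0 < n%:R :> R by rewrite ltr0n.
have [H _] := ln_fact_bounds n0.
rewrite -(ler_pM2l n0R) mulrBr lerBlDr.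
suff : ln n`!%:R <= n%:R * (mertens_sum n + 2) by lra.
apply: (@le_trans _ _ (n%:R * (mertens_sum n +
  \sum_(0 <= q < n.+1 | prime q) ln q%:R / (q%:R * (q%:R - 1))))); last first.
  by rewrite ler_pM2l // lerD2l sum_lnq_tail.
rewrite ln_fact_sum -big_split mulr_sumr; apply: ler_sum => q qp /=.
have q1R : 1 < q%:R :> R by rewrite ltr1n prime_gt1.
have lq : 0 <= ln q%:R :> R by rewrite ln_ge0 // ltW.
have -> : n%:R * (ln q%:R / q%:R + ln q%:R / (q%:R * (q%:R - 1))) =
   n%:R / (q%:R - 1) * ln q%:R :> R by field; lra.
apply: ler_wpM2r => //; rewrite ler_pdivlMr ?subr_gt0 // logn_fact //.
(* The remainder [n / q ^ m] of the geometric series is kept so that the induction closes. *)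
have geo m : ((\sum_(1 <= k < m.+1) n %/ q ^ k)%:R * (q%:R - 1) + n%:R / (q ^ m)%:R <= n%:R :> R).
  elim: m => [|m IH]; first by rewrite big_geq // mul0r add0r expn0 divr1.
  rewrite big_nat_recr //= natrD mulrDl; apply: le_trans IH; rewrite -addrA lerD2l.
  have qm : 0 < (q ^ m.+1)%:R :> R by rewrite ltr0n expn_gt0 prime_gt0.
  have h : (n %/ q ^ m.+1)%:R <= n%:R / (q ^ m.+1)%:R :> R.
    by rewrite ler_pdivlMr // -natrM ler_nat leq_divM.
  have -> : n%:R / (q ^ m)%:R = n%:R / (q ^ m.+1)%:R * q%:R :> R.
    by rewrite expnSr natrM; field; rewrite -?natrM !pnatr_eq0 -!lt0n expn_gt0 prime_gt0.
  nra.
apply: le_trans (geo n); rewrite lerDl divr_ge0 //.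
Qed.

End Primes.

Section PrimeSums.
Variable R : realType.
Implicit Types n q : nat.

Lemma ln4_le2 : ln 4 <= 2 :> R.
Proof.
have -> : 4 = 2 ^+ 2 :> R by rewrite -natrX.
rewrite lnXn // mulr2n -[2 in leRHS]/(1 + 1).
have h : ln 2 <= 1 :> R by rewrite -[2]/(1 + 1) le_ln1Dx.
by rewrite lerD.
Qed.

Lemma mertens_sumS n : mertens_sum R n.+1 =
  mertens_sum R n + (if prime n.+1 then ln n.+1%:R / n.+1%:R else 0).
Proof.
by rewrite /mertens_sum big_mkcond big_nat_recr //= -big_mkcond.
Qed.

(** Partial summation in the form of an induction: the boundary term [D n / ln n] is carried along
    and dropped at the end, being nonnegative. *)
Lemma sum_prime_inv_le (Q x : nat) : (1 < Q)%N -> (Q <= x)%N ->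
  \sum_(Q.+1 <= q < x.+1 | prime q) q%:R^-1 <= ln (ln x%:R / ln Q%:R) + 5 / ln Q%:R :> R.
Proof.
move=> Q1 Qx.
have lnp n : (Q <= n)%N -> 0 < ln n%:R :> R.
  by move=> Qn; rewrite ln_gt0 // ltr1n (leq_trans Q1).
(* The constant 5 bounds [ln 4 + 3], the sum of the errors in the two Mertens inequalities, so
   [D n >= 0]. *)
pose D n : R := ln n%:R - ln Q%:R + 5 - (mertens_sum R n - mertens_sum R Q).
have D0 n : (Q <= n)%N -> 0 <= D n.
  move=> Qn; have n0 : (0 < n)%N by lia.
  have := mertens_upper R n0; have := mertens_lower R (ltnW Q1); have := ln4_le2.
  rewrite /D; lra.
suff H n : \sum_(Q.+1 <= q < (n + Q).+1 | prime q) q%:R^-1 + D (n + Q)%N / ln (n + Q)%:R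
    <= ln (ln (n + Q)%:R / ln Q%:R) + 5 / ln Q%:R.
  have := H (x - Q)%N; rewrite subnK //; apply: le_trans.
  by rewrite lerDl divr_ge0 ?D0 // ltW ?lnp.
elim: n => [|n IH].
  by rewrite add0n big_geq // /D !subrr !add0r subr0 divff ?ln1 ?add0r // gt_eqF // lnp.
rewrite addSn big_mkcond big_nat_recr /= -?big_mkcond; last by rewrite ltnS leq_addl.
have Qn : (Q <= n + Q)%N by apply: leq_addl.
have := lnp _ Qn; have := lnp _ (leqW Qn); have := lnp _ (leqnn Q).
have := D0 _ Qn; have : ln (n + Q)%:R <= ln (n + Q).+1%:R :> R.
  by rewrite ler_ln ?posrE ?ltr0n ?ler_nat //; lia.
have -> : D (n + Q).+1 = D (n + Q)%N + (ln (n + Q).+1%:R - ln (n + Q)%:R)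
     - (if prime (n + Q).+1 then ln (n + Q).+1%:R / (n + Q).+1%:R else 0).
  by rewrite /D mertens_sumS; lra.
move: IH; move: (n + Q)%N => m; move: (\sum_(_ <= _ < _ | _) _) (D m) => S d IH.
set P := (if prime m.+1 then _ / _ else _).
have -> : (if prime m.+1 then m.+1%:R^-1 else 0) = P / ln m.+1%:R :> R.
  rewrite /P; case: ifP => [mp|_]; last by rewrite mul0r.
  rewrite mulrAC divff ?mul1r // gt_eqF // ln_gt0 // ltr1n.
  exact: prime_gt1.
move: P IH; move: (ln m%:R) (ln m.+1%:R) (ln Q%:R) => a b l P IH ab d0 l0 b0 a0.
rewrite mulrBl -addrA [X in S + X]addrC subrK.
have -> : ln (b / l) = ln (a / l) - ln (a / b).
  rewrite -ln_div ?posrE ?divr_gt0 //; congr ln; field.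
  by rewrite !gt_eqF.
have h : ln (a / b) <= a / b - 1.
  have := @le_ln1Dx R (a / b - 1); rewrite addrCA subrr addr0; apply.
  by rewrite ltrBrDl subrr divr_gt0.
have -> : (d + (b - a)) / b = d / b + 1 - a / b by field; rewrite gt_eqF.
have : d / b <= d / a by rewrite ler_wpM2l // lef_pV2.
lra.
Qed.

(* Locked, since unary numerals of this size make conversion checks slow. *)
Definition block_ratio : nat := locked (4 ^ 5)%N.

Lemma block_ratio_gt0 : (0 < block_ratio)%N.
Proof. by rewrite /block_ratio -lock. Qed.

Definition prime_block (K : nat) : {set 'I_(block_ratio * K).+1} :=
  [set a : 'I_(block_ratio * K).+1 | prime a && (K < a)%N].

(** With ratio [4 ^ 5] the two Mertens inequalities leave at least [4 * ln 4 - 3 >= 1] for the sum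
    of [ln a / a] over the block, and each term is at most [ln (block_ratio * K) / K]. *)
Lemma card_prime_block K : (0 < K)%N ->
  K%:R <= #|prime_block K|%:R * ln (block_ratio * K)%:R :> R.
Proof.
move=> K0; have K0R : 0 < K%:R :> R by rewrite ltr0n.
have ltK : (K.+1 <= (block_ratio * K).+1)%N by rewrite ltnS leq_pmull // block_ratio_gt0.
have h1 : 1 <= mertens_sum R (block_ratio * K) - mertens_sum R K.
  have := mertens_lower R (n := block_ratio * K); rewrite muln_gt0 K0 block_ratio_gt0 => /(_ isT).
  have := mertens_upper R K0.
  rewrite /block_ratio -lock natrM natrX lnM ?posrE ?exprn_gt0 ?ltr0n //.
  rewrite lnXn ?ltr0n //.
  have : 1 <= ln 4 :> R.
    have -> : 4 = (2^-1 ^+ 2)^-1 :> R by rewrite exprVn invrK -natrX.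
    rewrite lnV ?posrE ?exprn_gt0 ?invr_gt0 ?ltr0n // lnXn ?invr_gt0 ?ltr0n //.
    have := @le_ln1Dx R (- 2^-1); rewrite (_ : 1 + - 2^-1 = 2^-1); last by lra.
    have h : -1 < - 2^-1 :> R by lra.
    move=> /(_ h); move: (ln _) => l; lra.
  lra.
have h2 : mertens_sum R (block_ratio * K) - mertens_sum R K =
   \sum_(a in prime_block K) ln (a%:R) / a%:R.
  rewrite {1}/mertens_sum (@big_cat_nat _ _ _ K.+1) //= -/(mertens_sum R K) addrAC subrr add0r.
  by rewrite big_geq_mkord; apply: eq_bigl => a; rewrite inE.
have : \sum_(a in prime_block K) ln (a%:R) / a%:R <=
   \sum_(a in prime_block K) ln (block_ratio * K)%:R / K%:R :> R.
  apply: ler_sum => a; rewrite inE => /andP[ap Ka].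
  have a0 := prime_gt0 ap.
  have aN : (a <= block_ratio * K)%N by rewrite -ltnS ltn_ord.
  apply: ler_pM.
  - by rewrite ln_ge0 // ler1n.
  - by rewrite invr_ge0.
  - by rewrite ler_ln ?posrE ?ltr0n ?ler_nat //; apply: leq_trans aN.
  - by rewrite lef_pV2 ?posrE ?ltr0n // ler_nat ltnW.
rewrite -h2 sumr_const -[leRHS]mulr_natl mulrA => h3.
by move: (le_trans h1 h3); rewrite ler_pdivlMr // mul1r.
Qed.
End PrimeSums.

(** * Burgess' estimate beyond p^{1/4} *)

Section Eventually.
Local Open Scope classical_set_scope.
Variable R : realType.

Lemma powR_ge_near (d C : R) : 0 < d -> \forall n \near \oo, C <= n%:R `^ d.
Proof.
move=> d0; pose C1 := Num.max C 1.
have C10 : 0 < C1 by rewrite lt_max ltr01 orbT.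
exists (Num.truncn (C1 `^ d^-1)).+1 => // n /= Cn.
apply: le_trans (_ : C1 <= _); first by rewrite le_max lexx.
rewrite -[leLHS]powRr1 ?(ltW C10) // -[X in _ `^ X <= _](mulVf (lt0r_neq0 d0)) powRrM.
apply: ge0_ler_powR; rewrite ?nnegrE ?powR_ge0 ?(ltW d0) //.
by apply/ltW/(lt_le_trans (truncnS_gt _)); rewrite ler_nat.
Qed.

Lemma ln_le_powR (d x : R) : 0 < d -> 0 < x -> ln x <= x `^ d / d.
Proof.
move=> d0 x0; rewrite ler_pdivlMr // mulrC -ln_powR.
exact/ltW/ln_sublinear/powR_gt0.
Qed.

Lemma ln_le_powR_near (d C : R) : 0 < d ->
  \forall n \near \oo, C * ln n%:R <= n%:R `^ d.
Proof.
move=> d0; have d20 : 0 < d / 2 by rewrite divr_gt0.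
near=> n; have n0 : 0 < n%:R :> R by rewrite ltr0n; near: n; exists 1%N.
have l0 : 0 <= ln n%:R :> R by rewrite ln_ge0 // ler1n -(ltr0n R).
apply: le_trans (_ : Num.max C 0 * ln n%:R <= _); first by rewrite ler_wpM2r // le_max lexx.
apply: le_trans (_ : Num.max C 0 * (n%:R `^ (d / 2) / (d / 2)) <= _).
  by rewrite ler_wpM2l ?ln_le_powR // le_max lexx orbT.
rewrite [d in leRHS]splitr powRD ?(gt_eqF n0) ?implybT // mulrCA.
rewrite ler_wpM2l ?powR_ge0 //.
by near: n; apply: powR_ge_near.
Unshelve. all: by end_near. Qed.

Lemma truncn_ge_half (y : R) : 1 <= y -> y / 2 <= (Num.truncn y)%:R.
Proof.
move=> y1; have y0 : 0 <= y by apply: le_trans y1.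
have := truncnS_gt y; rewrite -natr1.
have : 1 <= (Num.truncn y)%:R :> R by rewrite ler1n truncn_gt0.
move: (_%:R) => t; lra.
Qed.

End Eventually.

Lemma exists_sqrtn (n : nat) : exists M : nat, (M ^ 2 <= n < M.+1 ^ 2)%N.
Proof.
have ex : exists m, (m ^ 2 <= n)%N by exists 0%N.
have bd m : (m ^ 2 <= n -> m <= n)%N.
  by apply: leq_trans; rewrite -mulnn; case: m => // m; rewrite leq_pmulr.
case: (ex_maxnP ex bd) => M Mn maxM; exists M; rewrite Mn /= ltnNge.
by apply/negP => /maxM; rewrite ltnn.
Qed.

Section Burgess.
Local Open Scope classical_set_scope.
Variable R : realType.

(** Markov's inequality for the moment of order [r.*2]. The condition [p <= B ^ r.*2] means that the
    square root of [p] is at most [B ^ r], which brings the contribution of the even tuples down to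
    the size of Weil's term. *)
Lemma large_short_sum_card (p B r M : nat) (tau : R) : prime p -> odd p ->
  (0 < B < p)%N -> (M ^ 2 <= p < M.+1 ^ 2)%N -> (r.*2 + 5 <= M)%N -> (p <= B ^ r.*2)%N ->
  0 < tau ->
  #|[set u : 'F_p | tau * B%:R < `|short_sum B u|%:~R]%SET|%:R * tau ^+ r.*2
    <= ((r ^ r.*2)%:R + (51 * r.*2.+1)%:R) * Num.sqrt p%:R.
Proof.
move=> pp podd /andP[B0 Bp] Mp rM pB tau0; set U := [set u | _]%SET.
have B0R : 0 < B%:R :> R by rewrite ltr0n.
have := short_sum_moment (pchar_Fp pp) (card_Fp pp) podd (B := B) (r := r) (M := M).
rewrite B0 Bp => /(_ isT Mp rM); rewrite -(ler_int R) rmorph_sum /= => mom.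
have s0 : 0 <= Num.sqrt p%:R :> R by apply: sqrtr_ge0.
have ss : Num.sqrt p%:R * Num.sqrt p%:R = p%:R :> R by rewrite -expr2 sqr_sqrtr.
have sB : Num.sqrt p%:R <= B%:R ^+ r :> R.
  rewrite -(@ler_pXn2r _ 2) ?nnegrE ?exprn_ge0 ?ler0n // sqr_sqrtr ?ler0n //.
  by rewrite -exprM muln2 -natrX ler_nat.
have sM : M%:R <= Num.sqrt p%:R :> R.
  rewrite -(@ler_pXn2r _ 2) ?nnegrE // sqr_sqrtr ?ler0n // -natrX ler_nat.
  by case/andP: Mp.
have lower : #|U|%:R * (tau * B%:R) ^+ r.*2 <=
    \sum_(u : 'F_p) (short_sum B u ^+ r.*2)%:~R :> R.
  apply: le_trans (_ : \sum_(u in U) (short_sum B u ^+ r.*2)%:~R <= _); last first.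
    rewrite [leRHS](bigID (mem U)) /= lerDl; apply: sumr_ge0 => u _.
    by rewrite ler0z -mul2n exprM exprn_ge0 // sqr_ge0.
  rewrite mulr_natl -sumr_const; apply: ler_sum => u; rewrite inE => /ltW uU.
  have -> : (short_sum B u ^+ r.*2)%:~R = (`|short_sum B u|%:~R) ^+ r.*2 :> R.
    by rewrite -rmorphXn /= -!mul2n !exprM real_normK ?num_real.
  by rewrite lerXn2r ?nnegrE // ?mulr_ge0 ?(ltW tau0) // ler0z.
have Br0 : 0 < B%:R ^+ r.*2 :> R by rewrite exprn_gt0.
rewrite -(ler_pM2r Br0) -mulrA -exprMn; apply: le_trans lower (le_trans mom _).
set Br := B%:R ^+ r in sB *.
have Br_ge0 : 0 <= Br by rewrite exprn_ge0.
have -> : B%:R ^+ r.*2 = Br * Br :> R by rewrite -addnn exprD.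
set a := (r ^ r.*2)%N; set b := (51 * r.*2.+1)%N.
move: a b => a b.
have -> : (a * B ^ r * p + B ^ r.*2 * (b * M))%N%:~R =
    a%:R * (Br * p%:R) + b%:R * (M%:R * (Br * Br)) :> R.
  rewrite -pmulrn natrD !natrM !natrX -addnn exprD -/Br; ring.
rewrite -!mulrA mulrDl; apply: lerD; apply: ler_wpM2l => //; last first.
  by apply: ler_wpM2r => //; rewrite mulr_ge0.
by rewrite -{1}ss mulrCA; do 2 apply: ler_wpM2l => //.
Qed.

(** In the application [l = ln p], [s] is the square root of [p], [u = p ^ eps], [z = #|P| * x] and
    [c] is the moment constant. The excess of [x] over [p ^ (1 / 4)] supplies a factor [u ^+ 2], of
    which [B] consumes one [u]; the other one beats the logarithm and the constants. *)
Lemma burgess_final_inequality (L c t tau z l s u x A B : R) :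
  0 < L -> 0 <= c -> 0 < t -> 0 < tau -> 0 <= z -> 0 < l -> 0 <= s -> 0 < u ->
  0 <= x -> 0 <= A -> tau * x <= 8 * L * B * A -> B <= 2 * u -> s * u ^+ 2 <= x ^+ 2 ->
  A * x <= z * l -> (L + 2) * c * (16 * L) * l <= t ^+ 2 * tau * u ->
  c * s * (L + 2) <= t ^+ 2 * z.
Proof.
move=> L0 c0 t0 tau0 z0 l0 s0 u0 x0 A0 h1 Bu sx Az key.
have Ax0 : 0 <= A * x by rewrite mulr_ge0.
have h4 : tau * (s * u) * u <= 16 * L * (A * x) * u.
  apply: le_trans (_ : 8 * L * B * A * x <= _).
    apply: le_trans (_ : tau * x ^+ 2 <= _).
      by rewrite -mulrA -[s * u * u]mulrA -expr2 ler_pM2l.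
    by rewrite expr2 mulrA ler_wpM2r.
  have -> : 8 * L * B * A * x = 8 * L * (A * x) * B by ring.
  have -> : 16 * L * (A * x) * u = 8 * L * (A * x) * (2 * u) by ring.
  by rewrite ler_wpM2l // !mulr_ge0 // ltW.
have {}h4 : tau * (s * u) <= 16 * L * (z * l).
  rewrite ler_pM2r // in h4; apply: le_trans h4 _.
  by rewrite ler_wpM2l // mulr_ge0 // ltW.
have lL : 0 < 16 * L * l by rewrite !mulr_gt0.
rewrite -(ler_pM2r lL).
have -> : c * s * (L + 2) * (16 * L * l) = s * ((L + 2) * c * (16 * L) * l) by ring.
apply: le_trans (_ : s * (t ^+ 2 * tau * u) <= _); first by rewrite ler_wpM2l.
have -> : s * (t ^+ 2 * tau * u) = t ^+ 2 * (tau * (s * u)) by ring.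
have -> : t ^+ 2 * z * (16 * L * l) = t ^+ 2 * (16 * L * (z * l)) by ring.
by rewrite ler_wpM2l // exprn_ge0 // ltW.
Qed.

(** The upper limit on [x] guarantees [block_ratio * A * x < p], so that fractions with numerator up
    to [x] and denominator up to [block_ratio * A] can be compared as rational numbers. *)
Lemma burgess_sum_near (eps tau : R) : 0 < eps -> 0 < tau ->
  \forall p \near \oo, prime p -> forall x : nat,
    p%:R `^ (1 / 4 + eps) <= x%:R :> R -> x%:R ^+ 2 <= p%:R :> R ->
    (\sum_(n < x) qchi (n.+1%:R : 'F_p))%:~R <= tau * x%:R :> R.
Proof.
(* As [r > 1 / eps], a [B] of order [p ^ (1 / (2 * r))] meets [p <= B ^ r.*2] and costs at most a
   constant times [p ^ (eps / 2)]. *)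
move=> e0 t0; pose r := (Num.truncn eps^-1).+1.
have re : 1 <= r%:R * eps.
  by rewrite -ler_pdivrMr // div1r; apply/ltW/truncnS_gt.
have r0 : 0 < r%:R :> R by rewrite ltr0n.
pose d := (r.*2)%:R^-1 : R.
have d0 : 0 < d by rewrite invr_gt0 ltr0n.
have de : d <= eps / 2.
  rewrite /d -mul2n natrM invfM mulrC ler_pM2r ?invr_gt0 //.
  by rewrite -div1r ler_pdivrMr // mulrC.
have dr : d <= 1 / 2.
  rewrite /d -mul2n natrM invfM div1r ger_pMr ?invr_gt0 // invf_le1 // ler1n //.
pose t := tau / 4; have tp : 0 < t by rewrite divr_gt0.
pose c : R := ((r ^ r.*2)%:R + (51 * r.*2.+1)%:R) / t ^+ r.*2.
pose L : R := block_ratio%:R.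
have L0 : 0 < L by rewrite ltr0n block_ratio_gt0.
have half0 : 0 < 1 / 2 :> R by rewrite divr_gt0.
have quart0 : 0 < 1 / 4 :> R by rewrite divr_gt0.
have d2e : d * 2 <= eps by rewrite mulrC -ler_pdivlMl // mulrC.
near=> p => pp x xlo xhi.
have n1 : 5 <= p%:R `^ (1 / 2) :> R by near: p; apply: powR_ge_near.
have n2 : 8 * L / tau <= p%:R `^ (1 / 4) by near: p; apply: powR_ge_near.
have n3 : tau <= p%:R `^ d by near: p; apply: powR_ge_near.
have n4 : (L + 2) * c * (16 * L) / (t ^+ 2 * tau) * ln p%:R <= p%:R `^ eps.
  by near: p; apply: ln_le_powR_near.
have n5 : (3 <= p)%N by near: p; exists 3%N.
have n6 : ((r.*2 + 5) ^ 2 <= p)%N by near: p; exists ((r.*2 + 5) ^ 2)%N.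
have p0 : 0 < p%:R :> R by rewrite ltr0n prime_gt0.
have p1 : 1 <= p%:R :> R by rewrite ler1n prime_gt0.
have p_neq0 : p%:R != 0 :> R by rewrite gt_eqF.
have podd : odd p by case: (even_prime pp) n5 => // ->.
have [M HM] := exists_sqrtn p.
have rM : (r.*2 + 5 <= M)%N.
  rewrite -ltnS -(@ltn_exp2r _ _ 2) //; case/andP: HM => _; exact: leq_ltn_trans.
have x0R : 0 < x%:R :> R by apply: lt_le_trans xlo; rewrite powR_gt0.
have x0 : (0 < x)%N by rewrite -(ltr0n R).
pose y := p%:R `^ d.
have y1 : 1 <= y by rewrite -[leLHS](powRr0 p%:R) ler_powR // ltW.
have y0 : 0 < y by apply: lt_le_trans y1.
pose B := (Num.truncn y).+1.
have By : y <= B%:R by apply/ltW/truncnS_gt.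
have yB : B%:R <= 2 * y.
  rewrite /B -natr1 mulr_natl mulr2n lerD // truncn_le //; exact: ltW.
have B0R : 0 < B%:R :> R by rewrite ltr0n.
have pB : (p <= B ^ r.*2)%N.
  rewrite -(ler_nat R) natrX; apply: le_trans (_ : y ^+ r.*2 <= _).
    by rewrite -powR_mulrn ?powR_ge0 // /y -powRrM /d mulVf ?powRr1 // gt_eqF ?ltr0n.
  by rewrite lerXn2r ?nnegrE // powR_ge0.
pose s : R := Num.sqrt p%:R.
have s0 : 0 < s by rewrite sqrtr_gt0.
have sE : p%:R `^ (1 / 2) = s by rewrite div1r powR12_sqrt ?ltW.
have Bp : (0 < B < p)%N.
  rewrite /= -(ltr_nat R); apply: le_lt_trans yB _.
  have hy : y <= s by rewrite -sE ler_powR.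
  have -> : p%:R = s * s by rewrite -expr2 sqr_sqrtr // ltW.
  apply: le_lt_trans (_ : 2 * s < _); first by rewrite ler_pM2l.
  by rewrite ltr_pM2r // -sE; apply: lt_le_trans n1; rewrite ltr_nat.
pose u := p%:R `^ eps.
have yu : y <= u by rewrite ler_powR // (le_trans _ d2e) // mulr_natr mulr2n lerDl ltW.
have u0 : 0 < u by rewrite powR_gt0.
have xq : p%:R `^ (1 / 4) * u <= x%:R by rewrite -powRD // p_neq0 implybT.
have xx : s * u ^+ 2 <= x%:R ^+ 2.
  have -> : s * u ^+ 2 = (p%:R `^ (1 / 4) * u) ^+ 2.
    rewrite exprMn -sE; congr (_ * _).
    by rewrite -powR_mulrn ?powR_ge0 // -powRrM; congr (_ `^ _); clear; field.
  by rewrite lerXn2r ?nnegrE ?mulr_ge0 ?powR_ge0.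
(* Chosen so that the shifting error [2 * (block_ratio * A * B)] is at most [tau * x / 2]; the other
   half is [2 * t * x] with [t = tau / 4]. *)
pose w := tau * x%:R / (4 * L * B%:R).
have LB0 : 0 < 4 * L * B%:R by rewrite !mulr_gt0.
have w1 : 1 <= w.
  rewrite /w ler_pdivlMr // mul1r.
  apply: le_trans (_ : tau * (p%:R `^ (1 / 4) * u) <= _); last by rewrite ler_pM2l.
  apply: le_trans (_ : 8 * L * u <= _).
    have -> : 8 * L * u = 4 * L * (2 * u) by clear; ring.
    rewrite ler_pM2l ?mulr_gt0 //; apply: le_trans yB _; by rewrite ler_pM2l.
  by rewrite mulrA ler_pM2r // -ler_pdivrMl // mulrC.
pose A := Num.truncn w.
have Aw : w / 2 <= A%:R by apply: truncn_ge_half.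
have wA : A%:R <= w by rewrite truncn_le // (le_trans _ w1).
have A0 : (0 < A)%N by rewrite truncn_gt0.
have A0R : 0 < A%:R :> R by rewrite ltr0n.
have wB : w * (4 * L * B%:R) = tau * x%:R by rewrite /w mulfVK // gt_eqF.
have AB : A%:R * (4 * L * B%:R) <= tau * x%:R by rewrite -wB ler_wpM2r // ltW.
have mxp : (block_ratio * A * x < p)%N.
  rewrite -(ltr_nat R) !natrM; apply: lt_le_trans xhi; rewrite expr2 ltr_pM2r //.
  rewrite -/L -(ltr_pM2r B0R).
  have h : A%:R * (4 * L * B%:R) <= x%:R * B%:R.
    by apply: le_trans AB _; rewrite mulrC ler_pM2l // (le_trans n3).
  apply: lt_le_trans h; rewrite -[ltRHS]mulr1.
  have -> : A%:R * (4 * L * B%:R) * 1 = L * A%:R * B%:R * 4 by clear; ring.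
  by rewrite ltr_pMr ?mulr_gt0 // ltr1n.
pose P := prime_block A.
have lp0 : 0 < ln p%:R :> R by rewrite ln_gt0 // ltr1n prime_gt1.
have hP : A%:R <= #|P|%:R * ln p%:R :> R.
  apply: le_trans (card_prime_block R A0) _; apply: ler_wpM2l => //.
  rewrite ler_ln ?posrE ?ltr0n ?ler_nat ?muln_gt0 ?A0 ?block_ratio_gt0 ?(prime_gt0 pp) //.
  by apply/ltnW/(leq_ltn_trans _ mxp); rewrite leq_pmulr.
have P0 : (0 < #|P|)%N.
  by rewrite -(ltr0n R) -(pmulr_lgt0 _ lp0); apply: lt_le_trans hP.
have Pcard : (#|P| <= (block_ratio + 1) * A)%N.
  apply: leq_trans (max_card _) _; rewrite card_ord mulnDl mul1n.
  by rewrite -addn1 leq_add2l.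
have Pp a : a \in P -> prime a by rewrite inE => /andP[].
have Pgt a : a \in P -> (A < a)%N by rewrite inE => /andP[].
have HU := large_short_sum_card pp podd Bp HM rM pB tp.
have := burgess_inequality pp podd Pp Pgt A0 mxp (R := R) (tau := t) (B := B) x0 isT P0 tp.
set U := [set _ | _]%SET in HU *.
move=> H; apply: le_trans (H _) _; last first.
  rewrite !natrM -/L.
  have -> : tau = 4 * t by rewrite /t mulrC divfK // gt_eqF // ltr0n.
  move: AB; rewrite (_ : tau = 4 * t); last by rewrite /t mulrC divfK // gt_eqF // ltr0n.
  move: (A%:R : R) (B%:R : R) (x%:R : R) => a b X; clear; lra.
have E2 : (#|P| * x + #|P| * (#|P| * (x %/ A)) <= (block_ratio + 2) * (#|P| * x))%N.
  rewrite -(addn1 1) addnA [leqRHS]mulnDl mul1n addnC leq_add2r.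
  rewrite [leqRHS]mulnCA leq_mul2l; apply/orP; right.
  apply: leq_trans (_ : (block_ratio + 1) * A * (x %/ A) <= _)%N.
    by rewrite leq_mul2r Pcard orbT.
  by rewrite -mulnA leq_mul2l [(A * _)%N]mulnC leq_divM orbT.
pose z : R := (#|P| * x)%:R.
have z0 : 0 < z by rewrite ltr0n muln_gt0 P0.
apply: le_trans (_ : #|U|%:R * ((L + 2) * z) <= _).
  by rewrite natrM ler_wpM2l // /L -natrD -natrM ler_nat.
rewrite -/z exprMn [z ^+ 2]expr2 !mulrA ler_pM2r //.
have c0 : 0 <= c by rewrite divr_ge0 ?exprn_ge0 ?(ltW tp) // addr_ge0.
apply: le_trans (_ : c * s * (L + 2) <= _).
  by rewrite ler_wpM2r ?addr_ge0 ?(ltW L0) // /c mulrAC ler_pdivlMr ?exprn_gt0.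
apply: (@burgess_final_inequality L c t tau z (ln p%:R) s u x%:R A%:R B%:R) => //;
  try exact: ltW.
- have -> : 8 * L * B%:R * A%:R = 2 * A%:R * (4 * L * B%:R) by clear; ring.
  by rewrite -wB ler_pM2r // -ler_pdivrMl // mulrC.
- by apply: le_trans yB _; rewrite ler_pM2l.
- by rewrite /z natrM mulrAC ler_wpM2r.
by rewrite -/u mulrAC ler_pdivrMr ?mulr_gt0 ?exprn_gt0 // [leRHS]mulrC in n4.
Unshelve. all: by end_near. Qed.
End Burgess.

(** * Exponential sums attached to an exponent pair *)

Section DeriveOn.
Local Open Scope classical_set_scope.
Variable R : realType.
Implicit Types (a b x : R) (f g : R -> R).

(** Properness makes the limit in [derive_on] unique. Points to the right of [x] serve when [x < b],
    points to its left when [x = b]. *)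
Lemma within_dnbhs_itv_proper a b x : a < b -> a <= x <= b ->
  ProperFilter (within `[a, b] x^').
Proof.
move=> ab /andP[ax xb]; apply: Build_ProperFilter_ex => P.
rewrite /within /dnbhs /= /within /= => -[e /= e0 eP].
have [xltb|bx] := ltP x b.
  pose h := Num.min (e / 2) (b - x).
  have h0 : 0 < h by rewrite lt_min subr_gt0 xltb divr_gt0.
  exists (x + h); apply: eP; rewrite /ball_ /=.
  - rewrite opprD addNKr normrN gtr0_norm // /h gt_min; apply/orP; left.
    by rewrite ltr_pdivrMr // ltr_pMr // ltr1n.
  - by rewrite gt_eqF // ltrDl.
  rewrite in_itv /=; apply/andP; split; first by rewrite (le_trans ax) // lerDl ltW.
  by rewrite -lerBrDl ge_min lexx orbT.
pose h := Num.min (e / 2) (x - a).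
have h0 : 0 < h by rewrite lt_min subr_gt0 (lt_le_trans ab bx) divr_gt0.
exists (x - h); apply: eP; rewrite /ball_ /=.
- rewrite opprB addrC subrK gtr0_norm // /h gt_min; apply/orP; left.
  by rewrite ltr_pdivrMr // ltr_pMr // ltr1n.
- by rewrite lt_eqF // gtrBl.
rewrite in_itv /=; apply/andP; split; last by rewrite (le_trans _ xb) // gerBl ltW.
by rewrite lerBrDr -lerBrDl ge_min lexx orbT.
Qed.

(** Two functions are needed because an iterate of [derive_on] is known only on the interval, while
    the formula [g] that it agrees with there is differentiable in the ordinary sense. *)
Lemma diff_quot_cvg a b f g x l : a < b -> a <= x <= b ->
  (forall z, a <= z <= b -> f z = g z) -> is_derive x 1 g l ->
  diff_quot f x y @[y --> within `[a, b] x^'] --> l.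
Proof.
move=> ab axb fg /is_derive1_caratheodory[q [gq qc <-]].
have : q y @[y --> within `[a, b] x^'] --> q x.
  move=> P HP.
  exact: (@filterS _ (nbhs x) (nbhs_filter x) _ _ (fun y Py _ _ => Py) (qc P HP)).
apply: cvg_trans; apply: near_eq_cvg.
have H y : y != x -> `[a, b]%classic y -> q y = diff_quot f x y.
  move=> yx; rewrite /= in_itv /= => yab.
  by rewrite /diff_quot !fg // gq mulfK // subr_eq0.
exact: (@filterE _ (nbhs x) (nbhs_filter x) _ H).
Qed.

Lemma derive_on_itv a b f g x l : a < b -> a <= x <= b ->
  (forall z, a <= z <= b -> f z = g z) -> is_derive x 1 g l ->
  cvg (diff_quot f x y @[y --> within `[a, b] x^']) /\ derive_on `[a, b] f x = l.
Proof.
move=> ab axb fg gl; have H := diff_quot_cvg ab axb fg gl.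
split; first by apply/cvg_ex; exists l.
by have ? := within_dnbhs_itv_proper ab axb; apply: (@cvg_lim _ _ _ _ _ _ _ H).
Qed.

End DeriveOn.

Section PowerPhase.
Local Open Scope classical_set_scope.
Variable R : realType.
Implicit Types (a b x y s : R).

Lemma is_derive_scale_powR (k e x : R) : 0 < x ->
  is_derive x 1 (fun z => k * z `^ e) (k * (e * x `^ (e - 1))).
Proof.
move=> x0; have := is_derive1_powR e x0 => H.
have := @is_deriveZ _ _ _ (fun z : R => z `^ e) k x 1 _ H.
by [].
Qed.

Variables (s y a b : R).
Hypotheses (s_gt0 : 0 < s) (s_lt1 : s < 1) (a_gt0 : 0 < a) (ab : a < b).

Let f x := y / (1 - s) * x `^ (1 - s).
Let D j x := (-1) ^+ j * pochhammer s j * y * x `^ (- s - j%:R).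

Let f_derive x : 0 < x -> is_derive x 1 f (D 0 x).
Proof.
move=> x0; have := is_derive_scale_powR (y / (1 - s)) (1 - s) x0.
have -> : y / (1 - s) * ((1 - s) * x `^ (1 - s - 1)) = D 0 x; last exact.
rewrite mulrA divfK ?subr_eq0 ?gt_eqF // /D expr0 /pochhammer big_ord0 !mul1r.
by rewrite subr0 addrAC subrr add0r.
Qed.

Let D_derive j x : 0 < x -> is_derive x 1 (D j) (D j.+1 x).
Proof.
move=> x0; have := is_derive_scale_powR ((-1) ^+ j * pochhammer s j * y) (- s - j%:R) x0.
have -> : (-1) ^+ j * pochhammer s j * y * ((- s - j%:R) * x `^ (- s - j%:R - 1)) = D j.+1 x; last exact.
rewrite /D exprS /pochhammer big_ord_recr /= -[j.+1%:R]natr1 opprD addrA; ring.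
Qed.

Let pos x : a <= x <= b -> 0 < x.
Proof. by move=> /andP[ax _]; apply: lt_le_trans ax. Qed.

Let derive_n_f j x : a <= x <= b -> derive_n_on `[a, b] j.+1 f x = D j x.
Proof.
elim: j x => [|j IH] x axb.
  exact: (derive_on_itv ab axb (fun z _ => erefl (f z)) (f_derive (pos axb))).2.
exact: (derive_on_itv ab axb IH (D_derive j (pos axb))).2.
Qed.

(** The derivatives coincide with the model in the definition of the class, so every [P] and every
    [eps > 0] is admissible. *)
Lemma power_phase_in_F (N eps : R) (P : nat) : 0 < y -> 0 < eps -> N <= a -> b <= 2 * N ->
  in_F N P s y eps a b f.
Proof.
move=> y0 eps0 Na bN; split=> //.
- by move=> x /=; rewrite !in_itv /= => /andP[ax xb]; rewrite (le_trans Na) ?(le_trans xb).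
- move=> j _; split.
    move=> x /=; rewrite in_itv /= => axb.
    case: j => [|j].
      exact: (derive_on_itv ab axb (fun z _ => erefl (f z)) (f_derive (pos axb))).1.
    exact: (derive_on_itv ab axb (@derive_n_f j) (D_derive j (pos axb))).1.
  apply: (@subspace_eq_continuous _ _ _ (D j)).
    by move=> x; rewrite inE /= in_itv /= => axb; exact/esym/derive_n_f.
  apply: continuous_in_subspaceT => x; rewrite inE /= in_itv /= => axb.
  apply: differentiable_continuous; apply/derivable1_diffP.
  exact: (@ex_derive _ _ _ _ _ _ _ (D_derive j (pos axb))).
move=> j x _ axb; rewrite derive_n_f // subrr normr0.
rewrite mulr_gt0 ?powR_gt0 ?(pos axb) // mulr_gt0 // mulr_gt0 //.
by apply: prodr_gt0 => i _; rewrite ltr_pwDl.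
Qed.

End PowerPhase.

Section PowerSums.
Local Open Scope classical_set_scope.
Variable R : realType.

Lemma expi_sum_Re_Im (I : Type) (r : seq I) (P : pred I) (F : I -> R) (c : R) :
  `|\sum_(i <- r | P i) expi (F i)| <= c%:C%C ->
  `|\sum_(i <- r | P i) cos (F i)| <= c /\ `|\sum_(i <- r | P i) sin (F i)| <= c.
Proof.
have -> : \sum_(i <- r | P i) expi (F i) =
   Complex (\sum_(i <- r | P i) cos (F i)) (\sum_(i <- r | P i) sin (F i)).
  elim: r => [|i r IH]; first by rewrite !big_nil.
  by rewrite !big_cons; case: (P i); rewrite IH.
rewrite normc_def /= lecR; set u := \sum_(_ <- _ | _) _; set v := \sum_(_ <- _ | _) _.
move=> H; have ge x z : `|x| <= Num.sqrt (x ^+ 2 + z ^+ 2).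
  by rewrite -sqrtr_sqr ler_wsqrtr // lerDl sqr_ge0.
by split; apply: le_trans H; rewrite ?ge // addrC ge.
Qed.

Lemma exponent_pair_power_sum (kappa lambda s : R) :
  exponent_pair kappa lambda -> 0 < s < 1 ->
  exists2 C : R, 0 < C & forall (Y : nat) (y : R), (0 < Y)%N -> 0 < y ->
    let bound := C * ((y * Y%:R `^ (- s)) `^ kappa * Y%:R `^ lambda + y^-1 * Y%:R `^ s) in
    `|\sum_(Y.+1 <= q < (2 * Y).+1) cos (2 * pi * (y * q%:R `^ (1 - s)))| <= bound /\
    `|\sum_(Y.+1 <= q < (2 * Y).+1) sin (2 * pi * (y * q%:R `^ (1 - s)))| <= bound.
Proof.
move=> [k0 k1 l0 l1 EP] /andP[s0 s1].
have [P [eps [C [eps0 _ C0 H]]]] := EP s s0.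
have s10 : 0 < 1 - s by rewrite subr_gt0.
exists (C / (1 - s)); first by rewrite divr_gt0.
move=> Y y Y0 y0 /=.
have YR0 : 0 < Y%:R :> R by rewrite ltr0n.
(* The phase [y * x ^ (1 - s)] has derivative [z * x ^ (- s)]. Returning from [z] to [y] costs the
   factor [1 / (1 - s)] in the constant. *)
pose z := y * (1 - s); have z0 : 0 < z by rewrite mulr_gt0.
have inF : in_F Y%:R P s z eps Y%:R (2 * Y%:R) (fun x => z / (1 - s) * x `^ (1 - s)).
  by apply: power_phase_in_F => //; rewrite ltr_pMl // ltr1n.
have := H _ _ _ _ _ YR0 z0 inF; rewrite /exp_sum => {}H.
have bd : (C * ((z * Y%:R `^ (- s)) `^ kappa * Y%:R `^ lambda + z^-1 * Y%:R `^ s))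
   <= C / (1 - s) * ((y * Y%:R `^ (- s)) `^ kappa * Y%:R `^ lambda + y^-1 * Y%:R `^ s).
  rewrite -[leRHS]mulrA ler_pM2l // mulrDr; apply: lerD.
    apply: le_trans (_ : (y * Y%:R `^ (- s)) `^ kappa * Y%:R `^ lambda <= _).
      apply: ler_wpM2r; first exact: powR_ge0.
      apply: ge0_ler_powR; rewrite ?nnegrE ?mulr_ge0 ?powR_ge0 ?(ltW z0) ?(ltW y0) ?(ltW s10) //.
      apply: ler_wpM2r; first exact: powR_ge0.
      by rewrite /z ler_piMr ?(ltW y0) // gerBl ltW.
    by rewrite ler_peMl ?mulr_ge0 ?powR_ge0 // invf_ge1 // gerBl ltW.
  by rewrite /z invfM mulrA [y^-1 * _]mulrC.
have E (F : nat -> R[i]) :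
    \sum_(0 <= n < (Num.truncn (2 * Y%:R : R)).+1 | Y%:R < n%:R <= (2 * Y%:R : R)) F n
    = \sum_(Y.+1 <= q < (2 * Y).+1) F q.
  rewrite -natrM natrK (@big_nat_widenl _ _ _ Y.+1 0) //= [RHS]big_mkcond [LHS]big_mkcond /=.
  apply: eq_big_nat => i /andP[_ iY]; rewrite !ltr_nat ler_nat.
  by rewrite -[(i <= _)%N]ltnS iY andbT.
have z1 : z / (1 - s) = y by rewrite /z mulfK // gt_eqF.
rewrite E /= z1 in H; have [Hc Hs] := expi_sum_Re_Im H.
by split; apply: le_trans bd.
Qed.
End PowerSums.

(** * A trigonometric minorant *)

Section TrigMinorant.
Variable R : realType.
Implicit Types (t c : R) (L : nat).

Lemma cos_absz (z : int) t : cos (z%:~R * t) = cos (`|z|%N%:R * t).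
Proof. by case: z => n //; rewrite NegzE abszN mulrNz mulNr cosN. Qed.

Definition mult_count (I : finType) (z : I -> int) (h : nat) : nat :=
  #|[pred i | `|z i|%N == h]|.

Lemma sum_cos_collapse (I : finType) (z : I -> int) (H : nat) t :
  (forall i, `|z i| < H)%N ->
  \sum_i cos ((z i)%:~R * t) = \sum_(h < H) (mult_count z h)%:R * cos (h%:R * t).
Proof.
move=> zH; rewrite (partition_big (fun i => Ordinal (zH i)) xpredT) //=.
apply: eq_bigr => h _; rewrite /mult_count mulr_natl -sumr_const.
apply: eq_big => [i|i /eqP <-]; first by rewrite inE -val_eqE.
by rewrite cos_absz.
Qed.

(* Up to the sign of [z i], the pair made of [f i] and [h] determines [i]. *)
Lemma mult_count_le (I J : finType) (z : I -> int) (f : I -> J) h :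
  (forall i i', f i = f i' -> z i = z i' -> i = i') -> (mult_count z h <= 2 * #|J|)%N.
Proof.
move=> inj; have inj2 : {in [pred i | `|z i|%N == h] &, injective (fun i => (0 <= z i, f i))}.
  move=> i i'; rewrite !inE => /eqP e /eqP e' [es ef]; apply: inj => //.
  by move: es; case: (z i) e; case: (z i') e' => m + n => /= <- // [->].
rewrite /mult_count -(card_in_imset inj2); apply: leq_trans (max_card _) _.
by rewrite card_prod card_bool.
Qed.

Definition csum L t : R := \sum_(i < L) cos (i%:R * t).
Definition ssum L t : R := \sum_(i < L) sin (i%:R * t).
Definition fejer L t : R := csum L t ^+ 2 + ssum L t ^+ 2.

Lemma fejer_closed L t : (1 - cos t) * fejer L t = 1 - cos (L%:R * t).
Proof.
(* [re] and [im] are the real and imaginary parts of the geometric sum multiplied by [1 - expi t].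
   Adding their squares compares moduli, and the square of [|1 - expi t|] is [2 * (1 - cos t)]. *)
have re : csum L t * (1 - cos t) + ssum L t * sin t = 1 - cos (L%:R * t).
  rewrite /csum /ssum; elim: L => [|L IH]; first by rewrite !big_ord0 !mul0r cos0 subrr addr0.
  rewrite !big_ord_recr /= -natr1 [(_ + 1) * t]mulrDl mul1r cosD.
  move: IH; move: (\sum_(i < L) cos _) (\sum_(i < L) sin _) (cos _) (sin (L%:R * _)) => *; lra.
have im : ssum L t * (1 - cos t) - csum L t * sin t = - sin (L%:R * t).
  rewrite {re} /csum /ssum; elim: L => [|L IH]; first by rewrite !big_ord0 !mul0r sin0 subrr oppr0.
  rewrite !big_ord_recr /= -natr1 [(_ + 1) * t]mulrDl mul1r sinD.
  move: IH; move: (\sum_(i < L) cos _) (\sum_(i < L) sin _) (cos (L%:R * _)) (sin (L%:R * _)) => *; lra.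
have p1 := cos2Dsin2 t; have p2 := cos2Dsin2 (L%:R * t).
have := congr1 (fun x => x ^+ 2) re; have := congr1 (fun x => x ^+ 2) im.
rewrite /fejer; move: p1 p2 {re im}.
move: (cos t) (sin t) (cos (L%:R * t)) (sin (L%:R * t)) (csum L t) (ssum L t).
move=> a b u v C S p1 p2 e1 e2.
have E : (C ^+ 2 + S ^+ 2) * ((1 - a) ^+ 2 + b ^+ 2) = (1 - u) ^+ 2 + v ^+ 2.
  by rewrite -e2 -[v ^+ 2]sqrrN -e1; ring.
have E1 : (1 - a) ^+ 2 + b ^+ 2 = 2 * (1 - a) by rewrite -[RHS]addr0 -(subrr (a ^+ 2 + b ^+ 2)) {2}p1; ring.
have E2 : (1 - u) ^+ 2 + v ^+ 2 = 2 * (1 - u) by rewrite -[RHS]addr0 -(subrr (u ^+ 2 + v ^+ 2)) {2}p2; ring.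
rewrite E1 E2 in E; lra.
Qed.

Lemma fejerE L t :
  fejer L t = \sum_(q : 'I_L * 'I_L) cos ((q.1%:Z - q.2%:Z)%:~R * t).
Proof.
rewrite /fejer !expr2 /csum /ssum !big_distrlr /= -big_split /=.
under eq_bigr do rewrite -big_split /=.
rewrite pair_big; apply: eq_bigr => q _.
by rewrite rmorphB mulrBl cosB.
Qed.

(** Swapping the coordinates changes the sign. This removes the product of sines when the kernel is
    squared. *)
Lemma fejer_sinE L t :
  \sum_(q : 'I_L * 'I_L) sin ((q.1%:Z - q.2%:Z)%:~R * t) = 0.
Proof.
transitivity (ssum L t * csum L t - csum L t * ssum L t); last by rewrite mulrC subrr.
rewrite /csum /ssum !big_distrlr /= !pair_big /= -sumrB.
by apply: eq_bigr => q _; rewrite rmorphB mulrBl sinB.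
Qed.

Let z4 L (q : ('I_L * 'I_L) * ('I_L * 'I_L)) : int :=
  (q.1.1%:Z - q.1.2%:Z) + (q.2.1%:Z - q.2.2%:Z).
Let z2 L (k : int) (q : 'I_L * 'I_L) : int := (q.1%:Z - q.2%:Z) + k.

Lemma fejer_sqrE L t :
  fejer L t ^+ 2 = \sum_(q : ('I_L * 'I_L) * ('I_L * 'I_L)) cos ((z4 q)%:~R * t).
Proof.
pose S : R := \sum_(q : 'I_L * 'I_L) sin ((q.1%:Z - q.2%:Z)%:~R * t).
transitivity (fejer L t * fejer L t - S * S).
  by rewrite expr2 [S]fejer_sinE mulr0 subr0.
rewrite fejerE /S !big_distrlr /= !pair_big /= -sumrB.
by apply: eq_bigr => q _; rewrite /z4 [in RHS]rmorphD mulrDl cosD.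
Qed.

Lemma cos_mul_fejerE L t : cos (L%:R * t) * fejer L t =
  \sum_(q : 'I_L * 'I_L) cos ((z2 L%:Z q)%:~R * t) / 2 +
  \sum_(q : 'I_L * 'I_L) cos ((z2 (- L%:Z) q)%:~R * t) / 2.
Proof.
rewrite fejerE -big_split mulr_sumr; apply: eq_bigr => q _ /=.
rewrite /z2; move: (q.1%:Z - q.2%:Z) => z.
rewrite !rmorphD rmorphN /= -pmulrn mulrDl mulrBl cosD cosB.
move: (cos (L%:R * t)) (cos (z%:~R * t)) (sin (L%:R * t)) (sin (z%:~R * t)) => *; lra.
Qed.

(** The additive energy of an interval: its [L ^ 2] pairs have fewer than [2 * L] sums, and
    Cauchy-Schwarz applies. *)
Lemma quadruple_count L : (L ^ 3 <= 2 * mult_count (@z4 L) 0)%N.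
Proof.
case: L => [//|L].
pose s (q : 'I_L.+1 * 'I_L.+1) : 'I_(L + L).+1 := inord (q.1 + q.2).
have sE q : s q = (q.1 + q.2)%N :> nat.
  by rewrite inordK // ltnS leq_add // -ltnS ltn_ord.
pose v (x : 'I_(L + L).+1) := #|[pred q | s q == x]|.
have v1 : (\sum_x v x = L.+1 ^ 2)%N.
  rewrite -[RHS]mulnn -{1 2}(card_ord L.+1) -card_prod -sum1_card.
  rewrite (partition_big s xpredT) //=; apply: eq_bigr => x _.
  by rewrite /v -sum1_card.
have v2 : (\sum_x v x ^ 2 = mult_count (@z4 L.+1) 0)%N.
  rewrite /mult_count -sum1_card.
  (* After this rearrangement the vanishing of [z4] says that the two pairs have equal sums. *)
  pose sw (q : ('I_L.+1 * 'I_L.+1) * ('I_L.+1 * 'I_L.+1)) := ((q.1.1, q.2.1), (q.1.2, q.2.2)).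
  have swK : involutive sw by case=> [[a b] [c d]].
  rewrite (reindex_inj (inv_inj swK)) /=.
  rewrite (partition_big (fun q => s q.1) xpredT) //=; apply: eq_bigr => x _.
  rewrite -mulnn {1}/v /v -!sum1_card big_distrlr /= pair_big_dep /=.
  by apply: eq_bigl => -[[i j] [k l]]; rewrite !inE /z4 /= -!val_eqE /= !sE /=; lia.
have := sum_sqr_le [set: 'I_(L + L).+1]%SET v.
have E (g : 'I_(L + L).+1 -> nat) : (\sum_(u in [set: 'I_(L + L).+1]%SET) g u = \sum_u g u)%N.
  by apply: eq_bigl => u; rewrite inE.
rewrite !E cardsT card_ord.
rewrite v1 v2 -expnM => h; rewrite -(@leq_pmul2l L.+1) // -expnS.
apply: leq_trans h _; rewrite mulnA leq_mul2r; apply/orP; right; lia.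
Qed.

(* The cosine polynomial is [(cos t - c) * fejer L t ^+ 2]; by [fejer_closed] it equals
   [(1 - c) * fejer L t ^+ 2 - (1 - cos (L%:R * t)) * fejer L t]. *)
Lemma trig_minorant L c : (0 < L)%N -> c <= 1 -> 4 <= (1 - c) * L%:R ^+ 2 ->
  exists a : nat -> R, [/\ 0 < a 0%N, forall h, `|a h| <= 12 * a 0%N &
    forall t, 0 < a 0%N + \sum_(1 <= h < L.*2) a h * cos (h%:R * t) -> c < cos t].
Proof.
move=> L0 c1 cL; have L0R : 0 < L%:R :> R by rewrite ltr0n.
pose a h : R := (1 - c) * (mult_count (@z4 L) h)%:R - (mult_count (@z2 L 0) h)%:R
  + ((mult_count (@z2 L L%:Z) h)%:R + (mult_count (@z2 L (- L%:Z)) h)%:R) / 2.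
have cL3 : 4 * L%:R <= (1 - c) * L%:R ^+ 3 by rewrite [_ ^+ 3]exprSr mulrA ler_pM2r.
have n4 h : (mult_count (@z4 L) h)%:R <= 2 * L%:R ^+ 3 :> R.
  rewrite -natrX -natrM ler_nat.
  have := @mult_count_le _ _ (@z4 L) (fun q => (q.1.1, q.1.2, q.2.1)) h.
  rewrite !card_prod card_ord -!mulnA -[(L * (L * L))%N]/(L ^ 3)%N; apply.
  move=> [[i j] [k l]] [[i' j'] [k' l']] /= [-> -> ->]; rewrite /z4 /= => e.
  by have /val_inj -> : l = l' :> nat by lia.
have n2 k h : (mult_count (@z2 L k) h)%:R <= 2 * L%:R :> R.
  rewrite -natrM ler_nat -[in leqRHS](card_ord L).
  apply: (@mult_count_le _ _ _ (fun q => q.1)) => -[i j] [i' j'] /= ->; rewrite /z2 /= => e.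
  by have /val_inj -> : j = j' :> nat by lia.
have n20 : mult_count (@z2 L 0) 0 = L.
  rewrite /mult_count -[RHS](card_ord L) -(card_imset _ (f := fun i : 'I_L => (i, i))) => [|i j [] //].
  apply: eq_card => -[i j]; rewrite !inE /z2 /=; apply/idP/imsetP => [e|[k _ [-> ->]]]; last by lia.
  by exists i => //; have /val_inj -> : j = i :> nat by lia.
(* The energy contributes at least half of [(1 - c) * L ^ 3], and the subtracted [L] is at most a
   quarter of it by the hypothesis on [L]. *)
have a0 : (1 - c) * L%:R ^+ 3 <= 4 * a 0%N.
  rewrite /a n20.
  have : L%:R ^+ 3 <= 2 * (mult_count (@z4 L) 0)%:R :> R.
    by rewrite -natrX -natrM ler_nat quadruple_count.
  move=> /(ler_wpM2l (_ : 0 <= 1 - c)); rewrite subr_ge0 => /(_ c1).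
  have : 0 <= (mult_count (@z2 L L%:Z) 0)%:R :> R by [].
  have : 0 <= (mult_count (@z2 L (- L%:Z)) 0)%:R :> R by [].
  move: cL3 {cL}; move: (mult_count (@z4 L) 0)%:R (mult_count (@z2 L L%:Z) 0)%:R
    (mult_count (@z2 L (- L%:Z)) 0)%:R (L%:R ^+ 3) => y x1 x2 M; lra.
exists a; split.
- have : 0 < (1 - c) * L%:R ^+ 3 by apply: lt_le_trans cL3; rewrite mulr_gt0.
  by move=> h; have := lt_le_trans h a0; rewrite pmulr_rgt0.
- move=> h.
  have aux (A M y x1 x2 x3 : R) : M <= 4 * A -> 4 * L%:R <= M -> 0 <= y -> y <= 2 * M ->
      0 <= x1 -> x1 <= 2 * L%:R -> 0 <= x2 -> x2 <= 2 * L%:R -> 0 <= x3 -> x3 <= 2 * L%:R ->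
      `|y - x3 + (x1 + x2) / 2| <= 12 * A.
    by move=> *; rewrite ler_norml; apply/andP; split; lra.
  apply: (aux _ ((1 - c) * L%:R ^+ 3)) => //; try exact: n2.
    by rewrite mulr_ge0 // subr_ge0.
  by rewrite mulrCA ler_wpM2l // subr_ge0.
move=> t.
have zH4 (q : ('I_L * 'I_L) * ('I_L * 'I_L)) : (`|z4 q| < L.*2)%N.
  case: q => -[i j] [k l]; rewrite /z4 /=.
  have := ltn_ord i; have := ltn_ord j; have := ltn_ord k; have := ltn_ord l; lia.
have zH2 (k : int) (q : 'I_L * 'I_L) : (`|k| <= L)%N -> (`|z2 k q| < L.*2)%N.
  case: q => i j; rewrite /z2 /=; have := ltn_ord i; have := ltn_ord j; lia.
have E : a 0%N + \sum_(1 <= h < L.*2) a h * cos (h%:R * t) = (cos t - c) * fejer L t ^+ 2.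
  have -> : a 0%N + \sum_(1 <= h < L.*2) a h * cos (h%:R * t) =
      \sum_(h < L.*2) a h * cos (h%:R * t).
    rewrite -(big_mkord xpredT (fun h => a h * cos (h%:R * t))) big_ltn ?double_gt0 //.
    by rewrite mul0r cos0 mulr1.
  have -> : (cos t - c) * fejer L t ^+ 2 =
     (1 - c) * fejer L t ^+ 2 - (1 - cos t) * fejer L t * fejer L t by ring.
  rewrite fejer_closed [(1 - cos _) * _]mulrBl mul1r cos_mul_fejerE -!mulr_suml fejer_sqrE.
  have -> : fejer L t = \sum_q cos ((@z2 L 0 q)%:~R * t).
    by rewrite fejerE; apply: eq_bigr => q _; rewrite /z2 addr0.
  rewrite !(sum_cos_collapse _ (H := L.*2)) => [|q|q|q|q]; try exact: zH4; try by apply: zH2; lia.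
  rewrite mulr_sumr !mulr_suml -big_split /= -sumrB -[LHS]/(\sum_(h < _) _) -sumrB.
  by apply: eq_bigr => h _; rewrite /a; lra.
rewrite E => H; rewrite ltNge; apply/negP => tc.
move: H; rewrite ltNge => /negP; apply; apply: mulr_le0_ge0; rewrite ?sqr_ge0 ?subr_le0 //.
Qed.

End TrigMinorant.

(** * Spacing of near-coincident frequencies *)

Section SecondMoment.
Variable R : realType.

(** Chebyshev's inequality: a bad [q] contributes at least [b ^+ 2] to the second moment over [Q].
    Expanding the square moves the sum over [q] inside, where it can oscillate. *)
Lemma bad_count_le (I : finType) (D : {set I}) (Q : seq nat) (bad : pred nat)
    (w : I -> R) (g : I -> nat -> R) (W b : R) :
  0 <= b -> (forall x, `|w x| <= W) ->
  (forall q, q \in Q -> bad q -> b <= `|\sum_(x in D) w x * g x q|) ->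
  (count bad Q)%:R * b ^+ 2 <=
    W ^+ 2 * \sum_(x in D) \sum_(x' in D) `|\sum_(q <- Q) g x q * g x' q|.
Proof.
move=> b0 wW Hb; have W0 x : 0 <= `|w x| <= W by rewrite wW normr_ge0.
apply: (@le_trans _ _ (\sum_(q <- Q) (\sum_(x in D) w x * g x q) ^+ 2)).
  rewrite -sum1_count natr_sum mulr_suml big_mkcond /= [leLHS]big_seq [leRHS]big_seq.
  apply: ler_sum => q qQ; case: ifP => [/(Hb q qQ) h|_]; last exact: sqr_ge0.
  by rewrite mul1r -[leRHS]real_normK ?num_real // lerXn2r ?nnegrE.
have -> : \sum_(q <- Q) (\sum_(x in D) w x * g x q) ^+ 2 =
    \sum_(x in D) \sum_(x' in D) w x * w x' * \sum_(q <- Q) g x q * g x' q.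
  under eq_bigr do rewrite expr2 big_distrlr /=.
  rewrite exchange_big /=; apply: eq_bigr => x _.
  rewrite exchange_big /=; apply: eq_bigr => x' _.
  by rewrite mulr_sumr; apply: eq_bigr => q _; rewrite mulrACA.
rewrite mulr_sumr; apply: ler_sum => x _; rewrite mulr_sumr; apply: ler_sum => x' _.
apply: le_trans (ler_norm _) _; rewrite normrM ler_wpM2r // normrM expr2.
by apply: ler_pM.
Qed.

Lemma powR_sub_ge (al x z : R) : 1 <= al -> 0 < z -> z <= x ->
  z `^ (al - 1) * (x - z) <= x `^ al - z `^ al.
Proof.
move=> al1 z0 zx; have x0 : 0 < x by apply: lt_le_trans zx.
have E u : 0 < u -> u `^ al = u `^ (al - 1) * u.
  by move=> u0; rewrite -{3}[u]powRr1 ?ltW // -powRD ?subrK // (gt_eqF u0) implybT.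
rewrite (E x) // (E z) // mulrBr lerD2r ler_pM2r //.
by apply: ge0_ler_powR; rewrite ?nnegrE ?subr_ge0 ?(ltW x0) ?(ltW z0).
Qed.

Section Spacing.
Variables (K : nat) (al : R).
Hypotheses (K0 : (0 < K)%N) (al1 : 1 <= al) (al2 : al <= 2).
Local Notation M := block_ratio.
Local Notation kT := 'I_(M * K).+1.

(** Half of the least gap between powers of distinct quotients: the quotients are [1 / (M * K) ^ 2]
    apart, and raising to the power [al] loses at most a factor [M]. *)
Definition spacing : R := ((2 * M ^ 3 * K ^ 2)%N%:R)^-1.

Let KR0 : 0 < K%:R :> R. Proof. by rewrite ltr0n. Qed.
Let M1 : 1 <= M%:R :> R. Proof. by rewrite ler1n block_ratio_gt0. Qed.
Let M0 : 0 < M%:R :> R. Proof. exact: lt_le_trans M1. Qed.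

Let kP (k : kT) : k \in prime_block K ->
  [/\ prime k, K%:R <= k%:R :> R, k%:R <= M%:R * K%:R :> R & 0 < k%:R :> R].
Proof.
rewrite inE => /andP[kp Kk]; split=> //.
- by rewrite ler_nat ltnW.
- by rewrite -natrM ler_nat -ltnS ltn_ord.
by rewrite ltr0n prime_gt0.
Qed.

(* Quotients of primes determine the primes, so two distinct ones are at least [1 / (k2 * l2)]
   apart. *)
Let prime_ratio_powR_spaced_le (k1 k2 l1 l2 : kT) :
  k1 \in prime_block K -> k2 \in prime_block K ->
  l1 \in prime_block K -> l2 \in prime_block K ->
  k1 != k2 -> (k1, k2) != (l1, l2) ->
  l1%:R / l2%:R <= k1%:R / k2%:R :> R ->
  2 * spacing <= (k1%:R / k2%:R) `^ al - (l1%:R / l2%:R) `^ al.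
Proof.
move=> /kP[k1p k1lo k1hi k10] /kP[k2p k2lo k2hi k20] /kP[l1p l1lo l1hi l10] /kP[l2p l2lo l2hi l20].
move=> k12 kl le.
have u0 : 0 < l1%:R / l2%:R :> R by rewrite divr_gt0.
apply: le_trans (powR_sub_ge al1 u0 le).
have MK0 : 0 < M%:R * K%:R :> R by rewrite mulr_gt0.
have uM : M%:R^-1 <= l1%:R / l2%:R :> R.
  rewrite ler_pdivlMr // mulrC ler_pdivrMr // mulrC.
  by apply: le_trans l2hi _; rewrite ler_pM2l.
have M01 : 0 < (M%:R^-1 : R) <= 1 by rewrite invr_gt0 M0 invf_le1.
have uM' : M%:R^-1 <= (l1%:R / l2%:R) `^ (al - 1) :> R.
  apply: le_trans (_ : M%:R^-1 `^ (al - 1) <= _); last first.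
    by apply: ge0_ler_powR; rewrite ?nnegrE ?subr_ge0 ?(ltW u0) ?invr_ge0.
  rewrite -[leLHS]powRr1 ?invr_ge0 //; apply: ger_powR => //.
  by move: al2; lra.
have cross : (k1 * l2 != l1 * k2)%N.
  apply: contra kl => /eqP e.
  have k1l1 : k1 = l1.
    have : (k1 %| l1 * k2)%N by rewrite -e dvdn_mulr.
    rewrite Euclid_dvdM // !dvdn_prime2 // => /orP[/eqP/val_inj //|/eqP/val_inj e'].
    by rewrite e' eqxx in k12.
  move: e; rewrite k1l1 => /eqP; rewrite eqn_pmul2l ?prime_gt0 // => /eqP/val_inj ->.
  by rewrite eqxx.
have gap : ((M%:R * K%:R) ^+ 2)^-1 <= k1%:R / k2%:R - l1%:R / l2%:R :> R.
  have e : k1%:R / k2%:R - l1%:R / l2%:R = ((k1 * l2)%:R - (l1 * k2)%:R) / (k2%:R * l2%:R) :> R.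
    by rewrite !natrM; field; rewrite !gt_eqF.
  have : 0 <= k1%:R / k2%:R - l1%:R / l2%:R :> R by rewrite subr_ge0.
  rewrite e pmulr_lge0 ?invr_gt0 ?mulr_gt0 // subr_ge0 ler_nat => h.
  have h1 : 1 <= (k1 * l2)%:R - (l1 * k2)%:R :> R.
    by rewrite -natrB // ler1n subn_gt0 ltn_neqAle eq_sym cross.
  apply: le_trans (_ : (k2%:R * l2%:R)^-1 <= _).
    rewrite lef_pV2 ?posrE ?exprn_gt0 ?mulr_gt0 // expr2.
    by apply: ler_pM.
  by rewrite ler_peMl // invr_ge0 mulr_ge0.
have -> : 2 * spacing = M%:R^-1 * ((M%:R * K%:R) ^+ 2)^-1.
  rewrite /spacing !natrM ?natrX; field.
  by rewrite !gt_eqF.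
by apply: ler_pM => //; rewrite invr_ge0 ?exprn_ge0 // ltW.
Qed.

Lemma prime_ratio_powR_spaced (k1 k2 l1 l2 : kT) :
  k1 \in prime_block K -> k2 \in prime_block K ->
  l1 \in prime_block K -> l2 \in prime_block K ->
  k1 != k2 -> l1 != l2 -> (k1, k2) != (l1, l2) ->
  2 * spacing <= `|(k1%:R / k2%:R) `^ al - (l1%:R / l2%:R) `^ al|.
Proof.
move=> k1P k2P l1P l2P k12 l12 kl.
case: (leP (l1%:R / l2%:R : R) (k1%:R / k2%:R)) => [le|/ltW le].
  by apply: le_trans (ler_norm _); apply: prime_ratio_powR_spaced_le.
rewrite distrC; apply: le_trans (ler_norm _); apply: prime_ratio_powR_spaced_le => //.
by rewrite eq_sym.
Qed.

Definition near_gap : R := K%:R `^ al * spacing.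

Variable H : nat.
Local Notation idx := ('I_H * kT)%type.
Definition frequencies : {set idx} := [set x : idx | (0 < x.1)%N && (x.2 \in prime_block K)].
Definition freq (x : idx) : R := x.1%:R * x.2%:R `^ al.

Let in_freq (x : idx) : (x \in frequencies) = (0 < x.1)%N && (x.2 \in prime_block K).
Proof. by rewrite !inE. Qed.

Lemma freq_diff_ge (x x' : idx) : x \in frequencies -> x' \in frequencies ->
  x.2 = x'.2 -> x != x' -> near_gap <= `|freq x - freq x'|.
Proof.
case: x x' => [h k] [h' k']; rewrite !in_freq /= => /andP[h0 kB] _ <- hh.
have [_ klo _ k0] := kP kB; rewrite /freq /= -mulrBl normrM.
have hh1 : 1 <= `|h%:R - h'%:R| :> R.
  have : (h != h' :> nat) by apply: contra hh => /eqP/val_inj ->.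
  have gap (m n : nat) : (m < n)%N -> 1 <= `|n%:R - m%:R| :> R.
    move=> mn; rewrite -natrB; last exact: ltnW.
    by rewrite normr_nat ler1n subn_gt0.
  by case: (ltngtP h h') => // lt _; [rewrite distrC|]; apply: gap.
rewrite (ger0_norm (powR_ge0 _ _)) /near_gap [leLHS]mulrC; apply: ler_pM.
- by rewrite invr_ge0.
- exact: powR_ge0.
- apply: le_trans hh1; rewrite invf_le1 ?ltr0n ?ler1n ?muln_gt0 ?expn_gt0 ?block_ratio_gt0 //.
    by rewrite K0.
  by rewrite K0.
by apply: ge0_ler_powR; rewrite ?nnegrE // (le_trans ler01 al1).
Qed.

(** Dividing a near coincidence of [h * k ^ al] and [h' * k' ^ al] by [h * k' ^ al] puts
    [(k / k') ^ al] within [spacing] of [h' / h]. For given [h] and [h'] two such quotients would be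
    closer than [2 * spacing]. *)
Lemma near_pair_unique (x x' z z' : idx) :
  x \in frequencies -> x' \in frequencies -> z \in frequencies -> z' \in frequencies ->
  x.1 = z.1 -> x'.1 = z'.1 -> x.2 != x'.2 -> z.2 != z'.2 ->
  `|freq x - freq x'| < near_gap -> `|freq z - freq z'| < near_gap ->
  (x, x') = (z, z').
Proof.
case: x x' z z' => [h k1] [h' k2] [a l1] [a' l2] /=.
rewrite !in_freq /= => /andP[h0 k1B] /andP[h'0 k2B] /andP[_ l1B] /andP[_ l2B] <- <- k12 l12 n1 n2.
have near (k k' : kT) : k \in prime_block K -> k' \in prime_block K ->
    `|freq (h, k) - freq (h', k')| < near_gap ->
    `|(k%:R / k'%:R) `^ al - h'%:R / h%:R| < spacing.
  move=> /kP[_ klo _ k0] /kP[_ klo' _ k0'] n.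
  have hR : 1 <= h%:R :> R by rewrite ler1n.
  have hR0 : 0 < h%:R :> R by rewrite ltr0n.
  have kk : K%:R `^ al <= k'%:R `^ al.
    by apply: ge0_ler_powR; rewrite ?nnegrE // (le_trans ler01 al1).
  have p0 : 0 < K%:R `^ al by rewrite powR_gt0.
  have p0' : 0 < k'%:R `^ al by rewrite powR_gt0.
  have e : (freq (h, k) - freq (h', k')) = ((k%:R / k'%:R) `^ al - h'%:R / h%:R) * (h%:R * k'%:R `^ al).
    rewrite /freq /= powRM ?invr_ge0 ?(ltW k0) ?(ltW k0') //.
    have -> : (k'%:R^-1) `^ al = (k'%:R `^ al)^-1 by rewrite -powR_inv1 ?(ltW k0') // powRAC powR_inv1 ?powR_ge0.
    by field; rewrite !gt_eqF.
  move: n; rewrite e normrM (ger0_norm (_ : 0 <= h%:R * _)); last by rewrite mulr_ge0 ?powR_ge0.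
  rewrite /near_gap [ltRHS]mulrC => n.
  have s0 : 0 < spacing by rewrite invr_gt0 ltr0n !muln_gt0 ?expn_gt0 block_ratio_gt0 K0.
  rewrite ltNge; apply/negP => big; move: n; rewrite ltNge => /negP; apply.
  apply: ler_pM; rewrite ?(ltW s0) ?(ltW p0) //.
  by apply: le_trans kk _; rewrite ler_peMl // ltW.
apply/eqP/negP => /negP ne.
have kl : (k1, k2) != (l1, l2) by apply: contra ne => /eqP[-> ->].
have := prime_ratio_powR_spaced k1B k2B l1B l2B k12 l12 kl.
have := near _ _ k1B k2B n1; have := near _ _ l1B l2B n2.
move: ((k1%:R / _) `^ _) ((l1%:R / _) `^ _) (h'%:R / h%:R) => u v w.
rewrite !ltr_norml => /andP[? ?] /andP[? ?]; rewrite leNgt => /negP; apply.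
by rewrite ltr_norml; apply/andP; split; lra.
Qed.

(** Diagonal pairs give the first term. Distinct pairs with the same prime are never near, and
    different primes allow at most one pair for each [(h, h')]. *)
Lemma near_pairs_count :
  (\sum_(x in frequencies) \sum_(x' in frequencies) (`|freq x - freq x'| < near_gap)%R
    <= H * #|prime_block K| + H ^ 2)%N.
Proof.
have split (x x' : idx) : x \in frequencies -> x' \in frequencies ->
   ((`|freq x - freq x'| < near_gap)%R <=
     (x == x') + ((x.2 != x'.2) && (`|freq x - freq x'| < near_gap)%R))%N.
  move=> xF x'F; case: eqP => [_|/eqP ne]; first by case: (_ < _)%R.
  case: (eqVneq x.2 x'.2) => [e|//]; rewrite ltNge.
  by rewrite freq_diff_ge.
apply: leq_trans (_ : \sum_(x in frequencies) \sum_(x' in frequencies)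
   ((x == x') + ((x.2 != x'.2) && (`|freq x - freq x'| < near_gap)%R)) <= _)%N.
  by apply: leq_sum => x xF; apply: leq_sum => x' x'F; apply: split.
under eq_bigr do rewrite big_split /=.
rewrite big_split /=; apply: leq_add.
  apply: leq_trans (_ : \sum_(x in frequencies) 1 <= _)%N.
    apply: leq_sum => x xF; rewrite (bigD1 x) //= eqxx big1 // => x' /andP[_ /negPf].
    by rewrite eq_sym => ->.
  rewrite sum1_card; apply: leq_trans (_ : #|finset.setX [set: 'I_H] (prime_block K)| <= _)%N.
    by apply/subset_leq_card/fintype.subsetP => x; rewrite !inE => /andP[_].
  by rewrite cardsX cardsT card_ord.
rewrite pair_big_dep /= -big_mkcondr /= sum1_card.
rewrite -[in leqRHS](card_ord H) -mulnn -card_prod.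
rewrite -(card_in_imset (f := fun q : idx * idx => (q.1.1, q.2.1))) ?max_card //.
move=> [x x'] [z z']; rewrite !unfold_in /=.
move=> /andP[/andP[xF x'F] /andP[xx nx]] /andP[/andP[zF z'F] /andP[zz nz]] [e1 e2].
exact: near_pair_unique.
Qed.

End Spacing.
End SecondMoment.

(** * Exceptional integers in a dyadic block *)

Section BadDensity.
Variable R : realType.

Lemma cos_cos (u v : R) : cos u * cos v = (cos (u + v) + cos (u - v)) / 2.
Proof. by rewrite cosD cosB; lra. Qed.

Lemma norm_cos_le1 (u : R) : `|cos u| <= 1.
Proof. by rewrite ler_norml cos_geN1 cos_le1. Qed.

Lemma norm_sin_le1 (u : R) : `|sin u| <= 1.
Proof. by rewrite ler_norml sin_geN1 sin_le1. Qed.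

Lemma sum_cos_shift_le (r : seq nat) (f : nat -> R) (psi B : R) :
  `|\sum_(q <- r) cos (f q)| <= B -> `|\sum_(q <- r) sin (f q)| <= B ->
  `|\sum_(q <- r) cos (f q + psi)| <= 2 * B.
Proof.
move=> Hc Hs.
have -> : \sum_(q <- r) cos (f q + psi) =
    (\sum_(q <- r) cos (f q)) * cos psi - (\sum_(q <- r) sin (f q)) * sin psi.
  by rewrite !mulr_suml -sumrB; apply: eq_bigr => q _; rewrite cosD.
apply: le_trans (ler_normB _ _) _; rewrite !normrM.
have -> : 2 * B = B * 1 + B * 1 by rewrite mulr1 mulr_natl mulr2n.
apply: lerD; apply: ler_pM => //; [exact: norm_cos_le1|exact: norm_sin_le1].
Qed.

Section Fixed.
Variables (kappa lambda s C : R) (Y K H : nat) (phi : R).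
Let gam := 1 - s.
Let al := 2 * gam.
Hypotheses (kappa0 : 0 <= kappa) (C0 : 0 < C) (Y0 : (0 < Y)%N) (K0 : (0 < K)%N).
Hypotheses (s0 : 0 < s) (s12 : s <= 1 / 2).
Hypothesis HC : forall y : R, 0 < y ->
    let bound := C * ((y * Y%:R `^ (- s)) `^ kappa * Y%:R `^ lambda + y^-1 * Y%:R `^ s) in
    `|\sum_(Y.+1 <= q < (2 * Y).+1) cos (2 * pi * (y * q%:R `^ gam))| <= bound /\
    `|\sum_(Y.+1 <= q < (2 * Y).+1) sin (2 * pi * (y * q%:R `^ gam))| <= bound.

Local Notation kT := 'I_(block_ratio * K).+1.

Definition max_freq : R := 2 * (H%:R * (block_ratio%:R * K%:R) `^ al).
Definition phase_bound : R :=
  C * ((max_freq * Y%:R `^ (- s)) `^ kappa * Y%:R `^ lambda + (near_gap K al)^-1 * Y%:R `^ s).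

Let gap0 : 0 < near_gap K al :> R.
Proof.
rewrite mulr_gt0 ?powR_gt0 ?ltr0n // invr_gt0 ltr0n !muln_gt0.
by rewrite ?expn_gt0 block_ratio_gt0 K0.
Qed.

Lemma phase_sum_le (y psi : R) : near_gap K al <= `|y| -> `|y| <= max_freq ->
  `|\sum_(Y.+1 <= q < (2 * Y).+1) cos (2 * pi * (y * q%:R `^ gam) + psi)| <= 2 * phase_bound.
Proof.
move=> ylo yhi; have y0 : 0 < `|y| by apply: lt_le_trans ylo.
have [Hc Hs] := HC y0.
have bd : C * ((`|y| * Y%:R `^ (- s)) `^ kappa * Y%:R `^ lambda + `|y|^-1 * Y%:R `^ s)
    <= phase_bound.
  rewrite /phase_bound ler_pM2l //; apply: lerD; apply: ler_wpM2r; rewrite ?powR_ge0 //.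
    apply: ge0_ler_powR; rewrite ?nnegrE ?mulr_ge0 ?powR_ge0 //.
    by rewrite ler_wpM2r ?powR_ge0.
  by rewrite lef_pV2 ?posrE.
have {}Hc := le_trans Hc bd; have {}Hs := le_trans Hs bd.
have [yp|yn] := leP 0 y.
  by rewrite (ger0_norm yp) in Hc Hs; apply: sum_cos_shift_le.
rewrite (ltr0_norm yn) in Hc Hs; apply: sum_cos_shift_le.
  by under eq_bigr do rewrite -cosN -mulrN -mulNr.
under eq_bigr do rewrite -[sin _]opprK -sinN -mulrN -mulNr.
by rewrite sumrN normrN.
Qed.

Definition theta (k q : nat) : R := 2 * pi * ((q * k ^ 2)%:R `^ gam + phi).
Let g (x : 'I_H * kT) (q : nat) : R := cos (x.1%:R * theta x.2 q).
Local Notation freqs := (frequencies K H).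

Let gE x q : g x q = cos (2 * pi * (freq al x * q%:R `^ gam) + x.1%:R * (2 * pi * phi)).
Proof.
rewrite /g /theta /freq natrM natrX powRM ?exprn_ge0 //.
rewrite -[_ ^+ 2]powR_mulrn // -powRrM -/al; congr cos; ring.
Qed.

Lemma near_gap_le : near_gap K al <= K%:R `^ al :> R.
Proof.
rewrite ler_piMr ?powR_ge0 // invf_le1 ?ltr0n ?ler1n ?muln_gt0 ?expn_gt0 ?block_ratio_gt0 //.
  by rewrite K0.
by rewrite K0.
Qed.

Lemma freq_bounds (x : 'I_H * kT) : x \in freqs ->
  K%:R `^ al <= freq al x /\ 2 * freq al x <= max_freq.
Proof.
case: x => h k; rewrite !inE /= => /and3P[h0 kp Kk]; rewrite /freq /max_freq /=.
have al0 : 0 <= al by rewrite /al /gam; move: s12; lra.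
have k0 : (0 < k)%N := prime_gt0 kp.
split.
  apply: le_trans (_ : k%:R `^ al <= _).
    by apply: ge0_ler_powR; rewrite ?nnegrE // ler_nat ltnW.
  by rewrite ler_peMl ?powR_ge0 // ler1n.
rewrite ler_pM2l //; apply: ler_pM; rewrite ?powR_ge0 // ?ler_nat ?(ltnW (ltn_ord h)) //.
by apply: ge0_ler_powR; rewrite ?nnegrE -?natrM // ler_nat -ltnS.
Qed.

(** The product of cosines splits into a sum and a difference of frequencies. The sum always exceeds
    [near_gap], so only a small difference forces the trivial bound [Y]. *)
Lemma pair_sum_le (x x' : 'I_H * kT) : x \in freqs -> x' \in freqs ->
  `|\sum_(Y.+1 <= q < (2 * Y).+1) g x q * g x' q| <=
    2 * phase_bound + (`|freq al x - freq al x'| < near_gap K al)%R%:R * Y%:R.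
Proof.
move=> xF x'F.
have pb0 : 0 <= phase_bound.
  by rewrite mulr_ge0 ?(ltW C0) // addr_ge0 // mulr_ge0 ?powR_ge0 // invr_ge0 ltW.
have [nr|far] := ltP `|freq al x - freq al x'| (near_gap K al).
  rewrite mul1r -[leLHS]add0r; apply: lerD; first by rewrite mulr_ge0.
  apply: le_trans (ler_norm_sum _ _ _) _.
  apply: le_trans (_ : \sum_(Y.+1 <= q < (2 * Y).+1) 1 <= _).
    apply: ler_sum => q _; rewrite normrM -[leRHS]mulr1.
    by apply: ler_pM => //; apply: norm_cos_le1.
  by rewrite big_const_nat iter_addr_0 subSS mul2n -addnn addnK.
rewrite mul0r addr0.
have [lo hi] := freq_bounds xF; have [lo' hi'] := freq_bounds x'F.
have kal0 : 0 <= K%:R `^ al :> R by apply: powR_ge0.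
have gl := near_gap_le.
have E : \sum_(Y.+1 <= q < (2 * Y).+1) g x q * g x' q =
  ((\sum_(Y.+1 <= q < (2 * Y).+1)
      cos (2 * pi * ((freq al x + freq al x') * q%:R `^ gam) +
           (x.1%:R * (2 * pi * phi) + x'.1%:R * (2 * pi * phi)))) +
   (\sum_(Y.+1 <= q < (2 * Y).+1)
      cos (2 * pi * ((freq al x - freq al x') * q%:R `^ gam) +
           (x.1%:R * (2 * pi * phi) - x'.1%:R * (2 * pi * phi))))) / 2.
  rewrite -big_split mulr_suml; apply: eq_bigr => q _ /=.
  rewrite !gE cos_cos; congr (_ / 2); congr (cos _ + cos _); ring.
rewrite E normrM (ger0_norm (_ : 0 <= 2^-1)) ?invr_ge0 // ler_pdivrMr //.
have -> : 2 * phase_bound * 2 = 2 * phase_bound + 2 * phase_bound by ring.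
move: lo hi lo' hi' kal0 gl far; move: (freq al x) (freq al x') (K%:R `^ al) => u v w.
move=> lo hi lo' hi' kal0 gl far; apply: le_trans (ler_normD _ _) _; apply: lerD.
  apply: phase_sum_le; rewrite ger0_norm; lra.
apply: phase_sum_le => //; rewrite ler_norml; apply/andP; split; lra.
Qed.

(** At a bad [q] the polynomial is nonpositive for every prime [k], so its oscillating parts add up
    to at least [#|prime_block K| * a 0] in absolute value. As all coefficients are at most
    [12 * a 0], this scale cancels and leaves [144]. *)
Lemma bad_density (a : nat -> R) (bad : pred nat) :
  0 < a 0%N -> (forall h, `|a h| <= 12 * a 0%N) -> (0 < H)%N ->
  (forall q (k : kT), bad q -> k \in prime_block K ->
     a 0%N + \sum_(1 <= h < H) a h * cos (h%:R * theta k q) <= 0) ->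
  (count bad (index_iota Y.+1 (2 * Y).+1))%:R * #|prime_block K|%:R ^+ 2 <=
    144 * ((H * #|prime_block K|)%:R ^+ 2 * (2 * phase_bound)
           + Y%:R * (H * #|prime_block K| + H ^ 2)%:R) :> R.
Proof.
move=> a0 ale H0 Hbad.
have sumE q : \sum_(x in freqs) a x.1 * g x q =
    \sum_(k in prime_block K) \sum_(1 <= h < H) a h * cos (h%:R * theta k q).
  rewrite exchange_big /=.
  rewrite (eq_bigl (fun x : 'I_H * kT => (0 < x.1)%N && (x.2 \in prime_block K))) => [|x]; last first.
    by rewrite !inE.
  rewrite -(pair_big (fun h : 'I_H => (0 < h)%N) (mem (prime_block K))
     (fun (h : 'I_H) (k : kT) => a h * cos (h%:R * theta k q))) /=.
  by rewrite big_geq_mkord.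
have key q : q \in index_iota Y.+1 (2 * Y).+1 -> bad q ->
    #|prime_block K|%:R * a 0%N <= `|\sum_(x in freqs) a x.1 * g x q|.
  move=> _ bq; rewrite sumE -normrN; apply: le_trans (ler_norm _).
  rewrite -sumrN mulr_natl -sumr_const; apply: ler_sum => k kK.
  by have := Hbad q k bq kK; rewrite addrC -lerBrDr sub0r lerNr.
have b0 : 0 <= #|prime_block K|%:R * a 0%N by rewrite mulr_ge0 // ltW.
have := bad_count_le b0 (fun x : 'I_H * kT => ale x.1) key.
have pb0 : 0 <= phase_bound.
  by rewrite mulr_ge0 ?(ltW C0) // addr_ge0 // mulr_ge0 ?powR_ge0 // invr_ge0 ltW.
have al1 : 1 <= al by rewrite /al /gam; move: s12; lra.
have al2 : al <= 2 by rewrite /al /gam; move: s0; lra.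
have cF : (#|freqs| <= H * #|prime_block K|)%N.
  apply: leq_trans (_ : #|finset.setX [set: 'I_H] (prime_block K)| <= _)%N.
    by apply/subset_leq_card/fintype.subsetP => x; rewrite !inE => /andP[_].
  by rewrite cardsX cardsT card_ord.
have big : \sum_(x in freqs) \sum_(x' in freqs)
    `|\sum_(q <- index_iota Y.+1 (2 * Y).+1) g x q * g x' q| <=
    (H * #|prime_block K|)%:R ^+ 2 * (2 * phase_bound)
           + Y%:R * (H * #|prime_block K| + H ^ 2)%:R.
  apply: le_trans (_ : \sum_(x in freqs) \sum_(x' in freqs) (2 * phase_bound +
     (`|freq al x - freq al x'| < near_gap K al)%R%:R * Y%:R) <= _).
    by apply: ler_sum => x xF; apply: ler_sum => x' x'F; apply: pair_sum_le.
  under eq_bigr do rewrite big_split sumr_const -mulr_suml /=.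
  rewrite big_split sumr_const -mulr_suml /=; apply: lerD.
    rewrite -mulrnA -[leLHS]mulr_natl; apply: ler_wpM2r; first by rewrite mulr_ge0.
    by rewrite -natrX ler_nat -mulnn leq_mul.
  rewrite mulrC ler_wpM2l //.
  under eq_bigr do rewrite -natr_sum.
  by rewrite -natr_sum ler_nat near_pairs_count.
move=> h; have {}h := le_trans h (ler_wpM2l (sqr_ge0 _) big).
move: h; move: (_ + _ * _) (count _ _)%:R #|_|%:R (a 0%N) a0 => X n P A A0 h.
rewrite -(ler_pM2r (exprn_gt0 2 A0)).
have -> : n * P ^+ 2 * A ^+ 2 = n * (P * A) ^+ 2 by ring.
by have -> : 144 * X * A ^+ 2 = (12 * A) ^+ 2 * X by ring.
Qed.

End Fixed.
End BadDensity.

(** * From an inequality between cosines to the value of a floor *)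

Section GapAndPhase.
Variable R : realType.

(** With [v = m / (m + 1)] one has [v ^ gam <= v ^ (1 / 2) <= (1 + v) / 2], and
    [1 - v = 1 / (m + 1)]. *)
Lemma powR_succ_gap (gam m : R) : 1 / 2 <= gam -> 0 <= m ->
  (m + 1) `^ (gam - 1) / 2 <= (m + 1) `^ gam - m `^ gam.
Proof.
move=> g2 m0; have m1 : 0 < m + 1 by rewrite ltr_wpDl.
have E : (m + 1) `^ (gam - 1) = (m + 1) `^ gam / (m + 1).
  by rewrite powRB ?(gt_eqF m1) ?implybT // powRr1 // ltW.
pose v := m / (m + 1).
have v0 : 0 <= v by rewrite divr_ge0 // ltW.
have v1 : v <= 1 by rewrite ler_pdivrMr // mul1r lerDl.
have Ev : m `^ gam = (m + 1) `^ gam * v `^ gam.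
  by rewrite -powRM ?(ltW m1) // mulrC /v divfK // gt_eqF.
have vg : v `^ gam <= v + (1 - v) / 2.
  apply: le_trans (_ : v `^ (1 / 2) <= _).
    have [->|vn] := eqVneq v 0; first by rewrite !powR0 ?gt_eqF //; move: g2; lra.
    by apply: ger_powR => //; rewrite v1 andbT lt_def vn.
  rewrite div1r powR12_sqrt // -(@ler_pXn2r _ 2) ?nnegrE ?sqrtr_ge0 //; last by lra.
  by rewrite sqr_sqrtr //; have := sqr_ge0 ((1 - v) / 2); nra.
rewrite E Ev -[X in X - _]mulr1 -mulrBr -mulrA ler_wpM2l ?powR_ge0 //.
have -> : (m + 1)^-1 = 1 - v by rewrite /v; field; rewrite gt_eqF.
lra.
Qed.

Lemma sin_ge_half_near0 :
  exists2 d : R, 0 < d & forall y, 0 <= y -> y < d -> y / 2 <= sin y.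
Proof.
have /is_derive1_caratheodory[q [sq qc q0]] := is_derive_sin (0 : R).
have h : \forall z \near (0 : R)%R, 1 / 2 < q z.
  have qc1 : (q z @[z --> (0 : R)] --> q 0)%classic := qc.
  have h1 : 1 / 2 < q 0 by rewrite q0 cos0; lra.
  exact: (cvgr_gt _ qc1 _ h1).
have [d /= d0 Hd] := h; exists d => // y y0 yd.
have /Hd /= qy : ball (0 : R) d y by rewrite /ball /= sub0r normrN ger0_norm.
by have := sq y; rewrite sin0 !subr0 => ->; rewrite mulrC ler_wpM2r // -div1r ltW.
Qed.

Lemma cos_periodz (x : R) (n : int) : cos (x + 2 * pi * n%:~R) = cos x.
Proof.
have per (m : nat) (z : R) : cos (z + 2 * pi * m%:R) = cos z.
  rewrite -[RHS](periodicn (@cosD2pi R) m z); congr (cos (z + _)).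
  by rewrite mulr_natr mulr_natl.
case: n => n; first exact: per.
rewrite NegzE -[LHS](per n.+1); congr cos; rewrite mulrNz; ring.
Qed.

Lemma cos_gt_int (x d : R) : 0 <= d -> d <= 1 / 2 -> cos (2 * pi * d) < cos (2 * pi * x) ->
  exists n : int, `|x - n%:~R| < d.
Proof.
move=> d0 d2 H; have pi0 : 0 < pi :> R := pi_gt0 R.
pose n := Num.floor (x + 1 / 2); exists n.
have := floor_itv (x + 1 / 2); rewrite -/n intrD => /andP[n1 n2].
have y2 : `|x - n%:~R| <= 1 / 2 by rewrite ler_norml; apply/andP; split; lra.
have E : cos (2 * pi * x) = cos (2 * pi * `|x - n%:~R|).
  rewrite -[LHS](cos_periodz _ (- n)) mulrNz -mulrDr.
  by case: (ger0P (x - n%:~R)) => // _; rewrite mulrN cosN.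
have B (z : R) : 0 <= z -> z <= 1 / 2 -> 0 <= 2 * pi * z <= pi.
  move=> z0 z2; rewrite !mulr_ge0 ?(ltW pi0) //=.
  by have := ler_wpM2l (ltW pi0) z2; move: (pi * z) (pi : R) => *; lra.
by move: H; rewrite E ltr_cos ?in_itv ?B // ltr_pM2l // mulr_gt0.
Qed.

(* A phase [m ^ gam] just below an integer [n] means that [n ^ c] is just above [m]. *)
Lemma floor_powR_of_cos (c d : R) (m : nat) : 1 < c -> (0 < m)%N -> 0 <= d -> d <= 1 / 2 ->
  2 * d <= (m%:R + 1) `^ c^-1 - m%:R `^ c^-1 ->
  cos (2 * pi * d) < cos (2 * pi * (m%:R `^ c^-1 + d)) ->
  exists n : nat, [/\ (0 < n)%N, Num.floor (n%:R `^ c : R) = m%:Z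
    & n%:R <= (m%:R + 1) `^ c^-1 :> R].
Proof.
move=> c1 m0 d0 d2 gap /(cos_gt_int d0 d2)[n].
have c0 : 0 < c by apply: lt_trans c1.
have mR : 0 < m%:R :> R by rewrite ltr0n.
rewrite ltr_norml => /andP[nlo nhi].
have lo : m%:R `^ c^-1 < n%:~R :> R by move: nhi; lra.
have hi : n%:~R < (m%:R + 1) `^ c^-1 :> R by move: nlo gap; lra.
have n0 : 0 < n%:~R :> R by apply: le_lt_trans lo; apply: powR_ge0.
case: n n0 lo hi {nlo nhi} => [n|n]; last by rewrite ltr0z.
rewrite -pmulrn ltr0n => n0 lo hi; exists n; split=> //; last exact: ltW.
have inv (z : R) : 0 <= z -> (z `^ c^-1) `^ c = z.
  by move=> z0; rewrite -powRrM mulVf ?gt_eqF // powRr1.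
apply: floor_def; rewrite -pmulrn; apply/andP; split.
  rewrite -[leLHS]inv //; apply: ge0_ler_powR; rewrite ?nnegrE ?powR_ge0 ?(ltW c0) //.
  exact: ltW.
rewrite intrD -pmulrn -[ltRHS]inv ?addr_ge0 //.
by apply: gt0_ltr_powR; rewrite ?nnegrE ?powR_ge0.
Qed.

(** The left side of [1 - cos (2 * pi * d) = 2 * sin (pi * d) ^+ 2] is what [trig_minorant] weighs
    against [L]; near 0 the sine is at least half its argument. *)
Lemma one_sub_cos_ge : exists2 d0 : R, 0 < d0 &
  forall d, 0 <= d -> d < d0 -> 2 * d ^+ 2 <= 1 - cos (2 * pi * d).
Proof.
have [e e0 He] := sin_ge_half_near0; have pi0 : 0 < pi :> R := pi_gt0 R.
exists (e / pi); first by rewrite divr_gt0.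
move=> d d0; rewrite ltr_pdivlMr // => de.
have -> : 2 * pi * d = d * pi + d * pi by ring.
have h := He (d * pi) (mulr_ge0 d0 (ltW pi0)) de.
have p2 := pi_ge2 R.
have h1 : d <= sin (d * pi).
  by apply: le_trans h; rewrite ler_pdivlMr // ler_wpM2l.
rewrite cosD -!expr2; have := cos2Dsin2 (d * pi).
have : d ^+ 2 <= sin (d * pi) ^+ 2 by rewrite lerXn2r ?nnegrE // (le_trans d0).
lra.
Qed.

End GapAndPhase.

(** * Choice of the exponents and sizes at a given scale *)

Section SparseExceptions.
Variable R : realType.

(** At [e = xi = 0] the identity [s + 2 * s * tau = tau] gives [h = w = tau], and the second-moment
    conditions become [2 * tau * (1 + kappa) + lambda <= 1], [3 * tau <= 1] and [0 <= 0]. The first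
    two are strict; the last gains from [e > 0], because [h] grows only by about [2 * s * e] while
    [w] grows by [e]. Then [xi = e / 20] is small enough. *)
Lemma exponent_choice (kappa lambda s tau eta : R) :
  0 <= kappa -> kappa <= 1 / 2 -> 1 / 2 <= lambda -> 0 < s -> s <= 1 / 5 ->
  0 <= tau -> s + 2 * s * tau = tau ->
  2 * tau * (1 + kappa) + lambda < 1 -> 0 < eta ->
  exists e xi : R, let w := tau + e in let h := s * (1 + 2 * w + xi) + xi in
  [/\ 0 < e, 0 < xi, (1 - s) * (1 + 2 * w + xi) <= 1 + tau + eta,
      xi + 2 * h + kappa * (xi + h + 2 * (1 - s) * w - s) + lambda <= 1 - 2 * xi &
      xi + 2 * h + (xi + 2 * s * w) + s <= 1 - 2 * xi /\
      xi + (h - (w - 2 * xi)) <= - 2 * xi].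
Proof.
move=> k0 k1 l1 s0 s1 t0 st key eta0.
pose D := 1 - lambda - 2 * tau * (1 + kappa).
have D0 : 0 < D by rewrite /D; move: key; lra.
have t4 : tau <= 1 / 4 by have := mulr_ge0 t0 k0; move: key; lra.
pose e := Num.min (Num.min (D / 4) (1 / 8)) (eta / 4).
have e0 : 0 < e by rewrite !lt_min !divr_gt0.
have e1 : e <= D / 4 by rewrite /e; do 2 (rewrite ge_min; apply/orP; left).
have e2 : e <= 1 / 8 by rewrite /e ge_min ge_min lexx orbT.
have e3 : e <= eta / 4 by rewrite /e ge_min lexx orbT.
have se : s * e <= e / 5 by rewrite mulrC ler_pM2l // -div1r.
have se0 : 0 <= s * e by rewrite mulr_ge0 // ltW.
exists e, (e / 20) => /=.
have ke : kappa * e <= e / 2 by rewrite mulrC ler_pM2l // -div1r.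
have ke0 : 0 <= kappa * e by rewrite mulr_ge0 // ltW.
have kse : kappa * (s * e) <= s * e by rewrite ler_piMl //; move: k1; lra.
have -> : s * (1 + 2 * (tau + e) + e / 20) = tau + (s * e) * (41 / 20).
  by rewrite -[tau in RHS]st; field.
have -> : (1 - s) * (1 + 2 * (tau + e) + e / 20) = 1 + tau + e * (41 / 20) - (s * e) * (41 / 20).
  have -> : 1 + tau = 1 + 2 * tau - (s + 2 * s * tau) by rewrite st; ring.
  by field.
have -> : kappa * (e / 20 + (tau + s * e * (41 / 20) + e / 20) + 2 * (1 - s) * (tau + e) - s) =
   2 * tau * kappa + kappa * e * (42 / 20) + kappa * (s * e) / 20.
  transitivity (2 * tau * kappa + kappa * e * (42 / 20) + kappa * (s * e) / 20
    - kappa * (s + 2 * s * tau - tau)); first by field.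
  by rewrite st subrr mulr0 subr0.
have -> : 2 * s * (tau + e) = (s + 2 * s * tau) - s + 2 * (s * e) by ring.
rewrite st.
split.
- by [].
- by rewrite divr_gt0.
- by move: (s * e) se se0 e3 => z *; lra.
- move: e1; rewrite /D; move: (s * e) (kappa * e) (kappa * (s * e)) se se0 ke ke0 kse => z y x *; lra.
by move: (s * e) se se0 e2 t4 => z *; split; lra.
Qed.

Section FixedScale.
Variables (Y : nat) (s w xi : R).
Hypotheses (Y0 : (0 < Y)%N) (s0 : 0 < s) (s2 : s <= 1 / 2) (w0 : 0 <= w) (xi0 : 0 < xi).
Local Notation M := (block_ratio).
Local Notation E x := (Y%:R `^ x : R).

Let Y1 : 1 <= Y%:R :> R. Proof. by rewrite ler1n. Qed.
Let YR0 : 0 < Y%:R :> R. Proof. exact: lt_le_trans Y1. Qed.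
Let EM a b : E a * E b = E (a + b).
Proof. by rewrite -powRD // (gt_eqF YR0) implybT. Qed.
Let Emono a b : a <= b -> E a <= E b. Proof. exact: ler_powR. Qed.
Let E0 : E 0 = 1. Proof. exact: powRr0. Qed.
Let E1 : E 1 = Y%:R. Proof. by rewrite powRr1 // ltW. Qed.
Let Egt0 a : 0 < E a. Proof. exact: powR_gt0. Qed.
Let Ege1 a : 0 <= a -> 1 <= E a. Proof. by move=> a0; rewrite -[leLHS]E0 Emono. Qed.
Let M1 : 1 <= M%:R :> R. Proof. by rewrite ler1n block_ratio_gt0. Qed.
Let M0 : 0 < M%:R :> R. Proof. exact: lt_le_trans M1. Qed.

(** [X] bounds [q * k ^ 2] on the block, so by [powR_succ_gap] consecutive powers there differ by at
    least [2 * d]. [L] exceeds [2 / d] so that [trig_minorant] applies. In the lemmas of this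
    section constants and logarithms are absorbed by powers [Y ^ xi]. *)
Let K := Num.truncn (E w).
Let X := (2 * Y * (M * K) ^ 2)%N.
Let d : R := (2 * X)%:R `^ (- s) / 4.
Let L := (Num.truncn (2 / d)).+1.
Let h := s * (1 + 2 * w + xi) + xi.

Lemma scale_K_gt0 : (0 < K)%N. Proof. by rewrite truncn_gt0 Ege1. Qed.

Lemma scale_K_le : K%:R <= E w. Proof. by rewrite truncn_le // ltW. Qed.

Lemma scale_card_ge : 2 <= E xi -> ln (M * K)%:R <= E xi -> E (w - 2 * xi) <= #|prime_block K|%:R.
Proof.
move=> c2 cl; have Kge : E (w - xi) <= K%:R.
  apply: le_trans (truncn_ge_half (Ege1 w0)); rewrite ler_pdivlMr //.
  apply: le_trans (_ : E (w - xi) * E xi <= _); first by rewrite ler_pM2l.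
  by rewrite EM subrK.
rewrite -(ler_pM2r (Egt0 xi)) EM (_ : w - 2 * xi + xi = w - xi); last by ring.
apply: le_trans Kge _; apply: le_trans (card_prime_block R scale_K_gt0) _.
by rewrite ler_wpM2l.
Qed.

Lemma scale_X_gt0 : (0 < X)%N.
Proof. by rewrite /X !(muln_gt0, expn_gt0) Y0 block_ratio_gt0 scale_K_gt0. Qed.

Let X1 : 1 <= (2 * X)%:R :> R.
Proof. by rewrite ler1n muln_gt0 scale_X_gt0. Qed.

Lemma scale_X_le : 4 * M%:R ^+ 2 <= E xi -> (2 * X)%:R <= E (1 + 2 * w + xi).
Proof.
move=> cM; have -> : (2 * X)%:R = 4 * M%:R ^+ 2 * (Y%:R * K%:R ^+ 2) :> R.
  rewrite /X !natrM; ring.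
have -> : E (1 + 2 * w + xi) = E xi * (E 1 * E w ^+ 2).
  by rewrite expr2 !EM; congr (_ `^ _); ring.
apply: ler_pM => //; rewrite ?mulr_ge0 ?exprn_ge0 // E1 ler_wpM2l //.
by rewrite lerXn2r ?nnegrE ?scale_K_le // ltW.
Qed.

Let Xs0 : 0 < (2 * X)%:R `^ s :> R.
Proof. by rewrite powR_gt0 // (lt_le_trans ltr01). Qed.

Lemma scale_dE : d = (4 * (2 * X)%:R `^ s)^-1.
Proof. by rewrite /d powRN invfM mulrC. Qed.

Lemma scale_d_gt0 : 0 < d. Proof. by rewrite scale_dE invr_gt0 mulr_gt0. Qed.

Lemma scale_d_le : d <= E (- s) / 4.
Proof.
rewrite ler_pM2r ?invr_gt0 // !powRN lef_pV2 ?posrE //.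
apply: ge0_ler_powR; rewrite ?nnegrE ?(ltW s0) // ler_nat /X.
have : (0 < (M * K) ^ 2)%N by rewrite expn_gt0 muln_gt0 block_ratio_gt0 scale_K_gt0.
move: ((M * K) ^ 2)%N => z z0; rewrite (_ : 2 * (2 * Y * z) = Y * (4 * z))%N; last by ring.
by rewrite leq_pmulr // muln_gt0.
Qed.

Lemma scale_H_le : 18 <= E xi -> 4 * M%:R ^+ 2 <= E xi -> L.*2%:R <= E h.
Proof.
move=> c18 cM.
have Ht : (2 * X)%:R `^ s <= E (s * (1 + 2 * w + xi)).
  rewrite mulrC powRrM; apply: ge0_ler_powR; rewrite ?nnegrE ?(ltW s0) ?powR_ge0 //.
  exact: scale_X_le.
have Xs1 : 1 <= (2 * X)%:R `^ s :> R.
  by rewrite -[leLHS](powRr0 (2 * X)%:R) ler_powR // ltW.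
have d2 : 2 / d = 8 * (2 * X)%:R `^ s by rewrite scale_dE invrK; ring.
have : (Num.truncn (2 / d))%:R <= 2 / d by rewrite truncn_le // d2 mulr_ge0 // ltW.
rewrite d2 => h1.
apply: le_trans (_ : 18 * (2 * X)%:R `^ s <= _).
  rewrite -mul2n natrM /L -[(Num.truncn _).+1%:R]natr1 d2.
  by move: h1 Xs1; move: ((2 * X)%:R `^ s) => v; move: (Num.truncn _) => n h1 v1; lra.
by rewrite /h addrC -EM; apply: ler_pM => //; exact: ltW.
Qed.

Lemma scale_max_freq_le : 18 <= E xi -> 4 * M%:R ^+ 2 <= E xi ->
  max_freq s K L.*2 <= E (xi + h + 2 * (1 - s) * w).
Proof.
move=> c18 cM; rewrite /max_freq.
have al0 : 0 <= 2 * (1 - s) by move: s2; lra.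
have al2 : 2 * (1 - s) <= 2 by move: s0; lra.
rewrite powRM //.
have Ma : M%:R `^ (2 * (1 - s)) <= M%:R ^+ 2 :> R.
  by rewrite -powR_mulrn ?(ltW M0) // ler_powR.
have Ka : K%:R `^ (2 * (1 - s)) <= E (2 * (1 - s) * w).
  rewrite [_ * w]mulrC [leRHS]powRrM; apply: ge0_ler_powR; rewrite ?nnegrE ?powR_ge0 //.
  exact: scale_K_le.
have -> : 2 * (L.*2%:R * (M%:R `^ (2 * (1 - s)) * K%:R `^ (2 * (1 - s)))) =
  (2 * M%:R `^ (2 * (1 - s))) * L.*2%:R * K%:R `^ (2 * (1 - s)) by ring.
rewrite -[leRHS]EM -[E (xi + h)]EM; apply: ler_pM; rewrite ?mulr_ge0 ?powR_ge0 //.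
apply: ler_pM; rewrite ?mulr_ge0 ?powR_ge0 ?scale_H_le //.
apply: le_trans cM; by move: Ma (sqr_ge0 (M%:R : R)); move: (_ `^ _) (_ ^+ 2) => *; lra.
Qed.

Lemma scale_near_gap_le : 2 * M%:R ^+ 3 <= E xi ->
  (near_gap K (2 * (1 - s)))^-1 <= E (xi + 2 * s * w).
Proof.
move=> cM; rewrite /near_gap /spacing.
have KR0 : 0 < K%:R :> R by rewrite ltr0n scale_K_gt0.
have -> : (K%:R `^ (2 * (1 - s)) * (2 * M ^ 3 * K ^ 2)%:R^-1)^-1 =
    2 * M%:R ^+ 3 * K%:R `^ (2 * s) :> R.
  rewrite invfM invrK.
  have -> : 2 * (1 - s) = 2 - 2 * s by ring.
  rewrite powRB ?(gt_eqF KR0) ?implybT // invfM invrK.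
  have -> : K%:R `^ 2 = K%:R ^+ 2 :> R := powR_mulrn 2 (ltW KR0).
  rewrite !natrM ?natrX.
  by field; rewrite gt_eqF.
rewrite -EM; apply: ler_pM; rewrite ?mulr_ge0 ?exprn_ge0 ?powR_ge0 //.
rewrite [2 * s * w]mulrC [leRHS]powRrM; apply: ge0_ler_powR; rewrite ?nnegrE ?mulr_ge0 ?(ltW s0) ?powR_ge0 //.
exact: scale_K_le.
Qed.

End FixedScale.

End SparseExceptions.

(** * Sparsity of the exceptional integers *)

Section SparseExceptionsNear.
Variable R : realType.

Definition represented (c B : R) (q : nat) : Prop :=
  exists n k : nat, [/\ prime k, (0 < n)%N, n%:R <= B &
    Num.floor (n%:R `^ c) = (q * k ^ 2)%N%:Z].

(** [N] counts exceptions, [P] primes and [H] harmonics; [G] is the phase bound with terms [b1] and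
    [b2], [u] bounds [H / P], and [xi1] stands for [Y ^ xi]. The two terms of [G] and the near pairs
    contribute at most [a1] each. *)
Lemma final_count_inequality (N P H G C y a1 b1 b2 u xi1 : R) :
  0 < P -> 0 <= H -> 0 <= y -> 0 <= C -> 0 <= xi1 ->
  N * P ^+ 2 <= 144 * ((H * P) ^+ 2 * (2 * G) + y * (H * P + H ^+ 2)) ->
  H <= u * P -> 0 <= u -> u <= 1 -> G <= C * (b1 + b2) ->
  288 * C <= xi1 -> 288 <= xi1 -> 0 <= b1 -> 0 <= b2 ->
  xi1 * (H ^+ 2 * b1) <= a1 -> xi1 * (H ^+ 2 * b2) <= a1 -> xi1 * (y * u) <= a1 ->
  N <= 3 * a1.
Proof.
move=> P0 H0 y0 C0 x0 main Hu u0 u1 GC c1 c2 b10 b20 A1 A2 A3.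
have P2 : 0 < P ^+ 2 by rewrite exprn_gt0.
rewrite -(ler_pM2r P2); apply: le_trans main _.
have H2 : 0 <= H ^+ 2 by rewrite exprn_ge0.
have t1 : (H * P) ^+ 2 * (2 * G) * 144 <= 2 * a1 * P ^+ 2.
  have -> : (H * P) ^+ 2 * (2 * G) * 144 = 288 * (H ^+ 2 * G) * P ^+ 2 by ring.
  rewrite ler_pM2r //.
  apply: le_trans (_ : 288 * (H ^+ 2 * (C * (b1 + b2))) <= _).
    by rewrite ler_pM2l ?ltr0n // ler_wpM2l.
  have -> : 288 * (H ^+ 2 * (C * (b1 + b2))) = 288 * C * (H ^+ 2 * b1) + 288 * C * (H ^+ 2 * b2) by ring.
  have -> : 2 * a1 = a1 + a1 by ring.
  by apply: lerD; [apply: le_trans A1|apply: le_trans A2]; rewrite ler_wpM2r // mulr_ge0.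
have t2 : y * (H * P + H ^+ 2) * 144 <= a1 * P ^+ 2.
  have h1 : H * P <= u * P ^+ 2 by rewrite expr2 mulrA ler_pM2r.
  have h2 : H ^+ 2 <= u * P ^+ 2.
    apply: le_trans (_ : H * P <= _) => //; rewrite expr2 ler_wpM2l //.
    by apply: le_trans Hu _; rewrite ler_piMl // ltW.
  apply: le_trans (_ : 288 * (y * u) * P ^+ 2 <= _).
    have -> : 288 * (y * u) * P ^+ 2 = y * (u * P ^+ 2 + u * P ^+ 2) * 144 by ring.
    by rewrite ler_pM2r ?ltr0n // ler_wpM2l // lerD.
  by rewrite ler_pM2r //; apply: le_trans A3; rewrite ler_wpM2r // mulr_ge0.
have -> : 144 * ((H * P) ^+ 2 * (2 * G) + y * (H * P + H ^+ 2)) =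
  (H * P) ^+ 2 * (2 * G) * 144 + y * (H * P + H ^+ 2) * 144 by ring.
by apply: le_trans (lerD t1 t2) _; rewrite le_eqVlt; apply/orP; left; apply/eqP; ring.
Qed.

(* With [k] of size [q ^ tau] there are about as many [k] as the inverse of the length, of order
   [(q * k ^ 2) ^ (- s)], of the interval that the fractional part of [(q * k ^ 2) ^ c^-1] has to meet. *)
Lemma ps_parameters (kappa lambda c : R) : 0 <= kappa -> kappa <= 1 / 2 -> 1 / 2 <= lambda ->
  1 < c -> c < 1 + (1 - lambda) / (2 * kappa - lambda + 3) -> lambda <= 1 ->
  let s := 1 - c^-1 in let tau := (c - 1) / (2 - c) in
  [/\ 0 < s, s <= 1 / 5, 0 <= tau, s + 2 * s * tau = tau &
      2 * tau * (1 + kappa) + lambda < 1 /\ 1 / (2 - c) = 1 + tau].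
Proof.
move=> k0 k2 l2 c1 cl l1 s tau.
have den : 0 < 2 * kappa - lambda + 3 by lra.
have ct : (c - 1) * (2 * kappa - lambda + 3) < 1 - lambda.
  by rewrite -ltr_pdivlMr // ltrBlDl.
have c54 : c < 5 / 4.
  have : (c - 1) * 2 <= (c - 1) * (2 * kappa - lambda + 3).
    by rewrite ler_pM2l ?subr_gt0 //; lra.
  by move: ct; move: ((c - 1) * _) => z; lra.
have c0 : 0 < c by apply: lt_trans c1.
have c2 : 0 < 2 - c by lra.
split.
- by rewrite subr_gt0 invf_lt1.
- rewrite /s lerBlDr -lerBlDl (_ : 1 - 1 / 5 = (5 / 4)^-1); last by field.
  by rewrite lef_pV2 ?posrE ?divr_gt0 // ltW.
- by apply: divr_ge0; [rewrite subr_ge0|]; exact: ltW.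
- by rewrite /s /tau; field; rewrite !gt_eqF.
split; last by rewrite /tau; field; rewrite gt_eqF.
rewrite -(ltr_pM2r c2) mulrDl mul1r.
have -> : 2 * tau * (1 + kappa) * (2 - c) = 2 * (c - 1) * (1 + kappa).
  by rewrite /tau; field; rewrite gt_eqF.
move: ct; nra.
Qed.

(** The statement at a single [Y], with every largeness condition as a hypothesis; the limit
    argument only has to supply them. *)
Lemma exceptions_le_at (kappa lambda c s tau eta w xi C d0 : R) (Y : nat) :
  let M : R := block_ratio%:R in let h := s * (1 + 2 * w + xi) + xi in
  let E x : R := Y%:R `^ x in
  1 < c -> c^-1 = 1 - s -> 0 < s -> s <= 1 / 2 -> 0 <= kappa -> 0 < C -> 0 <= w -> 0 < xi ->
  (0 < Y)%N ->
  (forall y : R, 0 < y ->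
    let bound := C * ((y * E (- s)) `^ kappa * E lambda + y^-1 * E s) in
    `|\sum_(Y.+1 <= q < (2 * Y).+1) cos (2 * pi * (y * q%:R `^ (1 - s)))| <= bound /\
    `|\sum_(Y.+1 <= q < (2 * Y).+1) sin (2 * pi * (y * q%:R `^ (1 - s)))| <= bound) ->
  0 < d0 -> (forall d, 0 <= d -> d < d0 -> 2 * d ^+ 2 <= 1 - cos (2 * pi * d)) ->
  (1 - s) * (1 + 2 * w + xi) <= 1 + tau + eta ->
  xi + 2 * h + kappa * (xi + h + 2 * (1 - s) * w - s) + lambda <= 1 - 2 * xi ->
  xi + 2 * h + (xi + 2 * s * w) + s <= 1 - 2 * xi ->
  xi + (h - (w - 2 * xi)) <= - 2 * xi ->
  18 <= E xi -> 4 * M ^+ 2 <= E xi -> 2 * M ^+ 3 <= E xi -> 288 * C <= E xi -> 288 <= E xi ->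
  d0^-1 <= E s -> (w + 1) * ln Y%:R <= E xi -> M <= E 1 ->
  (count (fun q => `[< ~ represented c (E (1 + tau + eta)) q >])
       (index_iota Y.+1 (2 * Y).+1))%:R <= E (1 - xi).
Proof.
move=> M h E c1 gE s0 s2.
have g0 : 0 <= 1 - s by move: s2; lra.
have g2 : 1 / 2 <= 1 - s by move: s2; lra.
move=> k0 C0 w0 xi0 Y0 HC d00 Hd E1 E2 E3 E4 n1 n2 n3 n4 n5 n6 n7 n8.
have Y1 : 1 <= Y%:R :> R by rewrite ler1n.
have YR0 : 0 < Y%:R :> R by apply: lt_le_trans Y1.
have EM a b : E a * E b = E (a + b) by rewrite -powRD // (gt_eqF YR0) implybT.
have Emono a b : a <= b -> E a <= E b by apply: ler_powR.
have EX a b : E (a * b) = E a `^ b by rewrite /E powRrM.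
have Egt0 a : 0 < E a by apply: powR_gt0.
pose K := Num.truncn (E w).
pose X := (2 * Y * (block_ratio * K) ^ 2)%N.
pose d : R := (2 * X)%:R `^ (- s) / 4.
pose L := (Num.truncn (2 / d)).+1.
have Kpos : (0 < K)%N by apply: scale_K_gt0.
have KR0 : 0 < K%:R :> R by rewrite ltr0n.
have Kle : K%:R <= E w by apply: scale_K_le.
have Xpos : (0 < X)%N by apply: scale_X_gt0.
have Xle : (2 * X)%:R <= E (1 + 2 * w + xi) by apply: scale_X_le.
have dpos : 0 < d by apply: scale_d_gt0.
have dle : d <= E (- s) / 4 by apply: scale_d_le.
have Es1 : 1 <= E s by rewrite -[leLHS](powRr0 Y%:R) ler_powR // ltW.
have EsN : E (- s) <= 1 by rewrite /E powRN invf_le1.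
have d12 : d <= 1 / 2 by move: dle EsN; lra.
have dd0 : d < d0.
  have : E (- s) <= d0 by rewrite /E powRN -[d0]invrK lef_pV2 ?posrE // invr_gt0.
  by move: dle d00; lra.
have Lpos : (0 < L)%N by [].
have cc1 : cos (2 * pi * d) <= 1 by apply: cos_le1.
have ccL : 4 <= (1 - cos (2 * pi * d)) * L%:R ^+ 2.
  have dL : 2 <= d * L%:R by rewrite mulrC -ler_pdivrMr //; apply/ltW/truncnS_gt.
  apply: le_trans (_ : 2 * d ^+ 2 * L%:R ^+ 2 <= _); last first.
    by apply: ler_wpM2r; rewrite ?exprn_ge0 // Hd // ltW.
  by rewrite -mulrA -exprMn; move: dL; move: (d * _) => z; nra.
have [a [a0 ale aT]] := trig_minorant Lpos cc1 ccL.
(* The range is built into [bad] because [bad_density] asks for its inequality at every bad integer,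
   inside the block or not. *)
pose bad q := (Y < q <= 2 * Y)%N && `[< ~ represented c (E (1 + tau + eta)) q >].
have -> : count (fun q => `[< ~ represented c (E (1 + tau + eta)) q >])
    (index_iota Y.+1 (2 * Y).+1) = count bad (index_iota Y.+1 (2 * Y).+1).
  by apply: eq_in_count => q; rewrite mem_index_iota /bad ltnS => ->.
(* A positive value would force [cos (2 * pi * (m ^ (1 / c) + d)) > cos (2 * pi * d)] for
   [m = q * k ^ 2], and [floor_powR_of_cos] would then represent [q]. The shift [phi] is [d], which
   centres the window just below the integers. *)
have Hbad q (k : 'I_(block_ratio * K).+1) : bad q -> k \in prime_block K ->
    a 0%N + \sum_(1 <= j < L.*2) a j * cos (j%:R * theta s d k q) <= 0.
  move=> /andP[/andP[Yq q2] /asboolP nrep]; rewrite inE => /andP[kp Kk].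
  rewrite leNgt; apply/negP => /aT; rewrite /theta => Hcos; apply: nrep.
  have q0 : (0 < q)%N by apply: leq_trans Yq.
  have m0 : (0 < q * k ^ 2)%N by rewrite muln_gt0 q0 expn_gt0 prime_gt0.
  have mX : ((q * k ^ 2)%:R + 1 <= (2 * X)%:R :> R).
    rewrite natr1 ler_nat mul2n -addnn; apply: (leq_add (m1 := 1)) => //.
    by rewrite leq_mul // leq_exp2r // -ltnS ltn_ord.
  have m1 : 0 < (q * k ^ 2)%:R + 1 :> R by rewrite ltr_wpDl.
  have gap : 2 * d <= ((q * k ^ 2)%:R + 1) `^ c^-1 - (q * k ^ 2)%:R `^ c^-1.
    rewrite gE; apply: le_trans (powR_succ_gap g2 (ler0n _ _)).
    rewrite (_ : 1 - s - 1 = - s); last by ring.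
    have : (2 * X)%:R `^ (- s) <= ((q * k ^ 2)%:R + 1) `^ (- s) :> R.
      rewrite !powRN lef_pV2 ?posrE ?powR_gt0 ?(lt_le_trans m1) //.
      by apply: ge0_ler_powR; rewrite ?nnegrE ?(ltW s0) // ltW // (lt_le_trans m1).
    by rewrite /d; move: (_ `^ _) (_ `^ _) => u v; lra.
  rewrite -gE in Hcos.
  have [n [npos nfl nle]] := floor_powR_of_cos c1 m0 (ltW dpos) d12 gap Hcos.
  exists n, k; split=> //; apply: le_trans nle _; rewrite gE.
  apply: le_trans (_ : (2 * X)%:R `^ (1 - s) <= _).
    by apply: ge0_ler_powR; rewrite ?nnegrE // ltW // (lt_le_trans m1).
  apply: le_trans (_ : E (1 + 2 * w + xi) `^ (1 - s) <= _).
    by apply: ge0_ler_powR; rewrite ?nnegrE ?powR_ge0.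
  by rewrite /E -powRrM mulrC; apply: Emono.
have H0 : (0 < L.*2)%N by rewrite double_gt0.
have main := bad_density k0 C0 Kpos s0 s2 HC a0 ale H0 Hbad.
have lnMK : ln (block_ratio * K)%:R <= E xi.
  apply: le_trans n7; rewrite -ln_powR ler_ln ?posrE ?powR_gt0 ?ltr0n ?muln_gt0 ?block_ratio_gt0 //.
  by rewrite natrM addrC -/(E _) -EM; apply: ler_pM.
have n12 : 2 <= E xi by apply: le_trans n1; rewrite ler_nat.
have Pge : E (w - 2 * xi) <= #|prime_block K|%:R by apply: scale_card_ge.
have P0 : 0 < #|prime_block K|%:R :> R by apply: lt_le_trans Pge.
have Hle : L.*2%:R <= E h by apply: scale_H_le.
have mfle : max_freq s K L.*2 <= E (xi + h + 2 * (1 - s) * w) by apply: scale_max_freq_le.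
have ngle : (near_gap K (2 * (1 - s)))^-1 <= E (xi + 2 * s * w) by apply: scale_near_gap_le.
have mf0 : 0 <= max_freq s K L.*2 by rewrite !mulr_ge0 ?powR_ge0.
have ng0 : 0 <= (near_gap K (2 * (1 - s)) : R)^-1.
  by rewrite invr_ge0 mulr_ge0 ?powR_ge0 // invr_ge0.
apply: le_trans (_ : 3 * E (1 - 2 * xi) <= _); last first.
  apply: le_trans (_ : E xi * E (1 - 2 * xi) <= _).
    by rewrite ler_pM2r //; apply: le_trans n1; rewrite ler_nat.
  by rewrite EM; apply: Emono; lra.
have b1le : (max_freq s K L.*2 * E (- s)) `^ kappa * E lambda <=
    E (kappa * (xi + h + 2 * (1 - s) * w - s) + lambda).
  rewrite -EM ler_pM2r // [kappa * _]mulrC EX.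
  apply: ge0_ler_powR; rewrite ?nnegrE ?mulr_ge0 ?powR_ge0 //.
  by rewrite -EM ler_pM2r.
have b2le : (near_gap K (2 * (1 - s)))^-1 * E s <= E (xi + 2 * s * w + s).
  by rewrite -EM ler_pM2r.
have e1 : (L.*2 * #|prime_block K|)%:R = L.*2%:R * #|prime_block K|%:R :> R by rewrite natrM.
have e2 : (L.*2 * #|prime_block K| + L.*2 ^ 2)%:R =
    (L.*2 * #|prime_block K|)%:R + L.*2%:R ^+ 2 :> R by rewrite natrD natrX.
have H2le : L.*2%:R ^+ 2 <= E (2 * h).
  by rewrite mulr_natl mulr2n -EM -expr2 lerXn2r ?nnegrE // ltW.
apply: (@final_count_inequality _ #|prime_block K|%:R L.*2%:R (phase_bound kappa lambda s C Y K L.*2)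
   C Y%:R (E (1 - 2 * xi)) ((max_freq s K L.*2 * E (- s)) `^ kappa * E lambda)
   ((near_gap K (2 * (1 - s)))^-1 * E s) (E (h - (w - 2 * xi))) (E xi)) => //; try exact: ltW.
- by rewrite -e1 -e2.
- apply: le_trans Hle _; rewrite -[h in leLHS](subrK (w - 2 * xi)) -EM.
  by rewrite ler_pM2l.
- by rewrite -[leRHS](powRr0 Y%:R); apply: Emono; move: E4 xi0; lra.
- by rewrite mulr_ge0 ?powR_ge0.
- by rewrite mulr_ge0 ?powR_ge0.
- apply: le_trans (_ : E xi * (E (2 * h) * E (kappa * (xi + h + 2 * (1 - s) * w - s) + lambda)) <= _).
    by rewrite ler_pM2l //; apply: ler_pM; rewrite ?exprn_ge0 ?mulr_ge0 ?powR_ge0.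
  by rewrite !EM; apply: Emono; rewrite !addrA in E2 *.
- apply: le_trans (_ : E xi * (E (2 * h) * E (xi + 2 * s * w + s)) <= _).
    by rewrite ler_pM2l //; apply: ler_pM; rewrite ?exprn_ge0 ?mulr_ge0 ?powR_ge0.
  by rewrite !EM; apply: Emono; rewrite !addrA in E3 *.
rewrite -[Y%:R]powRr1 ?ler0n // -/(E 1) !EM; apply: Emono; move: E4; lra.
Qed.

Lemma sparse_exceptions (kappa lambda c eta : R) :
  exponent_pair kappa lambda -> 1 < c ->
  c < 1 + (1 - lambda) / (2 * kappa - lambda + 3) -> 0 < eta ->
  exists2 xi : R, 0 < xi & (\forall Y \near \oo,
    (count (fun q => `[< ~ represented c (Y%:R `^ (1 / (2 - c) + eta)) q >])
       (index_iota Y.+1 (2 * Y).+1))%:R <= Y%:R `^ (1 - xi) :> R)%classic.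
Proof.
move=> EP c1 cl eta0; have [k0 k2 l2 l1 _] := EP.
have [s0 s15 t0 st [key tauE]] := ps_parameters k0 k2 l2 c1 cl l1.
set s := 1 - c^-1 in s0 s15 st; set tau := (c - 1) / (2 - c) in t0 st key tauE.
have c0 : 0 < c by apply: lt_trans c1.
have gE : c^-1 = 1 - s by rewrite /s; ring.
have s2 : s <= 1 / 2 by move: s15; lra.
have s01 : 0 < s < 1 by rewrite s0; move: s2; lra.
have [C C0 HC] := exponent_pair_power_sum EP s01.
have [d0 d00 Hd0] := one_sub_cos_ge R.
have [e [xi]] := exponent_choice k0 k2 l2 s0 s15 t0 st key eta0.
set w := tau + e; set h := s * (1 + 2 * w + xi) + xi => -[e0 xi0 E1 E2 [E3 E4]].
have w0 : 0 <= w by rewrite addr_ge0 // ltW.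
exists xi => //.
pose M : R := block_ratio%:R.
near=> Y.
have Y0 : (0 < Y)%N by near: Y; exists 1%N.
have n1 : 18 <= Y%:R `^ xi :> R by near: Y; apply: powR_ge_near.
have n2 : 4 * M ^+ 2 <= Y%:R `^ xi by near: Y; apply: powR_ge_near.
have n3 : 2 * M ^+ 3 <= Y%:R `^ xi by near: Y; apply: powR_ge_near.
have n4 : 288 * C <= Y%:R `^ xi by near: Y; apply: powR_ge_near.
have n5 : 288 <= Y%:R `^ xi :> R by near: Y; apply: powR_ge_near.
have n6 : d0^-1 <= Y%:R `^ s by near: Y; apply: powR_ge_near.
have n7 : (w + 1) * ln Y%:R <= Y%:R `^ xi by near: Y; apply: ln_le_powR_near.
have n8 : M <= Y%:R `^ 1 by near: Y; apply: powR_ge_near.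
rewrite tauE; apply: (exceptions_le_at c1 gE s0 s2 k0 C0 w0 xi0 Y0 _ d00 Hd0 E1 E2 E3 E4) => //.
by move=> y y0; apply: HC.
Unshelve. all: by end_near. Qed.

End SparseExceptionsNear.

(** * Vinogradov's trick *)

Section Nonresidues.
Variable p : nat.
Hypotheses (p_pr : prime p) (p_odd : odd p).
Local Notation F := 'F_p.
Let Fp : p \in [pchar F] := pchar_Fp p_pr.
Let cardF : #|F| = p := card_Fp p_pr.

Definition nonres (n : nat) : bool := qchi (n%:R : F) == -1.

Lemma qchi_natP n : (0 < n < p)%N -> qchi (n%:R : F) = 1 - (nonres n)%:Z * 2.
Proof.
move=> np; have h : n%:R != 0 :> F := natF_neq0 Fp np.
by rewrite /nonres (qchiE cardF h); case: ifP.
Qed.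

Lemma qchi_natM m n : qchi ((m * n)%:R : F) = qchi (m%:R : F) * qchi (n%:R : F).
Proof. by rewrite natrM (qchiM Fp cardF p_odd). Qed.

Lemma nonres_prime_factor n : (0 < n < p)%N -> nonres n ->
  exists2 q, prime q & (q %| n)%N && nonres q.
Proof.
elim/ltn_ind: n => n IH /andP[n0 np] nn.
have [n1|n1] := leqP n 1.
  have n1' : n = 1%N by lia.
  by move: nn; rewrite n1' /nonres (qchiE cardF (oner_neq0 F)) expr1n eqxx.
have qp := pdiv_prime n1; have qn := pdiv_dvd n.
have [nq|rq] := boolP (nonres (pdiv n)); first by exists (pdiv n); rewrite ?qn.
have q0 := prime_gt0 qp; have qlt : (pdiv n < p)%N by apply: leq_ltn_trans (pdiv_leq n0) np.
have En : n = (pdiv n * (n %/ pdiv n))%N by rewrite mulnC divnK.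
have m0 : (0 < n %/ pdiv n)%N by rewrite divn_gt0 // pdiv_leq.
have mn : (n %/ pdiv n < n)%N by rewrite ltn_Pdiv // prime_gt1.
have nm : nonres (n %/ pdiv n).
  move: nn; rewrite {1}En /nonres qchi_natM.
  by rewrite (qchi_natP (n := pdiv n)) ?q0 // (negPf rq) mul0r subr0 mul1r.
have mp : (0 < n %/ pdiv n < p)%N by rewrite m0 (ltn_trans mn).
have [q qpr /andP[qm nqq]] := IH _ mn mp nm.
by exists q => //; rewrite nqq andbT (dvdn_trans qm) // dvdn_div.
Qed.

Variable R : realType.

Lemma nonres_count_le (x : nat) : (x < p)%N ->
  (\sum_(n < x) nonres n.+1)%:R <=
    x%:R * \sum_(0 <= q < x.+1 | prime q && nonres q) q%:R^-1 :> R.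
Proof.
move=> xp; apply: le_trans (_ : (\sum_(0 <= q < x.+1 | prime q && nonres q) x %/ q)%:R <= _).
  rewrite ler_nat.
  apply: leq_trans (_ : \sum_(n < x) \sum_(0 <= q < x.+1 | prime q && nonres q) (q %| n.+1) <= _)%N.
    apply: leq_sum => n _; case nn : (nonres n.+1) => //.
    have nx : (0 < n.+1 < p)%N by rewrite /= (leq_ltn_trans _ xp).
    have [q qp /andP[qn nq]] := nonres_prime_factor nx nn.
    have qx : (q < x.+1)%N by rewrite ltnS (leq_trans (dvdn_leq _ qn)).
    rewrite big_mkord (bigD1 (Ordinal qx)) /= ?qp ?nq // qn; exact: leq_addr.
  rewrite exchange_big /=; apply: leq_sum => q /andP[qp _].
  by rewrite divn_count_dvd big_add1 /= big_mkord.
rewrite natr_sum mulr_sumr; apply: ler_sum => q /andP[qp _].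
rewrite ler_pdivlMr ?ltr0n ?prime_gt0 // -natrM ler_nat leq_divM //.
Qed.

Lemma nonres_countE (x : nat) : (x < p)%N ->
  (\sum_(n < x) qchi (n.+1%:R : F))%:~R = x%:R - 2 * (\sum_(n < x) nonres n.+1)%:R :> R.
Proof.
move=> xp; rewrite (eq_bigr (fun n : 'I_x => 1 - (nonres n.+1)%:Z * 2)) => [|n _]; last first.
  by rewrite qchi_natP //= (leq_ltn_trans _ xp).
rewrite sumrB sumr_const card_ord -mulr_suml.
rewrite rmorphB rmorphM /= -(big_morph Posz PoszD (erefl _)) -!pmulrn mulrC; congr (_ - _).
by rewrite natz.
Qed.

(* If [q0] is a nonresidue then [m |-> q0 * m] turns the residues of [(Y, 2Y]] into
   nonresidues of [(q0 * Y, 2 * q0 * Y]]. *)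
Lemma nonres_multiples (q0 Y : nat) : nonres q0 -> (0 < q0)%N -> (2 * Y < p)%N ->
  (Y <= count nonres (index_iota Y.+1 (2 * Y).+1) +
        count nonres (index_iota (q0 * Y).+1 (2 * (q0 * Y)).+1))%N.
Proof.
move=> nq q00 Yp; pose r := index_iota Y.+1 (2 * Y).+1.
have sr : size r = Y by rewrite size_iota subSS mul2n -addnn addnK.
rewrite -{1}sr -(count_predC nonres r) leq_add2l -size_filter -(size_map (muln q0)) -size_filter.
apply: uniq_leq_size.
  rewrite map_inj_uniq ?filter_uniq ?iota_uniq // => i j /eqP.
  by rewrite eqn_pmul2l // => /eqP.
move=> y /mapP[m]; rewrite mem_filter /r mem_index_iota /= => /andP[rm /andP[Ym mY]] ->.
have mp : (0 < m < p)%N by rewrite (leq_ltn_trans _ Ym) //= (leq_ltn_trans _ Yp) // -ltnS.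
rewrite mem_filter mem_index_iota ltn_pmul2l // Ym /= ltnS mulnCA leq_pmul2l // -ltnS mY andbT.
by rewrite /nonres qchi_natM (qchi_natP mp) (negPf rm) mul0r subr0 mulr1.
Qed.

End Nonresidues.

Section Dyadic.
Variable R : realType.

Lemma dyadic_sum_le (T J : nat) (P : pred nat) (f : nat -> R) (B : R) :
  (forall j, (j < J)%N -> \sum_((2 ^ j * T).+1 <= q < (2 * (2 ^ j * T)).+1 | P q) f q <= B) ->
  \sum_(T.+1 <= q < (2 ^ J * T).+1 | P q) f q <= J%:R * B.
Proof.
elim: J => [|J IH] H; first by rewrite expn0 mul1n big_geq // mul0r.
have TJ : (T <= 2 ^ J * T)%N by rewrite leq_pmull // expn_gt0.
rewrite (@big_cat_nat _ _ _ (2 ^ J * T).+1) //=; last by rewrite ltnS expnS -mulnA leq_pmull.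
rewrite -natr1 mulrDl mul1r; apply: lerD; first by apply: IH => j jJ; apply: H; apply: leqW.
by rewrite expnS -mulnA; apply: H.
Qed.

Lemma sum_inv_block_le (Y : nat) (P P' : pred nat) : (0 < Y)%N -> (forall q, P q -> P' q) ->
  \sum_(Y.+1 <= q < (2 * Y).+1 | P q) q%:R^-1 <=
    (count P' (index_iota Y.+1 (2 * Y).+1))%:R / Y%:R :> R.
Proof.
move=> Y0 PP'; rewrite -sum1_count natr_sum mulr_suml big_mkcond [leRHS]big_mkcond /=.
rewrite big_seq [leRHS]big_seq; apply: ler_sum => q; rewrite mem_index_iota => /andP[Yq _].
have inv0 : 0 <= Y%:R^-1 :> R by rewrite invr_ge0.
case Pq : (P q); last by case: ifP; rewrite ?mul1r.
rewrite PP' // mul1r lef_pV2 ?posrE ?ltr0n ?ler_nat //; first exact: ltnW.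
exact: leq_ltn_trans Yq.
Qed.

End Dyadic.

Section Vinogradov.
Variable R : realType.

Lemma ln_ge_near (C : R) : (\forall n \near \oo, C <= ln n%:R :> R)%classic.
Proof.
near=> n; have n1 : expR C <= n%:R `^ 1 by near: n; apply: powR_ge_near.
have n0 : 0 < n%:R :> R by apply: lt_le_trans (expR_gt0 C) _; rewrite powRr1 in n1.
by rewrite -ler_expR lnK ?posrE //; rewrite powRr1 in n1.
Unshelve. all: by end_near. Qed.

Definition burgess_exponent : R := 1 / (4 * Num.sqrt (expR 1)).

(** It yields [burgess_exponent < 3 / 16], hence room below [1 / 4] for [Q] and below [1 / 2] for
    the final exponent. *)
Lemma sqrt_e_gt : 4 / 3 < Num.sqrt (expR 1) :> R.
Proof.
have e2 : 2 <= expR 1 :> R by have := expR_ge1Dx (1 : R).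
rewrite -(@ltr_pXn2r _ 2) ?nnegrE ?sqrtr_ge0 ?divr_ge0 // sqr_sqrtr ?expR_ge0 //.
by apply: lt_le_trans e2; rewrite expr2; lra.
Qed.

Lemma ln_sqrt_e : ln (Num.sqrt (expR 1)) = 1 / 2 :> R.
Proof.
by rewrite -powR12_sqrt ?expR_ge0 // ln_powR expRK mulr1 div1r.
Qed.

Lemma burgess_exponent_bounds : 0 < burgess_exponent /\ burgess_exponent < 3 / 16.
Proof.
have se := sqrt_e_gt; have s0 : 0 < Num.sqrt (expR 1) :> R by apply: lt_trans se; lra.
split; first by rewrite divr_gt0 // mulr_gt0.
rewrite /burgess_exponent ltr_pdivrMr ?mulr_gt0 //; move: se; lra.
Qed.

(** The quotient of the exponents is below [sqrt e], so the primes between the two powers of [p]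
    have reciprocal sum asymptotically below [1 / 2]. *)
Lemma vinogradov_gap (eps : R) : 0 < eps ->
  0 < 1 / 2 - ln ((1 / 4 + eps / 4) / (burgess_exponent + eps / 2)).
Proof.
move=> e0; have se := sqrt_e_gt; have [b0 _] := burgess_exponent_bounds.
have s0 : 0 < Num.sqrt (expR 1) :> R by apply: lt_trans se; lra.
have den : 0 < burgess_exponent + eps / 2 by rewrite addr_gt0 // divr_gt0.
have num : 0 < 1 / 4 + eps / 4 by rewrite addr_gt0 // divr_gt0.
rewrite subr_gt0 -ln_sqrt_e ltr_ln ?posrE ?divr_gt0 // ltr_pdivrMr // mulrDr.
have -> : Num.sqrt (expR 1) * burgess_exponent = 1 / 4.
  by rewrite /burgess_exponent; field; rewrite gt_eqF.
rewrite ltrD2l; have : 0 < (Num.sqrt (expR 1) - 4 / 3) * eps by rewrite mulr_gt0 // subr_gt0.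
lra.
Qed.

(** Up to [x] the prime nonresidues have reciprocal sum at least [1 / 2 - t / 4], and the primes in
    [(Q, x]] account for at most [1 / 2 - 3 * t / 4]; the difference is [t / 2]. *)
Lemma nonres_inverse_sum_near (eps : R) : 0 < eps -> eps <= 1 / 16 ->
  exists2 th : R, 0 < th & (\forall p \near \oo, prime p ->
    exists Q : nat, [/\ Q%:R <= p%:R `^ (burgess_exponent + eps) :> R, (Q < p)%N &
      th <= \sum_(0 <= q < Q.+1 | prime q && nonres p q) q%:R^-1])%classic.
Proof.
move=> e0 e16; have [b0 b3] := burgess_exponent_bounds.
have t0 := vinogradov_gap e0.
set al := 1 / 4 + eps / 4 in t0; set b := burgess_exponent + eps / 2 in t0.
set t := 1 / 2 - ln (al / b) in t0.
have bpos : 0 < b by rewrite addr_gt0 // divr_gt0.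
exists (t / 2); first by rewrite divr_gt0.
have e8 : 0 < eps / 8 by rewrite divr_gt0.
have e2 : 0 < eps / 2 by rewrite divr_gt0.
have t2 : 0 < t / 2 by rewrite divr_gt0.
have x1 : 1 / 4 + eps / 8 + eps / 8 = al by rewrite /al; field.
have x2 : al * 2 <= 1 by rewrite /al; lra.
have x3 : b + eps / 8 <= 1 / 4 + eps / 8 by rewrite /b; lra.
have x4 : b + eps / 2 = burgess_exponent + eps by rewrite /b; field.
near=> p => pp.
have B : prime p -> forall x : nat,
    p%:R `^ (1 / 4 + eps / 8) <= x%:R :> R -> x%:R ^+ 2 <= p%:R :> R ->
    (\sum_(n < x) qchi (n.+1%:R : 'F_p))%:~R <= t / 2 * x%:R :> R.
  by near: p; apply: burgess_sum_near.
have n1 : 2 <= p%:R `^ (eps / 8) :> R by near: p; apply: powR_ge_near.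
have n2 : 2 <= p%:R `^ (eps / 2) :> R by near: p; apply: powR_ge_near.
have n3 : 20 / (t * b) <= ln p%:R by near: p; apply: ln_ge_near.
have n4 : (3 <= p)%N by near: p; exists 3%N.
have {}B := B pp.
have podd : odd p by case: (even_prime pp) n4 => // ->.
have p1 : 1 <= p%:R :> R by rewrite ler1n prime_gt0.
have p0 : 0 < p%:R :> R by apply: lt_le_trans p1.
have pw a c : p%:R `^ a * p%:R `^ c = p%:R `^ (a + c) :> R.
  by rewrite -powRD // (gt_eqF p0) implybT.
have tr a : 0 <= a -> (Num.truncn (p%:R `^ a)).+1%:R <= 2 * p%:R `^ a :> R.
  move=> a0; have h : 1 <= p%:R `^ a by rewrite -[leLHS](powRr0 p%:R) ler_powR.
  rewrite -natr1 mulr_natl mulr2n lerD // truncn_le //; exact: le_trans h.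
pose x := (Num.truncn (p%:R `^ (1 / 4 + eps / 8) : R)).+1.
have xlo : p%:R `^ (1 / 4 + eps / 8) <= x%:R :> R by apply/ltW/truncnS_gt.
have xhi : x%:R <= p%:R `^ al :> R.
  apply: le_trans (tr _ _) _; first by rewrite addr_ge0 ?divr_ge0 // ltW.
  by rewrite -x1 -[leRHS]pw [leRHS]mulrC ler_pM2r // powR_gt0.
have xsq : x%:R ^+ 2 <= p%:R :> R.
  apply: le_trans (_ : p%:R `^ al ^+ 2 <= _); first by rewrite lerXn2r ?nnegrE ?powR_ge0.
  by rewrite -powR_mulrn ?powR_ge0 // -powRrM -[leRHS]powRr1 ?(ltW p0) // ler_powR.
have xp : (x < p)%N.
  rewrite ltnNge; apply/negP => px; move: xsq; rewrite leNgt => /negP; apply.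
  rewrite -natrX ltr_nat -mulnn; apply: (leq_ltn_trans px); rewrite ltn_Pmulr //.
  by apply: leq_trans px; apply: ltnW.
have lnp0 : 0 < ln p%:R :> R by rewrite ln_gt0 // ltr1n prime_gt1.
pose Q := (Num.truncn (p%:R `^ b : R)).+1.
have Qlo : p%:R `^ b <= Q%:R :> R by apply/ltW/truncnS_gt.
have Qhi : Q%:R <= 2 * p%:R `^ b :> R by apply: tr; apply: ltW.
have Qx : (Q <= x)%N.
  rewrite -(ler_nat R); apply: le_trans Qhi (le_trans _ xlo).
  apply: le_trans (_ : p%:R `^ (b + eps / 8) <= _); last by rewrite ler_powR.
  by rewrite -[leRHS]pw [leRHS]mulrC ler_pM2r // powR_gt0.
have Q1 : (1 < Q)%N.
  by rewrite ltnS truncn_gt0 -[leLHS](powRr0 p%:R) ler_powR // ltW.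
exists Q; split.
- by apply: le_trans Qhi _; rewrite -x4 -[leRHS]pw [leRHS]mulrC ler_pM2r // powR_gt0.
- exact: leq_ltn_trans xp.
have xR0 : 0 < x%:R :> R by rewrite ltr0n.
have lnQ : b * ln p%:R <= ln Q%:R.
  by rewrite -ln_powR ler_ln ?posrE ?powR_gt0 // ltr0n.
have lnx : ln x%:R <= al * ln p%:R.
  by rewrite -ln_powR ler_ln ?posrE ?powR_gt0.
have lnQ0 : 0 < ln Q%:R :> R by rewrite ln_gt0 // ltr1n.
have tail := sum_prime_inv_le R Q1 Qx.
(* The main term is [ln (al / b) = 1 / 2 - t]; the error [5 / ln Q] is at most [t / 4] by [n3]. *)
have tail2 : ln (ln x%:R / ln Q%:R) + 5 / ln Q%:R <= 1 / 2 - t + t / 4.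
  apply: lerD.
    have -> : 1 / 2 - t = ln (al / b) by rewrite /t; ring.
    have lnx0 : 0 < ln x%:R :> R by rewrite ln_gt0 // ltr1n (leq_trans Q1).
    rewrite ler_ln ?posrE ?divr_gt0 //; last by rewrite addr_gt0 // divr_gt0.
    rewrite ler_pdivrMr // mulrAC ler_pdivlMr //.
    apply: le_trans (_ : al * ln p%:R * b <= _); first by rewrite ler_pM2r.
    by rewrite -mulrA [ln _ * b]mulrC ler_pM2l // addr_gt0 // divr_gt0.
  rewrite ler_pdivrMr // -ler_pdivrMl ?divr_gt0 //; apply: le_trans lnQ.
  have -> : (t / 4)^-1 * 5 = b * (20 / (t * b)) by field; rewrite !gt_eqF.
  by rewrite ler_pM2l.
have {}tail := le_trans tail tail2.
have S := B x xlo xsq; rewrite (nonres_countE pp R xp) in S.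
have N := nonres_count_le pp podd R xp.
have {S}N : (1 - t / 2) / 2 <= \sum_(0 <= q < x.+1 | prime q && nonres p q) q%:R^-1.
  rewrite -(ler_pM2l xR0); apply: le_trans N.
  move: S; move: ((\sum_(n < x) _)%:R : R) (x%:R : R) (t : R) => u v w S; lra.
move: N; rewrite (@big_cat_nat _ _ _ Q.+1) //=.
set S1 := \sum_(0 <= _ < _ | _) _; set S2 := \sum_(_ <= _ < _ | _) _ => N.
have : S2 <= \sum_(Q.+1 <= q < x.+1 | prime q) q%:R^-1.
  rewrite /S2 big_mkcond [leRHS]big_mkcond; apply: ler_sum => q _.
  by case: (prime q) => //=; case: (nonres p q) => //=; rewrite invr_ge0.
move: N tail; move: (\sum_(_ <= _ < _ | _) _) S1 S2 (t) => u v w z N1 N2 N3; lra.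
Unshelve. all: by end_near. Qed.

End Vinogradov.

(** * Dyadic blocks rich in nonresidues *)

Section NonresidueBlocks.
Variable R : realType.

Definition dyadic_block (Y : nat) : seq nat := index_iota Y.+1 (2 * Y).+1.

(** If the block of [Y] is poor, that of [q0 * Y] has at least [Y - Y ^ (1 - xi)] nonresidues, which
    exceeds [(q0 * Y) ^ (1 - xi)] because [2 * q0 < Y ^ xi]. *)
Lemma nonres_block_of_small (p q0 Y : nat) (xi : R) : prime p -> odd p ->
  nonres p q0 -> (0 < q0)%N -> (2 * Y < p)%N -> (0 < Y)%N -> 0 < xi -> 2 * q0%:R < Y%:R `^ xi ->
  exists2 d, (d == 1) || (d == q0) &
    (d * Y)%:R `^ (1 - xi) < (count (nonres p) (dyadic_block (d * Y)))%:R :> R.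
Proof.
move=> pp podd nq q00 Yp Y0 xi0 h; have H := nonres_multiples pp podd nq q00 Yp.
have YR : 0 < Y%:R :> R by rewrite ltr0n.
have [small|big] := ltP (Y%:R `^ (1 - xi)) (count (nonres p) (dyadic_block Y))%:R.
  by exists 1%N; rewrite ?mul1n.
exists q0; first by rewrite eqxx orbT.
have {H} : Y%:R <= (count (nonres p) (dyadic_block Y))%:R +
                 (count (nonres p) (dyadic_block (q0 * Y)))%:R :> R by rewrite -natrD ler_nat.
have q1 : 1 <= q0%:R :> R by rewrite ler1n.
have q0R : 0 < q0%:R :> R by apply: lt_le_trans q1.
have EY : Y%:R `^ (1 - xi) * Y%:R `^ xi = Y%:R :> R.
  by rewrite -powRD ?(gt_eqF YR) ?implybT // subrK powRr1 // ltW.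
rewrite natrM powRM ?ler0n // -[in leLHS]EY.
have qx : q0%:R `^ (1 - xi) <= q0%:R :> R.
  by rewrite -[leRHS]powRr1 ?ler_powR ?(ltW q0R) // gerBl ltW.
have w0 : 0 < Y%:R `^ (1 - xi) by rewrite powR_gt0.
have w1 : q0%:R `^ (1 - xi) * Y%:R `^ (1 - xi) <= q0%:R * Y%:R `^ (1 - xi) by rewrite ler_pM2r.
have w2 : Y%:R `^ (1 - xi) * (2 * q0%:R) < Y%:R `^ (1 - xi) * Y%:R `^ xi by rewrite ltr_pM2l.
have w3 : Y%:R `^ (1 - xi) * 1 <= Y%:R `^ (1 - xi) * q0%:R by rewrite ler_pM2l.
move: big w1 w2 w3; move: (Y%:R `^ (1 - xi)) (Y%:R `^ xi) (q0%:R `^ (1 - xi) * _) => w v u.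
move=> h1 h2 h3 h4 h5; have {}h5 := lerD h5 h1; have {}h5 := lerD h5 h4.
move: h2 h3 h5; nra.
Qed.

(** A poor block starting at [Y >= T] contributes at most [Y ^ (1 - xi) / Y], hence at most
    [T ^ (- xi)]. *)
Lemma dyadic_inverse_sum (T Q J : nat) (P : pred nat) (xi : R) :
  (0 < T)%N -> (Q <= 2 ^ J * T)%N -> 0 < xi ->
  (forall j, (2 ^ j * T <= Q)%N ->
     (count P (dyadic_block (2 ^ j * T)))%:R <= (2 ^ j * T)%:R `^ (1 - xi)) ->
  \sum_(T.+1 <= q < Q.+1 | prime q && P q) q%:R^-1 <= J%:R * T%:R `^ (- xi).
Proof.
(* [P'] empties the blocks lying entirely beyond [Q], about which [H] says nothing. *)
move=> T0 QJ xi0 H; pose P' q := [&& (q <= Q)%N, prime q & P q].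
have TR : 0 < T%:R :> R by rewrite ltr0n.
apply: le_trans (_ : \sum_(T.+1 <= q < (2 ^ J * T).+1 | P' q) q%:R^-1 <= _).
  have [TQ|TQ] := leqP T Q; last first.
    by rewrite big_geq; [apply: sumr_ge0 => q _; rewrite invr_ge0 | apply: ltnW].
  rewrite [leRHS](@big_cat_nat _ _ _ Q.+1) //= -[leLHS]addr0 lerD ?sumr_ge0 //.
    rewrite le_eqVlt; apply/orP; left; apply/eqP.
    rewrite big_nat_cond [RHS]big_nat_cond; apply: eq_bigl => q.
    by rewrite /P' ltnS; case: (q <= Q)%N; rewrite ?andbF.
apply: dyadic_sum_le => j jJ; have [jQ|jQ] := leqP (2 ^ j * T) Q; last first.
  rewrite big_nat_cond big1 ?powR_ge0 // => q /andP[/andP[h _] /andP[qQ _]].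
  by have := leq_ltn_trans qQ jQ; rewrite ltnNge ltnW.
have Y0 : (0 < 2 ^ j * T)%N by rewrite muln_gt0 expn_gt0.
apply: le_trans (sum_inv_block_le R (P' := P) Y0 _) _; first by move=> q /and3P[].
have YR : 0 < (2 ^ j * T)%:R :> R by rewrite ltr0n.
rewrite ler_pdivrMr //; apply: le_trans (H _ jQ) _.
rewrite powRD ?(gt_eqF YR) ?implybT // powRr1 ?(ltW YR) // mulrC ler_pM2r //.
rewrite !powRN lef_pV2 ?posrE ?powR_gt0 // ge0_ler_powR ?nnegrE ?(ltW xi0) ?ler0n //.
by rewrite ler_nat leq_pmull // expn_gt0.
Qed.

(** If there is no nonresidue up to [p ^ e1], the reciprocal sum starts beyond that power and poor
    blocks alone cannot reach [th]. The lower bound on [Y] makes [Y] tend to infinity with [p], as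
    [sparse_exceptions] needs. *)
Lemma nonres_block_near (eps xi : R) : 0 < eps -> eps <= 1 / 16 -> 0 < xi -> xi <= 1 ->
  exists2 e, 0 < e & (\forall p \near \oo, prime p -> exists Y : nat,
    [/\ p%:R `^ e <= Y%:R :> R, Y%:R <= p%:R `^ (burgess_exponent R + eps) :> R
      & Y%:R `^ (1 - xi) < (count (nonres p) (dyadic_block Y))%:R :> R])%classic.
Proof.
move=> e0 e16 xi0 xi1; have [b0 _] := burgess_exponent_bounds R.
have [th th0 V] := nonres_inverse_sum_near e0 e16.
(* As [e2 * xi = 2 * e1], a nonresidue up to [p ^ e1] is below half of [Y0 ^ xi]. As
   [e * xi = 2 * d], the saving [T ^ (- xi) <= p ^ (- 2 * d)] outweighs the at most [p ^ d] blocks.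
   Halving [e1] to [e] absorbs the truncation in [T]. *)
pose e2 := eps / 4; pose e1 := e2 * xi / 2; pose e := e1 / 2; pose d := e * xi / 2.
have e20 : 0 < e2 by rewrite divr_gt0.
have e10 : 0 < e1 by rewrite divr_gt0 ?mulr_gt0.
have ep0 : 0 < e by rewrite divr_gt0.
have d0 : 0 < d by rewrite divr_gt0 ?mulr_gt0.
have e12 : e1 <= e2 by rewrite ler_pdivrMr //; apply: ler_pM; rewrite ?(ltW e20) ?(ltW xi0) //; lra.
have l0 : 0 < ln 2 :> R by rewrite ln_gt0 // ltr1n.
exists e => //; near=> p => pp.
have W : prime p -> exists Q : nat, [/\ Q%:R <= p%:R `^ (burgess_exponent R + eps) :> R, (Q < p)%N &
      th <= \sum_(0 <= q < Q.+1 | prime q && nonres p q) q%:R^-1] by near: p.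
have n1 : 8 <= p%:R `^ e :> R by near: p; apply: powR_ge_near.
have n2 : (1 + 1 / ln 2) * ln p%:R <= p%:R `^ d :> R by near: p; apply: ln_le_powR_near.
have n3 : 2 / th <= p%:R `^ d :> R by near: p; apply: powR_ge_near.
have n4 : (3 <= p)%N by near: p; exists 3%N.
have n5 : 1 <= ln p%:R :> R by near: p; apply: ln_ge_near.
have [Q [Qhi Qp Vs]] := W pp.
have podd : odd p by case: (even_prime pp) n4 => // ->.
have p1 : 1 <= p%:R :> R by rewrite ler1n prime_gt0.
have p0 : 0 < p%:R :> R by apply: lt_le_trans p1.
have pw a c : p%:R `^ a * p%:R `^ c = p%:R `^ (a + c) :> R.
  by rewrite -powRD // (gt_eqF p0) implybT.
have mono a c : a <= c -> p%:R `^ a <= p%:R `^ c :> R by apply: ler_powR.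
have n8 a : e <= a -> 8 <= p%:R `^ a :> R by move=> /mono; apply: le_trans.
have [[q0 [q00 nq q0e]]|none] := pselect (exists q0 : nat,
    [/\ (0 < q0)%N, nonres p q0 & q0%:R <= p%:R `^ e1 :> R]).
  pose Y0 := (Num.truncn (p%:R `^ e2 : R)).+1.
  have Ylo : p%:R `^ e2 <= Y0%:R :> R by apply/ltW/truncnS_gt.
  have e2_8 : 8 <= p%:R `^ e2 :> R by apply: n8; apply: le_trans e12; rewrite /e; lra.
  have Yhi : Y0%:R <= 2 * p%:R `^ e2 :> R.
    rewrite /Y0 -natr1 mulr_natl mulr2n lerD ?truncn_le ?powR_ge0 //.
    by apply: le_trans e2_8; rewrite ler1n.
  have Ysmall : 4 * p%:R `^ e2 < p%:R `^ (e2 + e2) :> R.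
    by rewrite -pw ltr_pM2r ?powR_gt0 //; apply: lt_le_trans e2_8; lra.
  have Yp : (2 * Y0 < p)%N.
    rewrite -(ltr_nat R) natrM; apply: le_lt_trans (_ : 2 * (2 * p%:R `^ e2) < _).
      by rewrite ler_pM2l.
    rewrite mulrA -natrM; apply: lt_le_trans Ysmall _.
    by rewrite -[leRHS]powRr1 ?(ltW p0) //; apply: mono; rewrite /e2; lra.
  have q0Y : 2 * q0%:R < Y0%:R `^ xi :> R.
    apply: lt_le_trans (_ : (p%:R `^ e2) `^ xi <= _); last first.
      by rewrite ge0_ler_powR ?nnegrE ?(ltW xi0) ?powR_ge0.
    rewrite -powRrM; have -> : e2 * xi = e1 + e1 by rewrite /e1; field.
    rewrite -pw; apply: le_lt_trans (_ : 2 * p%:R `^ e1 < _); first by rewrite ler_pM2l.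
    rewrite ltr_pM2r ?powR_gt0 //; have : 8 <= p%:R `^ e1 :> R by apply: n8; rewrite /e; lra.
    by apply: lt_le_trans; lra.
  have [D hD bigY] := nonres_block_of_small pp podd nq q00 Yp (ltn0Sn _) xi0 q0Y.
  have D1 : 1 <= D%:R :> R by case/orP: hD => /eqP ->; rewrite // ler1n.
  have D2 : D%:R <= p%:R `^ e1 :> R.
    case/orP: hD => /eqP -> //; rewrite -[leLHS](powRr0 p%:R); exact/mono/ltW.
  exists (D * Y0)%N; split => //; rewrite natrM.
  - apply: le_trans (_ : 1 * p%:R `^ e2 <= _); last by apply: ler_pM => //; apply: powR_ge0.
    by rewrite mul1r; apply: mono; rewrite /e; lra.
  - apply: le_trans (_ : p%:R `^ e1 * p%:R `^ (e2 + e2) <= _).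
      apply: ler_pM => //; apply: le_trans Yhi (le_trans _ (ltW Ysmall)).
      by rewrite ler_pM2r ?powR_gt0 // ler_nat.
    by rewrite pw; apply: mono; rewrite /e2 in e12 *; lra.
pose T := Num.truncn (p%:R `^ e1 : R).
have e1_8 : 8 <= p%:R `^ e1 :> R by apply: n8; rewrite /e; lra.
have Thi : T%:R <= p%:R `^ e1 :> R by rewrite truncn_le ?powR_ge0.
have Tlo : p%:R `^ e <= T%:R :> R.
  apply: le_trans (truncn_ge_half _); last by apply: le_trans e1_8; lra.
  rewrite ler_pdivlMr // /e.
  apply: le_trans (_ : p%:R `^ (e1 / 2) * p%:R `^ (e1 / 2) <= _).
    by rewrite ler_pM2l ?powR_gt0 //; apply: le_trans n1; rewrite ler_nat.
  by rewrite pw -splitr.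
have TR0 : 0 < T%:R :> R by apply: lt_le_trans Tlo; apply: powR_gt0.
have T0 : (0 < T)%N by rewrite -(ltr0n R).
apply: contrapT => noblock.
pose J := (trunc_log 2 p).+1.
have QJ : (Q <= 2 ^ J * T)%N.
  apply: leq_trans (ltnW Qp) _; apply: leq_trans (_ : 2 ^ J <= _)%N; last by rewrite leq_pmulr.
  exact/ltnW/trunc_log_ltn.
have blocks j : (2 ^ j * T <= Q)%N ->
    (count (nonres p) (dyadic_block (2 ^ j * T)))%:R <= (2 ^ j * T)%:R `^ (1 - xi) :> R.
  move=> jQ; rewrite leNgt; apply/negP => big; apply: noblock; exists (2 ^ j * T)%N; split => //.
  - apply: le_trans Tlo _; rewrite ler_nat leq_pmull // expn_gt0 //.
  - by apply: le_trans Qhi; rewrite ler_nat.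
have := dyadic_inverse_sum T0 QJ xi0 blocks.
have JR : J%:R <= p%:R `^ d :> R.
  apply: le_trans n2; rewrite /J -natr1 addrC mulrDl; apply: lerD; first by rewrite mul1r.
  rewrite mul1r mulrC ler_pdivlMr // mulr_natl -lnXn // ler_ln ?posrE ?exprn_gt0 //.
  by rewrite -natrX ler_nat trunc_logP // ltnW // ltnW.
apply/negP; rewrite -ltNge; apply: lt_le_trans (_ : th <= _).
  apply: le_lt_trans (_ : p%:R `^ d * p%:R `^ (- (d + d)) < _).
    apply: ler_pM => //.
    have -> : - (d + d) = e * - xi by rewrite /d; field.
    rewrite powRrM !powRN lef_pV2 ?posrE ?powR_gt0 ?powR_gt0 //.
    by rewrite ge0_ler_powR ?nnegrE ?powR_ge0 ?ler0n ?(ltW xi0).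
  rewrite pw opprD addNKr powRN invf_plt ?posrE ?powR_gt0 //.
  apply: lt_le_trans n3; rewrite ltr_pdivlMr // mulVf ?gt_eqF // ltr1n //.
apply: le_trans Vs _.
have [TQ|QT] := leqP T Q; last first.
  rewrite big_nat_cond big1; first by apply: sumr_ge0 => q _; rewrite invr_ge0.
  move=> q /andP[/andP[_ qQ] /andP[qp nq]]; case: none; exists q; split; rewrite ?prime_gt0 //.
  by apply: le_trans Thi; rewrite ler_nat; apply: leq_trans (ltnW QT).
rewrite (@big_cat_nat _ _ _ T.+1) //= -[leRHS]add0r lerD // big_nat_cond big1 //.
move=> q /andP[/andP[_ qT] /andP[qp nq]]; case: none; exists q; split; rewrite ?prime_gt0 //.
by apply: le_trans Thi; rewrite ler_nat.
Unshelve. all: by end_near. Qed.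

End NonresidueBlocks.

(** * The theorem *)

Lemma legendre_nonres (p a : nat) : prime p -> odd p -> nonres p a -> legendre a%:Z p = -1.
Proof.
move=> pp podd; have cardF := card_Fp pp; have Fp := pchar_Fp pp.
rewrite /nonres /legendre => na.
have a0 : a%:R != 0 :> 'F_p by apply: contraTneq na => ->; rewrite qchi0.
have /negPf -> : ~~ (p %| a%:Z)%Z.
  by apply: contra a0 => pa; rewrite -(dvdn_pcharf Fp).
case: ifP => // /existsP[x /eqP]; rewrite expr2 -PoszM !modz_nat => -[xa].
have Ea : a%:R = (x%:R : 'F_p) * x%:R.
  by rewrite -natrM -(Fp_nat_mod pp) -xa (Fp_nat_mod pp).
move: na; rewrite Ea (qchiM Fp cardF podd) (qchi_sqr cardF) //.
by apply: contraNneq a0 => x0; rewrite Ea x0 mul0r.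
Qed.

(** From [k ^ 2 <= n ^ c <= n ^ 2]. Once [n < p] is known, this keeps [k] prime to [p]. *)
Lemma represented_le (R : realType) (c : R) (n q k : nat) : 1 < c -> c <= 2 -> (0 < n)%N ->
  (0 < q)%N -> Num.floor (n%:R `^ c) = (q * k ^ 2)%N%:Z -> (k <= n)%N.
Proof.
move=> c1 c2 n0 q0 E; have h : ((q * k ^ 2)%N%:Z)%:~R <= n%:R `^ c :> R by rewrite -E floor_le.
have n2 : n%:R `^ c <= (n ^ 2)%:R :> R.
  by rewrite natrX -powR_mulrn // ler_powR // ler1n.
have := le_trans h n2; rewrite -pmulrn ler_nat => qn.
by rewrite -leq_sqr (leq_trans _ qn) // leq_pmull.
Qed.

Lemma is_Nc_exists (R : realType) (c : R) (p n : nat) : (0 < n)%N ->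
  legendre (Num.floor (n%:R `^ c)) p = -1 -> exists2 m, is_Nc c p m & (m <= n)%N.
Proof.
move=> n0 Ln; pose P m := (0 < m)%N && (legendre (Num.floor (m%:R `^ c)) p == -1).
have exP : exists m, P m by exists n; rewrite /P n0 Ln eqxx.
case: (ex_minnP exP) => m /andP[m0 /eqP Lm] mmin; exists m; last by rewrite mmin // /P n0 Ln eqxx.
by split => // k k0 Lk; rewrite mmin // /P k0 Lk eqxx.
Qed.

(** [E] composes the exponent of [Y] in terms of [p] with that of [n] in terms of [Y]. As
    [1 / (2 - c) <= 4 / 3], the terms in [del] add up to less than [del]. *)
Lemma exponent_bound (R : realType) (c eps del : R) : 1 < c -> c < 5 / 4 -> 0 < del ->
  del <= 1 / 16 -> del <= eps ->
  let E := (burgess_exponent R + del / 4) * (1 / (2 - c) + del) in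
  E <= 1 / (4 * (2 - c) * Num.sqrt (expR 1)) + eps /\ E <= 1 / 2.
Proof.
move=> c1 c5 d0 d16 de E; have [b0 b3] := burgess_exponent_bounds R.
have -> : 1 / (4 * (2 - c) * Num.sqrt (expR 1)) = burgess_exponent R * (1 / (2 - c)).
  by rewrite /burgess_exponent !div1r -invfM mulrAC.
have w0 : 0 < 1 / (2 - c) by rewrite divr_gt0 // subr_gt0; lra.
have w1 : 1 / (2 - c) <= 4 / 3 by rewrite ler_pdivrMr ?subr_gt0; lra.
rewrite /E; move: (1 / (2 - c)) (burgess_exponent R) w0 w1 b0 b3 => w b w0 w1 b0 b3.
have h1 : b * w <= 3 / 16 * (4 / 3) by apply: ler_pM => //; apply: ltW.
have h2 : del * w <= del * (4 / 3) by rewrite ler_pM2l.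
have h3 : del * b <= del * (3 / 16) by rewrite ler_pM2l // ltW.
have h4 : del * del <= del * (1 / 16) by rewrite ler_pM2l.
split; nra.
Qed.

Theorem theorem2p3 (R : realType) (kappa lambda c : R) :
  exponent_pair kappa lambda ->
  1 < c -> c < 1 + (1 - lambda) / (2 * kappa - lambda + 3) ->
  forall eps : R, 0 < eps ->
  exists p0 : nat, forall p : nat, prime p -> (p0 <= p)%N ->
  exists n : nat, is_Nc c p n /\
    n%:R <= p%:R `^ (1 / (4 * (2 - c) * Num.sqrt (expR 1)) + eps).
Proof.
move=> EP c1 cl eps e0; have [k0 k2 l2 l1 _] := EP.
have c5 : c < 5 / 4.
  apply: lt_le_trans cl _; have -> : 5 / 4 = 1 + 1 / 4 :> R by field.
  by rewrite lerD2l ler_pdivrMr; lra.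
pose del := Num.min eps (1 / 16); have d0 : 0 < del by rewrite lt_min e0 divr_gt0.
have d16 : del <= 1 / 16 by rewrite ge_min lexx orbT.
have de : del <= eps by rewrite ge_min lexx.
have [E1 E2] := exponent_bound c1 c5 d0 d16 de.
have [xi xi0 [Y0 _ sparse]] := sparse_exceptions EP c1 cl d0.
(* [nonres_block_near] wants an exponent at most 1; lowering [xi] only raises the number of
   nonresidues it guarantees. *)
pose x := Num.min xi 1; have x0 : 0 < x by rewrite lt_min xi0 ltr01.
have x1 : x <= 1 by rewrite ge_min lexx orbT.
have xxi : x <= xi by rewrite ge_min lexx.
have d4 : 0 < del / 4 by rewrite divr_gt0.
have d416 : del / 4 <= 1 / 16 by move: d16 d0; lra.
have [e ep0 [N1 _ block]] := nonres_block_near d4 d416 x0 x1.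
have [N2 _ large] := powR_ge_near (Num.max Y0%:R 1 : R) ep0.
exists (maxn 3 (maxn N1 N2)) => p pp; rewrite !geq_max => /and3P[p3 pN1 pN2].
have podd : odd p by case: (even_prime pp) p3 => // ->.
have p1 : 1 < p%:R :> R by rewrite ltr1n prime_gt1.
have [Y [Ylo Yhi Ycount]] := block p pN1 pp.
have := le_trans (large p pN2) Ylo; rewrite ge_max ler_nat ler1n => /andP[YY0 Y1].
have few := sparse Y YY0.
(* Pigeonhole: the block has more nonresidues than integers that are not represented. *)
have [q [qY nq rq]] : exists q, [/\ q \in dyadic_block Y, nonres p q &
    represented c (Y%:R `^ (1 / (2 - c) + del)) q].
  apply: contrapT => none.
  have : (count (nonres p) (dyadic_block Y))%:R <= Y%:R `^ (1 - xi) :> R.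
    apply: le_trans few; rewrite ler_nat -/(dyadic_block Y).
    rewrite -!size_filter uniq_leq_size ?filter_uniq ?iota_uniq // => q.
    rewrite !mem_filter => /andP[nq qY]; rewrite qY andbT; apply/asboolP => rq.
    by apply: none; exists q; split.
  apply/negP; rewrite -ltNge; apply: le_lt_trans Ycount.
  by rewrite ler_powR ?ler1n // lerD2l lerN2.
have q0 : (0 < q)%N by move: qY; rewrite mem_index_iota => /andP[/(leq_ltn_trans (leq0n _))].
have [n [k [kp n0 nB En]]] := rq.
have np : n%:R <= p%:R `^ ((burgess_exponent R + del / 4) * (1 / (2 - c) + del)) :> R.
  apply: le_trans nB _; rewrite powRrM ge0_ler_powR ?nnegrE ?powR_ge0 //.
  by rewrite addr_ge0 ?(ltW d0) // divr_ge0 // subr_ge0; move: c5; lra.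
(* With [k <= n] this gives [k < p], so the square [k ^ 2] does not alter the character of [q]. *)
have nlt : (n < p)%N.
  rewrite -(ltr_nat R); apply: le_lt_trans np (le_lt_trans (ler_powR (ltW p1) E2) _).
  have pR0 : 0 < p%:R :> R by apply: lt_trans p1.
  by rewrite -ltr_ln ?posrE ?powR_gt0 // ln_powR; have := ln_gt0 p1; lra.
have kn : (k <= n)%N by apply: represented_le En => //; move: c5; lra.
have Ln : legendre (Num.floor (n%:R `^ c)) p = -1.
  rewrite En; apply: legendre_nonres => //.
  have k0F : k%:R != 0 :> 'F_p.
    by rewrite (natF_neq0 (pchar_Fp pp)) // prime_gt0 //= (leq_ltn_trans kn).
  rewrite /nonres natrM natrX expr2 !(qchiM (pchar_Fp pp) (card_Fp pp) podd).
  by rewrite (qchi_sqr (card_Fp pp) k0F) mulr1.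
have [m Nm mn] := is_Nc_exists n0 Ln; exists m; split => //.
apply: le_trans (le_trans np (ler_powR (ltW p1) E1)); by rewrite ler_nat.
Qed.
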